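(* Let $P\subset\mathbb N$ be the set of primes, let $\delta=\delta_P$ be the conformal dimension of the prime Gauss IFS, and let $\mu=\mu_P$ be its conformal measure. Let $\psi$ be a doubling dimension function such that $\Psi(r)=r^{-\delta}\psi(r)$ is monotonic. Fix $\lambda>1$. Then $\mathcal H^\psi(\mu)=0$ if the series \[ \sum_{k=1}^\infty \frac{y^{\frac{1-2\delta}{1-\delta}}}{(\log y)^{\frac{\delta}{1-\delta}}}\Big|_{y=\Psi(\lambda^{-k})} \] diverges, and $\mathcal H^\psi(\mu)=\infty$ if it converges. (Convergence or divergence of this series does not depend on the choice of $\lambda>1$.)
   Context: For $E\subset\mathbb N$ and $a\in E$ let $\phi_a(x)=1/(a+x)$ on $[0,1]$. Let $E^*=\bigcup_{n\ge0}E^n$ be the finite words; for $\omega\in E^*$ put $\phi_\omega=\phi_{\omega_1}\circ\cdots\circ\phi_{\omega_{|\omega|}}$, $\|\phi_\omega'\|=\sup_{x\in[0,1]}|\phi_\omega'(x)|$, and the cylinder $[\omega]=\phi_\omega([0,1])$. The coding map $\pi:E^{\mathbb N}\to(0,1)$ is $\pi((a_n))=[0;a_1,a_2,\dots]$ (continued fraction), and $\Lambda_E=\pi(E^{\mathbb N})$. The pressure is $\mathrm P_E(s)=\lim_{n\to\infty}\frac1n\log\sum_{\omega\in E^n}\|\phi_\omega'\|^s$; the system is regular if there is $\delta_E$ with $\mathrm P_E(\delta_E)=0$, and then the conformal measure $\mu_E$ is the unique Borel probability measure on $\Lambda_E$ with $\mu_E(A)=\sum_{a\in E}\int_{\phi_a^{-1}(A)}|\phi_a'(x)|^{\delta_E}\,d\mu_E(x)$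 for all Borel $A\subset[0,1]$. For $E=P$ (primes) this system is regular and $1/2<\delta_P<1$ ($\delta_P\approx0.657$). A dimension function is a continuous increasing $\psi:(0,\infty)\to(0,\infty)$ with $\psi(r)\to0$ as $r\to0$; it is doubling if for every $C_1\ge1$ there is $C_2\ge1$ with $C_2^{-1}\le\psi(x)/\psi(y)\le C_2$ whenever $C_1^{-1}\le x/y\le C_1$. $\mathcal H^\psi$ is the $\psi$-dimensional Hausdorff measure, and for a locally finite Borel measure $\mu$ on $\mathbb R$, $\mathcal H^\psi(\mu)=\inf\{\mathcal H^\psi(A):\mu(\mathbb R\setminus A)=0\}$. *)

(* Defs.v *)
From HB Require Import structures.
From mathcomp Require Import all_boot all_order all_algebra.
From mathcomp Require Import all_classical all_reals all_analysis.
Set Implicit Arguments. Unset Strict Implicit. Unset Printing Implicit Defensive.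
Import Order.TTheory GRing.Theory Num.Theory.
Import numFieldNormedType.Exports.
Local Open Scope classical_set_scope.
Local Open Scope ring_scope.

Section Defs.
Variable R : realType.

Definition gphi (a : nat) : R -> R := fun x => 1 / (a%:R + x).

Definition gphiw (w : seq nat) : R -> R := foldr (fun a f => gphi a \o f) id w.

Definition dnorm (w : seq nat) : R :=
  sup [set `|derive1 (gphiw w) x| | x in `[0, 1]].

Definition words (E : set nat) (n : nat) : set (seq nat) :=
  [set w | size w = n /\ forall i, i \in w -> E i].

Definition Zsum (E : set nat) (s : R) (n : nat) : \bar R :=
  (\esum_(w in words E n) ((dnorm w) `^ s)%:E)%E.

Definition pressure_is (E : set nat) (s l : R) : Prop :=
  (forall n, (Zsum E s n.+1 < +oo)%E) /\
  (fun n => ln (fine (Zsum E s n.+1)) / n.+1%:R) @ \oo --> l.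

(* the limit set Lambda_E = pi(E^N), pi(a) = [0;a_1,a_2,...] = lim_n phi_{a|n}(0) *)
Definition limset (E : set nat) : set R :=
  [set x | exists a : nat -> nat, (forall i, E (a i)) /\
     (fun n => gphiw (mkseq a n) 0) @ \oo --> x].

Definition conformal (E : set nat) (s : R) (mu : probability R R) : Prop :=
  mu (~` limset E) = 0%E /\
  forall A : set R, measurable A -> A `<=` `[0, 1] ->
    mu A = (\esum_(a in E)
              \int[mu]_(x in `[0%R, 1%R] `&` gphi a @^-1` A)
                 ((`|derive1 (gphi a) x|) `^ s)%:E)%E.

Definition dimension_function (psi : R -> R) : Prop :=
  {in `]0, +oo[, continuous psi} /\
  (forall x y, 0 < x -> x <= y -> psi x <= psi y) /\
  (forall x, 0 < x -> 0 < psi x) /\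
  psi x @[x --> 0^'+] --> 0.

Definition doubling (psi : R -> R) : Prop :=
  forall C1 : R, 1 <= C1 -> exists C2 : R, 1 <= C2 /\
    forall x y, 0 < x -> 0 < y -> C1^-1 <= x / y <= C1 ->
      C2^-1 <= psi x / psi y <= C2.

Definition diam (U : set R) : R := sup [set `|x - y| | x in U & y in U].

(* psi extended by psi(0) = 0 (its limit at 0) *)
Definition psi0 (psi : R -> R) (r : R) : R := if 0 < r then psi r else 0.

Definition hausdorff_eps (psi : R -> R) (eps : R) (A : set R) : \bar R :=
  ereal_inf [set (\sum_(0 <= i <oo) (psi0 psi (diam (U i)))%:E)%E |
    U in [set U : nat -> set R | A `<=` \bigcup_i U i /\
           forall i x y, U i x -> U i y -> `|x - y| <= eps]].

(* H^psi(A) = lim_{eps -> 0} H^psi_eps(A) = sup_{eps > 0} H^psi_eps(A) *)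
Definition hausdorff (psi : R -> R) (A : set R) : \bar R :=
  ereal_sup [set hausdorff_eps psi eps A | eps in `]0, +oo[].

Definition hausdorff_measure_of (psi : R -> R) (mu : probability R R) : \bar R :=
  ereal_inf [set hausdorff psi A | A in [set A | measurable A /\ mu (~` A) = 0%E]].

Definition series_term (d y : R) : R :=
  y `^ ((1 - 2 * d) / (1 - d)) / (ln y) `^ (d / (1 - d)).

(* the series sum_k term(y_k) converges: its terms are eventually defined
   (y_k > 1) and its tail has finite sum *)
Definition series_converges (d : R) (y : nat -> R) : Prop :=
  exists K : nat, (forall k, (K <= k)%N -> 1 < y k) /\
    (\sum_(K <= k <oo) (series_term d (y k))%:E < +oo)%E.

End Defs.

Definition primes_set : set nat := [set p | prime p].

(* Main.v *)
(* Let Q_n be the denominators of the convergents of x. Conformality and bounded distortion give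
   each cylinder of a word w the measure Q_w^(-2 delta), up to constants, and so, by Chebyshev's
   estimates, the event a_(n+1) >= 2^m has conditional measure comparable to
   tau(m) = 2^(m (1 - 2 delta)) / m. At scale r ~ Q_n^(-2) / a_(n+1), where the sparsity of the
   primes is felt, mu(B(x, r)) / r^delta can reach, but not exceed, the order of
   g(m) = 2^(m (1 - delta)) / m with m = log2 a_(n+1); when y ~ g(m), the term of the series is
   comparable to tau(m). Choose m_n least such that g(m_n) exceeds a large multiple of
   y_k, for k comparable to n.
   If the series converges, Borel-Cantelli gives a_(n+1) < 2^(m_n) for all large n, off a set of
   small measure, hence mu(B(x, r)) <= epsilon psi(r) for small r, and the mass distribution
   principle makes every set of full measure have infinite Hausdorff measure.
   If it diverges, almost every x satisfies a_(n+1) >= 2^(m_n) infinitely often (the conditional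
   measures are bounded below independently of the past); by a Chernoff bound the denominators grow
   at most exponentially, so psi is controlled at the scales Q_n^(-2) 2^(-m_n), and the union of
   the subcylinders with last letter >= 2^(m_n), taken at first hits, covers efficiently. *)
Require Import Defs.
From HB Require Import structures.
From mathcomp Require Import all_boot all_order all_algebra.
From mathcomp Require Import all_classical all_reals all_analysis measurable_realfun.
From mathcomp Require Import zify ring lra.
Set Implicit Arguments. Unset Strict Implicit. Unset Printing Implicit Defensive.

(** * Counting primes *)

(** The upper bound for balls rests on counting primes in windows. Around a letter [a], a ball of
    relative radius [rho] sees a window of length [k] about [rho a^2]. A sieve would give
    [k / log k] primes, but [k^d a^(1 - d) / log a] already yields the order [rho^d g(log2 a)], the
    worst window being as long as [a] itself. This weaker count is elementary: the primes of the
    window divide one binomial coefficient, whose logarithm is at most [k (1 + log (n / k))], and a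
    power of [n / k] dominates the logarithm. Letters are at least 2, so the dynamics lives on
    [[0, 1/2]]; cylinders of a level are then separated by definite gaps, and a small ball meets
    only one of them. The series is indexed by scales [lambda^-k], words by their length [n]. An
    integer factor [L] links the two: [k] is [n / L] rounded down in the convergence half and [L n]
    in the divergence half. *)

Definition nprimes (a b : nat) : nat := count prime (index_iota a b).

Lemma nprimesE a b : nprimes a b = \sum_(a <= p < b | prime p) 1.
Proof. by rewrite /nprimes sum1_count. Qed.

Lemma nprimes_cat a b c : a <= b -> b <= c -> nprimes a c = nprimes a b + nprimes b c.
Proof. by move=> ab bc; rewrite !nprimesE (big_cat_nat ab bc). Qed.

Lemma prime_dvd_fact p n : prime p -> p %| n`! -> p <= n.
Proof.
move=> pp; elim: n => [|n IH]; first by rewrite fact0 dvdn1 => /eqP p1; rewrite p1 in pp.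
rewrite factS Euclid_dvdM// => /orP[/dvdn_leq-> //|/IH/leqW//].
Qed.

Lemma prime_dvd_bin p n k : prime p -> k <= n -> p <= n -> n - k < p -> k < p -> p %| 'C(n, k).
Proof.
move=> pp kn pn nkp kp.
have : p %| n`! by rewrite dvdn_fact// prime_gt0.
rewrite -(bin_fact kn) Euclid_dvdM// => /orP[//|].
rewrite Euclid_dvdM// => /orP[] /(prime_dvd_fact pp); lia.
Qed.

Lemma prod_primes_dvd (a b m : nat) :
  (forall p, prime p -> a <= p < b -> p %| m) ->
  \prod_(a <= p < b | prime p) p %| m.
Proof.
elim: b => [|b IH] h; first by rewrite big_geq// dvd1n.
have [ab|ab] := leqP a b; last by rewrite big_geq// dvd1n.
rewrite big_mkcond big_nat_recr//= -big_mkcond/=.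
have IH' : \prod_(a <= p < b | prime p) p %| m.
  by apply: IH => p pp /andP[ap pb]; apply: h => //; rewrite ap ltnW.
case: ifPn => pb; last by rewrite muln1.
rewrite Gauss_dvd ?IH' ?h ?ab ?leqnn//.
rewrite coprime_sym big_seq_cond.
apply: (big_ind (fun m => coprime b m)).
- exact: coprimen1.
- by move=> x y bx by_; rewrite coprimeMr bx by_.
move=> i; rewrite mem_index_iota => /andP[/andP[ai ib] pi].
rewrite prime_coprime// dvdn_prime2//; apply/eqP; lia.
Qed.

(* Every prime of [L, n] divides 'C(n, k), as it divides n! but neither k! nor (n - k)!. *)
Lemma expn_nprimes_leq_bin L n k : k <= n -> k < L -> n - k < L ->
  L ^ nprimes L n.+1 <= 'C(n, k).
Proof.
move=> kn kL nkL.
apply: (@leq_trans (\prod_(L <= p < n.+1 | prime p) p)).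
  rewrite nprimesE expn_sum.
  rewrite (big_nat_cond _ _ L) [leqRHS]big_nat_cond; apply: leq_prod.
  by move=> p /andP[/andP[Lp _] _]; rewrite expn1.
apply: dvdn_leq; first by rewrite bin_gt0.
apply: prod_primes_dvd => p pp /andP[Lp pn].
by apply: prime_dvd_bin => //; [exact: leq_trans nkL _|exact: leq_trans kL _].
Qed.

Lemma bin_leq_exp2 n k : 'C(n, k) <= 2 ^ n.
Proof.
have [nk|kn] := ltnP n k; first by rewrite bin_small.
have := expnDn 1 1 n; rewrite addn1 => ->.
have kn' : k < n.+1 by [].
rewrite (bigD1 (Ordinal kn'))//= !exp1n !muln1; exact: leq_addr.
Qed.

(** The binomial bound with [L = 2^j + 1], [n = 2^(j+1)] and [k = 2^j] gives
    [(2^j)^N <= 2^(2^(j+1))]. The left end is dropped to have [k < L]; nothing is lost, since [2^j]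
    is not prime for [j >= 2]. *)
Lemma nprimes_dyadic_le j : nprimes (2 ^ j) (2 ^ j.+1) * j <= 2 ^ j.+1.
Proof.
case: j => [|[|j]]; [by rewrite muln0|by []|].
have h1 : 2 ^ j.+2 < 2 ^ j.+3 by rewrite ltn_exp2l.
have -> : nprimes (2 ^ j.+2) (2 ^ j.+3) = nprimes (2 ^ j.+2).+1 (2 ^ j.+3).
  rewrite !nprimesE big_ltn_cond//.
  suff -> : prime (2 ^ j.+2) = false by [].
  apply/negbTE/primePn; right; exists 2; last by rewrite expnS dvdn_mulr.
  by rewrite /= -{1}(expn1 2) ltn_exp2l.
have h2 : nprimes (2 ^ j.+2).+1 (2 ^ j.+3) <= nprimes (2 ^ j.+2).+1 (2 ^ j.+3).+1.
  rewrite (@nprimes_cat _ (2 ^ j.+3) (2 ^ j.+3).+1)//; exact: leq_addr.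
apply: (leq_trans (leq_mul h2 (leqnn _))).
rewrite -(@leq_exp2l 2)// mulnC expnM.
apply: leq_trans (bin_leq_exp2 (2 ^ j.+3) (2 ^ j.+2)).
apply: leq_trans (@expn_nprimes_leq_bin (2 ^ j.+2).+1 (2 ^ j.+3) (2 ^ j.+2) _ _ _) => //.
- case: (nprimes _ _) => [|N]; first by rewrite !expn0.
  by rewrite leq_exp2r.
- by apply: ltnW.
- by rewrite ltnS expnS; lia.
Qed.

(** Adding one dyadic block reproduces the constant 4, because [4 / k + 2 / k <= 8 / (k + 1)] once
    [k >= 3]; the small cases are computed. *)
Lemma primepi_exp2_le k : 0 < k -> nprimes 0 (2 ^ k) * k <= 4 * 2 ^ k.
Proof.
case: k => [//|[|[|[|k]]]] _; [by []|by []|by []|].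
elim: k => [|k IH]; first by [].
have := nprimes_dyadic_le k.+4.
rewrite (@nprimes_cat 0 (2 ^ k.+4))//; last by rewrite leq_exp2l.
  move: IH; rewrite !(expnS 2 k.+4).
  move: (nprimes 0 _) => a; move: (nprimes _ _) => b; move: (2 ^ _) => c; nia.
Qed.

Lemma expn2_leq_central_bin n : 2 ^ n <= 'C(n.*2, n).
Proof.
elim: n => [//|n IH]; rewrite doubleS binS expnS mul2n -addnn.
have e : 'C(n.*2.+1, n.+1) = 'C(n.*2.+1, n).
  rewrite -bin_sub; last lia.
  by congr 'C(_, _); lia.
suff h : 2 ^ n <= 'C(n.*2.+1, n) by rewrite e leq_add.
by apply: leq_trans IH _; case: (n) => [//|m]; rewrite binS leq_addr.
Qed.

(** Legendre's formula: a power [p^k <= 2 n] adds at most 1 to the exponent, the integer part of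
    [2 n / p^k] being at most one more than twice that of [n / p^k], and there are [M] such
    powers. *)
Lemma logn_central_bin p n : prime p -> 0 < n -> p ^ logn p 'C(n.*2, n) <= n.*2.
Proof.
move=> pp n0.
have nn : n <= n.*2 by lia.
have E : logn p n.*2`! = logn p 'C(n.*2, n) + (logn p n`! + logn p n`!).
  rewrite -(bin_fact nn) lognM ?bin_gt0 ?muln_gt0 ?fact_gt0//.
  by rewrite lognM ?fact_gt0//; congr (_ + (_ + logn _ _`!)); lia.
set M := trunc_log p n.*2.
have lt k : M < k -> n.*2 < p ^ k.
  move=> Mk; apply: leq_trans (trunc_log_ltn _ (prime_gt1 pp)) _.
  by rewrite leq_exp2l// prime_gt1.
suff lM : logn p 'C(n.*2, n) <= M.
  apply: leq_trans (_ : p ^ M <= _); first by rewrite leq_exp2l// prime_gt1.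
  by rewrite trunc_logP ?prime_gt1//; lia.
have fE m : m <= n.*2 -> logn p m`! = \sum_(1 <= k < n.*2.+1) m %/ p ^ k.
  move=> mn; rewrite logn_fact// (@big_cat_nat _ _ _ m.+1 1 n.*2.+1)//=.
  rewrite [X in _ = _ + X]big1_seq ?addn0// => k; rewrite mem_index_iota => /andP[_ /andP[mk _]].
  rewrite divn_small//; apply: leq_trans mk _.
  by apply: ltnW; exact: ltn_expl _ (prime_gt1 pp).
have Mn : M <= n.*2 by apply: ltnW; apply: leq_trans (ltn_expl _ (prime_gt1 pp)) _; rewrite trunc_logP ?prime_gt1//; lia.
have : logn p n.*2`! <= M + (logn p n`! + logn p n`!).
  rewrite !fE// -!big_split/=.
  rewrite (@big_cat_nat _ _ _ M.+1 1 n.*2.+1)//= [X in _ <= _ + X](@big_cat_nat _ _ _ M.+1 1 n.*2.+1)//=.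
  rewrite [X in _ + X <= _]big1_seq ?addn0; last first.
    by move=> k; rewrite mem_index_iota => /andP[_ /andP[Mk _]]; rewrite divn_small// lt.
  rewrite addnA (leq_trans _ (leq_addr _ _))//.
  have EM : \sum_(1 <= k < M.+1) 1 = M by rewrite sum_nat_const_nat muln1 subn1.
  rewrite -[X in _ <= X + _]EM.
  rewrite -big_split/=; apply: leq_sum => k _.
  have pk : 0 < p ^ k by rewrite expn_gt0 prime_gt0.
  have := divn_eq n (p ^ k); have := ltn_pmod n pk.
  move: (p ^ k) pk (n %/ _) (n %% _) => d d0 q r rd ->.
  rewrite (_ : (q * d + r).*2 = q.*2 * d + r.*2); last nia.
  rewrite divnMDl// -addnn; have : r.*2 %/ d < 2 by rewrite ltn_divLR//; lia.
  lia.
rewrite E; lia.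
Qed.

Lemma primepi_exp2_ge K : 0 < K -> 2 ^ K.-1 <= nprimes 0 (2 ^ K).+1 * K.
Proof.
case: K => [//|K] _; set n := 2 ^ K.
have n0 : 0 < n by rewrite expn_gt0.
have n2 : 2 ^ K.+1 = n.*2 by rewrite expnS mul2n.
rewrite -(@leq_exp2l 2)//=; apply: leq_trans (expn2_leq_central_bin n) _.
have C0 : 0 < 'C(n.*2, n) by rewrite bin_gt0; lia.
rewrite -(partnT C0) mulnC expnM n2 nprimesE expn_sum.
have -> : ('C(n.*2, n))`_predT = \prod_(0 <= p < n.*2.+1 | prime p) p ^ logn p 'C(n.*2, n).
  rewrite (@widen_partn ('C(n.*2, n) + n.*2)) ?leq_addr//.
  rewrite (@big_cat_nat _ _ _ n.*2.+1)//=; last by rewrite ltnS leq_addl.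
  rewrite [X in _ * X]big1_seq ?muln1; last first.
    move=> p; rewrite mem_index_iota => /andP[_ /andP[np _]].
    have [pp|/negbTE pp] := boolP (prime p); last by rewrite /logn pp.
    rewrite lognE pp C0/=; case: ifP => // pC.
    have : p %| n.*2`! by rewrite -(@bin_fact n.*2 n) ?dvdn_mulr//; lia.
    by move=> /(prime_dvd_fact pp); lia.
  rewrite [RHS]big_mkcond/=; apply: eq_bigr => p _.
  by case: ifPn => // /negbTE pp; rewrite /logn pp.
apply: leq_prod => p pp; rewrite expn1; exact: logn_central_bin.
Qed.

(** A block of ratio 2 is too short for the available constants: there are at least
    [8 2^m / (m + 4)] primes up to [2^(m + 4)], and up to [4 2^m / m] of them may lie below [2^m].
    Ratio 16 leaves a margin: failure would give [8 m <= 5 (m + 4)], false for [m >= 8]. *)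
Lemma nprimes_long_dyadic_ge m : 8 <= m -> 2 ^ m <= nprimes (2 ^ m) (2 ^ (m + 4)) * m.
Proof.
move=> m8.
have l0 : 2 ^ m <= 2 ^ (m + 4) by rewrite leq_exp2l//; lia.
have np : nprimes 0 (2 ^ (m + 4)).+1 = nprimes 0 (2 ^ (m + 4)).
  rewrite (@nprimes_cat 0 (2 ^ (m + 4)))//; rewrite [X in _ + X]nprimesE.
  rewrite big_mkcond big_nat1; have -> : prime (2 ^ (m + 4)) = false; last by rewrite addn0.
  apply/negbTE/primePn; right; exists 2; last by rewrite addnS expnS dvdn_mulr.
  by rewrite /= -{1}(expn1 2) ltn_exp2l//; lia.
have := @primepi_exp2_ge (m + 4); have := @primepi_exp2_le m.
rewrite np (@nprimes_cat 0 (2 ^ m) (2 ^ (m + 4)))// addn4/= !expnS.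
move: (nprimes 0 _) => a; move: (nprimes _ _) => b; move: (2 ^ m) => c.
move=> /(_ ltac:(lia)) am /(_ ltac:(lia)) h; rewrite leqNgt; apply/negP => yc.
have : (a * m + b * m) * m.+4 <= (5 * c) * m.+4 by rewrite leq_mul2r; lia.
have : m * (8 * c) <= m * ((a + b) * m.+4) by rewrite leq_mul2l; lia.
have : 0 < c by lia.
clear -m8 yc; nia.
Qed.

Import Order.TTheory GRing.Theory Num.Theory.
Import numFieldNormedType.Exports.
Local Open Scope classical_set_scope.
Local Open Scope ring_scope.

(** * Gauge, tail weight and the terms of the series *)

Lemma ln2_gt0 (R : realType) : 0 < ln (2 : R).
Proof. by rewrite ln_gt0// ltr1n. Qed.
#[local] Hint Extern 0 (is_true (0 < ln 2)) => solve [apply: ln2_gt0] : core.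

Section Gauge.
Variables (R : realType) (d : R).
Hypotheses (d_gt : 2^-1 < d) (d_lt1 : d < 1).

Lemma powR_expR (a x : R) : 0 < a -> a `^ x = expR (x * ln a).
Proof. by move=> a0; rewrite /powR gt_eqF. Qed.

(* Up to constant factors, [tailw m] is the sum of [p `^ (- 2 * d)] over the primes [p >= 2 ^ m], and
   it equals [series_term d (gauge m)]. *)
Definition gauge (m : nat) : R := expR (m%:R * ((1 - d) * ln 2)) / m%:R.
Definition tailw (m : nat) : R := expR (- (m%:R * ((2 * d - 1) * ln 2))) / m%:R.

Let b_gt0 : 0 < (1 - d) * ln 2.
Proof. by rewrite mulr_gt0// subr_gt0. Qed.

Lemma gauge_gt0 m : (0 < m)%N -> 0 < gauge m.
Proof. by move=> m0; rewrite divr_gt0 ?expR_gt0// ltr0n. Qed.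

Lemma tailw_gt0 m : (0 < m)%N -> 0 < tailw m.
Proof. by move=> m0; rewrite divr_gt0 ?expR_gt0// ltr0n. Qed.

Let p := (2 * d - 1) / (1 - d).
Let f := d / (1 - d).

Let d1_neq0 : 1 - d != 0.
Proof. by rewrite gt_eqF// subr_gt0. Qed.

Let p_gt0 : 0 < p.
Proof. by rewrite divr_gt0 ?subr_gt0//; have := d_gt; lra. Qed.

Let f_gt0 : 0 < f.
Proof. by rewrite divr_gt0 ?subr_gt0//; have := d_gt; lra. Qed.

(** The exponents of the series are tuned for this: at [y = e^(m b) / m] the factor [y^(-p)] brings
    [m^p], the factor [(ln y)^(-f)] about [m^(-f)], and their product [1 / m] is the density of the
    primes near [2^m]. *)
Let pf : p - f = -1.
Proof. by rewrite /p /f; field. Qed.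

Let pb : p * ((1 - d) * ln 2) = (2 * d - 1) * ln 2.
Proof. by rewrite /p; field. Qed.

Lemma series_termE y : 1 < y -> series_term d y = expR (- p * ln y - f * ln (ln y)).
Proof.
move=> y1; have pE : (1 - 2 * d) / (1 - d) = - p by rewrite /p -[in RHS]mulNr opprB.
rewrite /series_term pE !powR_expR ?ln_gt0//; last exact: lt_trans y1.
by rewrite -expRN -expRD.
Qed.

Lemma series_term_gt0 y : 1 < y -> 0 < series_term d y.
Proof. by move=> y1; rewrite series_termE// expR_gt0. Qed.

Lemma series_term_le x y : 1 < x -> x <= y -> series_term d y <= series_term d x.
Proof.
move=> x1 xy; have y1 : 1 < y by exact: lt_le_trans xy.
rewrite !series_termE// ler_expR lerB//.
  by rewrite !mulNr lerN2 ler_wpM2l ?(ltW p_gt0)// ler_ln ?posrE//; lra.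
rewrite ler_wpM2l ?(ltW f_gt0)// ler_ln ?posrE ?ln_gt0//.
by rewrite ler_ln ?posrE//; lra.
Qed.

Let lng m : (0 < m)%N -> ln (gauge m) = m%:R * ((1 - d) * ln 2) - ln m%:R.
Proof.
by move=> m0; rewrite ln_div ?posrE ?expR_gt0 ?ltr0n// expRK.
Qed.

Let tailwE m : (0 < m)%N -> tailw m = expR (- (m%:R * (p * ((1 - d) * ln 2))) - ln m%:R).
Proof.
by move=> m0; rewrite pb expRD expRN [in RHS]expRN lnK ?posrE ?ltr0n// -expRN.
Qed.

Lemma tailw_le_term (B : R) : 0 < B -> exists2 C, 0 < C &
  forall m y, (0 < m)%N -> 1 < y -> y <= B * gauge m -> tailw m <= C * series_term d y.
Proof.
move=> B0; set A := `|ln B| + (1 - d) * ln 2.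
have A0 : 0 < A by rewrite ltr_wpDl.
exists (expR (p * ln B + f * ln A)); first exact: expR_gt0.
move=> m y m0 y1 yB; have y0 : 0 < y by lra.
have mR0 : 0 < m%:R :> R by rewrite ltr0n.
have g0 := gauge_gt0 m0.
have lnm : 0 <= ln (m%:R : R) by rewrite ln_ge0// ler1n.
have l1 : ln y <= ln B + (m%:R * ((1 - d) * ln 2) - ln m%:R).
  by rewrite -lng// -lnM ?posrE// ler_ln ?posrE// mulr_gt0.
have l2 : ln y <= m%:R * A.
  have : `|ln B| <= m%:R * `|ln B| by rewrite ler_peMl// ler1n.
  by have := ler_norm (ln B); rewrite mulrDr; lra.
have l3 : ln (ln y) <= ln m%:R + ln A.
  by rewrite -lnM ?posrE// ler_ln ?posrE ?ln_gt0// mulr_gt0.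
rewrite series_termE// tailwE// -expRD ler_expR.
have := ler_wpM2l (ltW p_gt0) l1; have := ler_wpM2l (ltW f_gt0) l3.
have E : ln m%:R = f * ln m%:R - p * ln (m%:R : R).
  by rewrite -mulrBl -(opprB p) pf opprK mul1r.
by move: E; move: (ln (ln y)) (ln y) => z w; lra.
Qed.

(** For small [m] the bound [B * gauge m <= y] alone would allow [y] near or below 1, where [ln y]
    degenerates; [2 <= y] keeps [ln y] above [ln 2]. *)
Lemma term_le_tailw (B : R) : 0 < B -> exists2 C, 0 < C &
  forall m y, (0 < m)%N -> 2 <= y -> B * gauge m <= y -> series_term d y <= C * tailw m.
Proof.
move=> B0; set b := (1 - d) * ln 2; set L := `|ln B| + `|ln (b / 2)|.
have L0 : 0 <= L by rewrite addr_ge0.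
(* The term [ln m] costs at most half of [m b], up to [ln (b / 2)], and the leftover constant [L] is
   at most [L / ln 2] times [ln y]; hence [m c <= ln y]. *)
set c := (b / 2) / (1 + L / ln 2).
have q0 : 0 < 1 + L / ln 2 by rewrite ltr_pwDl// divr_ge0// ltW.
have c0 : 0 < c by rewrite divr_gt0// divr_gt0.
exists (expR (- p * ln B - f * ln c)); first exact: expR_gt0.
move=> m y m0 y2 yB; have y0 : 0 < y by lra.
have mR0 : 0 < m%:R :> R by rewrite ltr0n.
have g0 := gauge_gt0 m0.
have l1 : ln B + (m%:R * b - ln m%:R) <= ln y.
  by rewrite -lng// -lnM ?posrE// ler_ln ?posrE// mulr_gt0.
have lny : ln 2 <= ln y by rewrite ler_ln ?posrE.
have l2 : m%:R * c <= ln y.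
  rewrite /c mulrA ler_pdivrMr//.
  have h : ln (m%:R * (b / 2)) < m%:R * (b / 2) by rewrite ln_sublinear// mulr_gt0// divr_gt0.
  rewrite lnM ?posrE ?divr_gt0// in h.
  have : L <= L / ln 2 * ln y by rewrite mulrAC ler_pdivlMr// ler_wpM2l.
  have := ler_norm (- ln B); have := ler_norm (- ln (b / 2)); rewrite !normrN /L.
  rewrite mulrDr mulr1 (mulrC (ln y)); lra.
have l3 : ln m%:R + ln c <= ln (ln y).
  have lny0 : 0 < ln y by rewrite ln_gt0//; lra.
  by rewrite -lnM ?posrE// ler_ln ?posrE// mulr_gt0.
rewrite series_termE ?tailwE//; last lra.
rewrite -expRD ler_expR -/b.
have := ler_wpM2l (ltW p_gt0) l1; have := ler_wpM2l (ltW f_gt0) l3.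
have E : ln m%:R = f * ln m%:R - p * ln (m%:R : R).
  by rewrite -mulrBl -(opprB p) pf opprK mul1r.
by move: E; move: (ln (ln y)) (ln y) => z w; lra.
Qed.

(** The gauge decreases at first. The loss is bounded because [j + k <= (1 + 1 / b) (1 + k b) j] and
    [1 + k b <= e^(k b)]. *)
Lemma gauge_quasi_mono : exists2 C, 0 < C &
  forall j m, (0 < j <= m)%N -> gauge j <= C * gauge m.
Proof.
set b := (1 - d) * ln 2.
exists (1 + b^-1); first by rewrite addr_gt0 ?invr_gt0.
move=> j m /andP[j0 jm].
have jR : 0 < j%:R :> R by rewrite ltr0n.
have mR : 0 < m%:R :> R by rewrite ltr0n (leq_trans j0).
rewrite /gauge -/b ler_pdivrMr// [leRHS](_ : _ = (1 + b^-1) * j%:R * expR (m%:R * b) / m%:R); last by ring.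
rewrite ler_pdivlMr//.
have -> : m%:R = j%:R + (m - j)%:R :> R by rewrite -natrD subnKC.
rewrite (mulrDl _ _ b) expRD.
set k := (m - j)%:R; have k0 : 0 <= k by rewrite ler0n.
have := expR_ge1Dx (k * b); have E := expR_gt0 (j%:R * b).
move=> h; have h1 : j%:R + k <= (1 + b^-1) * (1 + k * b) * j%:R.
  have j1 : 1 <= j%:R :> R by rewrite ler1n.
  have -> : (1 + b^-1) * (1 + k * b) = 1 + k + b^-1 + k * b by field; rewrite gt_eqF.
  have : 0 <= b^-1 * j%:R by rewrite mulr_ge0// ?invr_ge0 ltW.
  have : 0 <= k * b * j%:R by apply: mulr_ge0 => //; apply: mulr_ge0 => //; exact: ltW b_gt0.
  have : k <= k * j%:R by apply: ler_peMr.
  by rewrite !mulrDl; lra.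
have h2 : (1 + b^-1) * (1 + k * b) * j%:R <= (1 + b^-1) * expR (k * b) * j%:R.
  by rewrite ler_pM2r// ler_pM2l// addr_gt0 ?invr_gt0.
have := le_trans h1 h2; rewrite -(ler_pM2l E) => /le_trans; apply.
by rewrite le_eqVlt; apply/orP; left; apply/eqP; ring.
Qed.

Lemma gauge_unbounded z : exists2 m, (0 < m)%N & z < gauge m.
Proof.
set b := (1 - d) * ln 2.
have b0 : 0 < b by [].
have [m hm] : exists m : nat, 4 * `|z| / b ^+ 2 < m%:R.
  by exists (Num.truncn (4 * `|z| / b ^+ 2)).+1; exact: truncnS_gt.
have m0 : 0 < m%:R :> R by apply: le_lt_trans hm; rewrite divr_ge0 ?sqr_ge0 ?mulr_ge0.
exists m; first by rewrite -(ltr0n R).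
rewrite (le_lt_trans (ler_norm z))// /gauge -/b ltr_pdivlMr//.
have -> : m%:R * b = m%:R * b / 2 + m%:R * b / 2 by field.
rewrite expRD; have h := expR_ge1Dx (m%:R * b / 2).
have q0 : 0 < m%:R * b / 2 by rewrite divr_gt0// mulr_gt0.
have : (m%:R * b / 2) * (m%:R * b / 2) < expR (m%:R * b / 2) * expR (m%:R * b / 2).
  by rewrite ltr_pM//; lra.
apply: le_lt_trans.
move: hm; rewrite ltr_pdivrMr ?exprn_gt0// => /ltW hm.
have := ler_wpM2r (ltW m0) hm; rewrite expr2; lra.
Qed.

(* From 'C(n, k) (k / n)^k <= (1 + k / n)^n <= e^k. *)
Lemma ln_bin_le (n k : nat) : (0 < k <= n)%N ->
  ln ('C(n, k)%:R : R) <= k%:R * (1 + ln (n%:R / k%:R)).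
Proof.
move=> /andP[k0 kn].
have kR : 0 < k%:R :> R by rewrite ltr0n.
have nR : 0 < n%:R :> R by rewrite ltr0n (leq_trans k0).
set x : R := k%:R / n%:R; have x0 : 0 < x by rewrite divr_gt0.
have h : 'C(n, k)%:R * x ^+ k <= expR k%:R.
  apply: (@le_trans _ _ ((1 + x) ^+ n)).
    have kn' : (k < n.+1)%N by [].
    rewrite exprDn (bigD1 (Ordinal kn'))//= expr1n mul1r [leLHS]mulr_natl lerDl.
    by apply: sumr_ge0 => i _; rewrite expr1n mul1r mulrn_wge0// exprn_ge0// ltW.
  have -> : k%:R = x *+ n :> R by rewrite -[RHS]mulr_natr /x divfK// gt_eqF.
  rewrite -mulr_natr expRM_natr lerXn2r ?nnegrE ?expR_ge0//; last exact: expR_ge1Dx.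
  by rewrite addr_ge0// ltW.
have C0 : 0 < 'C(n, k)%:R :> R by rewrite ltr0n bin_gt0.
have : ln ('C(n, k)%:R * x ^+ k) <= k%:R.
  by rewrite -[leRHS]expRK ler_ln ?posrE ?expR_gt0// mulr_gt0// exprn_gt0.
rewrite lnM ?posrE ?exprn_gt0// lnXn// -mulr_natl mulrDr mulr1.
have -> : n%:R / k%:R = x^-1 :> R by rewrite invf_div.
by rewrite lnV ?posrE//; lra.
Qed.

(** With [t = n / k >= 1] the right side is a multiple of [k t^(1 - d)], and [1 + ln t] is at most a
    constant times [t^(1 - d)]. These exponents suit the ball estimate: [n] about [a] and [k] about
    [rho a^2] give [rho^d a^(1 + d)]. *)
Lemma ln_bin_le_powR (n k : nat) : (0 < k <= n)%N ->
  ln ('C(n, k)%:R : R) <= (1 + (1 - d)^-1) * (k%:R `^ d * n%:R `^ (1 - d)).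
Proof.
move=> kn; apply: (le_trans (ln_bin_le kn)); move/andP: kn => [k0 kn].
have kR : 0 < k%:R :> R by rewrite ltr0n.
have nR : 0 < n%:R :> R by rewrite ltr0n (leq_trans k0).
set t : R := n%:R / k%:R; have t1 : 1 <= t by rewrite ler_pdivlMr// mul1r ler_nat.
have t0 : 0 < t by lra.
have -> : k%:R `^ d * n%:R `^ (1 - d) = k%:R * t `^ (1 - d).
  rewrite /t !powR_expR// -{2}(lnK kR) ln_div ?posrE// -!expRD; congr expR; ring.
rewrite mulrCA ler_pM2l// mulrDl mul1r lerD//.
  by rewrite -{1}(powRr0 t) ler_powR//; have := d_lt1; lra.
have d10 : 0 < 1 - d by have := d_lt1; lra.
rewrite mulrC ler_pdivlMr// mulrC -ln_powR ltW// ln_sublinear// powR_gt0//.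
Qed.

End Gauge.

(** * Denominators and cylinders *)

Section Words.
Variable R : realType.
Implicit Types (w v : seq nat) (a : nat) (x y : R).

Notation phi := (@gphiw R).
Notation half := (2^-1 : R).
Notation digits2 := (all (leq 2)).

(* [gden w x ^- 2] is the derivative of [phi w] at [x], up to sign. *)
Fixpoint gden w x : R :=
  if w is a :: v then (a%:R + gphiw v x) * gden v x else 1.

Lemma gphiw_cat w v x : phi (w ++ v) x = phi w (phi v x).
Proof. by elim: w => //= a w ->. Qed.

Lemma gden_cat w v x : gden (w ++ v) x = gden w (phi v x) * gden v x.
Proof. by elim: w => [|a w IH] /=; rewrite ?mul1r// IH gphiw_cat mulrA. Qed.

Lemma gphi_bounds a x : (1 < a)%N -> 0 <= x -> 0 <= gphi a x <= half.
Proof.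
move=> a2 x0; have a2R : 2 <= a%:R :> R by rewrite (ler_nat _ 2).
rewrite /gphi; apply/andP; split; first by rewrite divr_ge0//; lra.
by rewrite ler_pdivrMr; lra.
Qed.

Lemma gphiw_bounds w x : digits2 w -> 0 <= x <= half -> 0 <= phi w x <= half.
Proof.
elim: w => //= a w IH /andP[a2 w2] xh; apply: gphi_bounds => //.
by have /andP[] := IH w2 xh.
Qed.

Lemma gphiw_ge0 w x : digits2 w -> 0 <= x -> 0 <= phi w x.
Proof.
elim: w => //= a w IH /andP[a2 w2] x0.
by have /andP[] := gphi_bounds a2 (IH w2 x0).
Qed.

Lemma gden_gt0 w x : digits2 w -> 0 <= x -> 0 < gden w x.
Proof.
elim: w => //= a w IH /andP[a2 w2] x0; rewrite mulr_gt0 ?IH//.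
by rewrite ltr_wpDr ?gphiw_ge0// ltr0n (ltn_trans _ a2).
Qed.

Lemma gphiwB w x y : digits2 w -> 0 <= x -> 0 <= y ->
  `|phi w x - phi w y| = `|x - y| / (gden w x * gden w y).
Proof.
elim: w => [|a w IH] /=; first by rewrite mulr1 divr1.
move=> /andP[a2 w2] x0 y0.
have px := gphiw_ge0 w2 x0; have py := gphiw_ge0 w2 y0.
have gx := gden_gt0 w2 x0; have gy := gden_gt0 w2 y0.
have a2R : 2 <= a%:R :> R by rewrite (ler_nat _ 2).
have ax : 0 < a%:R + phi w x by lra.
have ay : 0 < a%:R + phi w y by lra.
have -> : gphi a (phi w x) - gphi a (phi w y) =
    (phi w y - phi w x) / ((a%:R + phi w x) * (a%:R + phi w y)).
  by rewrite /gphi; field; rewrite !gt_eqF.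
rewrite normrM normfV (gtr0_norm (mulr_gt0 ax ay)) distrC IH//.
by field; rewrite !gt_eqF.
Qed.

(** Continuants: [phi w] is the Moebius map [(p + p' x) / (q + q' x)]. The inequality
    [q' + p' <= q + p] is carried along because it lets [q' <= q] pass to the next letter: [(a q +
    p) - (a q' + p') = (a - 1) (q - q') + (q + p - q' - p')]. *)
Lemma gden_affine w : digits2 w -> exists q q' p p' : R,
  [/\ 0 <= q' <= q, q' + p' <= q + p &
      forall x, 0 <= x -> gden w x = q + q' * x /\ phi w x * gden w x = p + p' * x].
Proof.
elim: w => [_|a w IH /= /andP[a2 w2]].
  by exists 1, 0, 0, 1; split=> [||x x0 /=]; [lra|lra|split; [lra|rewrite /gphiw/=; lra]].
have [q [q' [p [p' [/andP[q'0 q'q] qp E]]]]] := IH w2.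
have a2R : 2 <= a%:R :> R by rewrite (ler_nat _ 2).
have h0 := E 0 (lexx 0); rewrite !mulr0 !addr0 in h0.
have p0 : 0 <= p.
  by rewrite -h0.2 mulr_ge0 ?gphiw_ge0// ltW// gden_gt0.
(* Were the new coefficient negative, the denominator, which is positive on the half-line, would
   equal -1 at the [x] below. *)
have p'0 : 0 <= a%:R * q' + p'.
  rewrite leNgt; apply/negP => n0.
  set s := a%:R * q + p.
  have s0 : 0 <= s by rewrite addr_ge0// mulr_ge0//; lra.
  set x := (s + 1) / - (a%:R * q' + p').
  have x0 : 0 <= x by rewrite divr_ge0 ?oppr_ge0 ?(ltW n0)//; lra.
  have [E1 E2] := E x x0.
  have : 0 <= gden (a :: w) x by rewrite ltW// gden_gt0//= a2.
  rewrite /= mulrDl E2 E1 (_ : _ + _ = s + (a%:R * q' + p') * x); last by rewrite /s; ring.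
  have -> : (a%:R * q' + p') * x = - (s + 1) by rewrite /x; field; rewrite lt_eqF.
  lra.
exists (a%:R * q + p), (a%:R * q' + p'), q, q'.
have : 0 <= (a%:R - 1) * (q - q') by rewrite mulr_ge0//; lra.
rewrite mulrBl mul1r mulrBr => h.
split; [by apply/andP; split; lra|lra|].
move=> x x0; have [E1 E2] := E x x0.
have px := gphiw_ge0 w2 x0.
split; first by rewrite mulrDl E2 E1; ring.
rewrite /gphi mulrA div1r mulVf ?mul1r ?E1//.
by rewrite gt_eqF//; lra.
Qed.

Lemma gden_distortion w x : digits2 w -> 0 <= x <= half ->
  gden w 0 <= gden w x <= 2 * gden w 0.
Proof.
move=> w2 /andP[x0 xh].
have [q [q' [p [p' [/andP[q'0 q'q] _ E]]]]] := gden_affine w2.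
rewrite (E x x0).1 (E 0 (lexx 0)).1 mulr0 addr0.
have : 0 <= q' * x by rewrite mulr_ge0.
have : q' * x <= q * half by rewrite ler_pM.
lra.
Qed.

Lemma gden_ge w x : digits2 w -> 0 <= x -> 2 ^+ size w <= gden w x.
Proof.
elim: w => //= a w IH /andP[a2 w2] x0; rewrite exprS ler_pM ?exprn_ge0 ?IH//.
have a2R : 2 <= a%:R :> R by rewrite (ler_nat _ 2).
by have := gphiw_ge0 w2 x0; lra.
Qed.

Lemma gden0_ge1 w : digits2 w -> 1 <= gden w 0.
Proof. by move=> w2; apply: le_trans (gden_ge w2 (lexx 0)); rewrite exprn_ege1// ler1n. Qed.

Lemma gden_rcons_bounds w a : digits2 w -> (1 < a)%N ->
  gden w 0 * a%:R <= gden (rcons w a) 0 <= 2 * gden w 0 * a%:R.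
Proof.
move=> w2 a2; have a0 : 0 < a%:R :> R by rewrite ltr0n; lia.
rewrite -cats1 gden_cat.
have -> : gden [:: a] 0 = a%:R by rewrite /= /gphiw/=; ring.
rewrite !ler_pM2r//; apply: gden_distortion => //.
by apply: (@gphiw_bounds [:: a]); rewrite /= ?a2//; apply/andP; split; lra.
Qed.

Lemma gden_cons_bounds w a : digits2 w ->
  a%:R * gden w 0 <= gden (a :: w) 0 <= (a%:R + 1) * gden w 0.
Proof.
move=> w2; have g0 := gden_gt0 w2 (lexx 0).
have /andP[] : 0 <= phi w 0 <= half by apply: gphiw_bounds => //; apply/andP; split; lra.
by move=> h1 h2 /=; rewrite !ler_pM2r//; apply/andP; split; lra.
Qed.

Lemma gphi_inj a b x y : 0 <= x <= half -> 0 <= y <= half -> (0 < a)%N -> (0 < b)%N ->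
  gphi a x = gphi b y -> a = b /\ x = y.
Proof.
move=> /andP[x0 xh] /andP[y0 yh] a0 b0; rewrite /gphi !div1r => /invr_inj E.
have aR : 0 <= a%:R :> R by []. have bR : 0 <= b%:R :> R by [].
have ab : a = b.
  have [ab|ba|//] := ltngtP a b.
    have : a.+1%:R <= b%:R :> R by rewrite ler_nat.
    by rewrite -natr1 => ?; exfalso; lra.
  have : b.+1%:R <= a%:R :> R by rewrite ler_nat.
  by rewrite -natr1 => ?; exfalso; lra.
by split=> //; move: E; rewrite ab => /addrI.
Qed.

Lemma gphiw_inj w v x y : digits2 w -> digits2 v -> size w = size v ->
  0 <= x <= half -> 0 <= y <= half -> phi w x = phi v y -> w = v /\ x = y.
Proof.
move=> + + + xh yh; elim: w v => [|a w IH] [|b v]//= /andP[a2 w2] /andP[b2 v2] [wv].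
move=> /(gphi_inj (gphiw_bounds w2 xh) (gphiw_bounds v2 yh) (ltnW a2) (ltnW b2)) [-> E].
by have [-> ->] := IH v w2 v2 wv E.
Qed.

(** Tails in [[0, 1/2]] leave [a + x] and [b + y] at least 1/2 apart. If [b + y <= 2 (a + x)], this
    gap divided by both denominators is enough; otherwise the gap is at least [(b + y) / 2]. So the
    bound involves [a] alone. *)
Lemma gphi_separation a b x y : (1 < a)%N -> (1 < b)%N -> a != b ->
  0 <= x <= half -> 0 <= y <= half ->
  (8 * a%:R ^+ 2)^-1 <= `|gphi a x - gphi b y|.
Proof.
move=> a2 b2 ab /andP[x0 xh] /andP[y0 yh].
have aR : 2 <= a%:R :> R by rewrite (ler_nat _ 2).
have bR : 2 <= b%:R :> R by rewrite (ler_nat _ 2).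
have gap : half <= `|b%:R + y - (a%:R + x)|.
  have [lab|lba|/eqP] := ltngtP a b; last by rewrite (negbTE ab).
    have : a.+1%:R <= b%:R :> R by rewrite ler_nat.
    by rewrite -natr1 => h; rewrite ger0_norm; lra.
  have : b.+1%:R <= a%:R :> R by rewrite ler_nat.
  by rewrite -natr1 => h; rewrite ler0_norm; lra.
have -> : gphi a x - gphi b y = (b%:R + y - (a%:R + x)) / ((a%:R + x) * (b%:R + y)).
  by rewrite /gphi; field; rewrite !gt_eqF//; lra.
have A0 : 0 < a%:R + x by lra.
have B0 : 0 < b%:R + y by lra.
rewrite normrM normfV (gtr0_norm (mulr_gt0 A0 B0)) ler_pdivlMr ?mulr_gt0//.
have D0 : 0 < 8 * a%:R ^+ 2 :> R by rewrite mulr_gt0// exprn_gt0//; lra.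
rewrite mulrC ler_pdivrMr//.
have [AB|AB] := leP (b%:R + y) (2 * (a%:R + x)).
  have : (a%:R + x) * (b%:R + y) <= (a%:R + x) * (2 * (a%:R + x)) by rewrite ler_pM2l.
  have : half * (8 * a%:R ^+ 2) <= `|b%:R + y - (a%:R + x)| * (8 * a%:R ^+ 2).
    by rewrite ler_pM2r.
  nra.
have h : (b%:R + y) / 2 <= `|b%:R + y - (a%:R + x)| by rewrite ger0_norm; lra.
have : (b%:R + y) / 2 * (8 * a%:R ^+ 2) <= `|b%:R + y - (a%:R + x)| * (8 * a%:R ^+ 2).
  by rewrite ler_pM2r.
apply: le_trans.
have : 0 <= (b%:R + y) * (4 * a%:R ^+ 2 - (a%:R + x)) by rewrite mulr_ge0//; nra.
by rewrite mulrBr; lra.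
Qed.

Lemma neq_size_split w v : size w = size v -> w != v ->
  exists s a w' b v', [/\ w = s ++ a :: w', v = s ++ b :: v' & a != b].
Proof.
elim: w v => [|a w IH] [|b v]//= [wv].
have [<-{b}|ab] := eqVneq a b; last by exists [::], a, w, b, v.
rewrite eqseq_cons eqxx/= => /(IH _ wv) [s [a' [w' [b' [v' [-> -> ab]]]]]].
by exists (a :: s), a', w', b', v'.
Qed.

(** At the first disagreement the letters give 8, and the common prefix distorts by at most 2 at
    each of the two points, hence [32 = 8 * 4]. A ball of smaller radius about a point of the
    cylinder of [w] thus avoids all other cylinders of that level. *)
Lemma gphiw_separation w v x y : digits2 w -> digits2 v -> size w = size v -> w != v ->
  0 <= x <= half -> 0 <= y <= half ->
  (32 * gden w 0 ^+ 2)^-1 <= `|phi w x - phi v y|.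
Proof.
move=> + + + + xh yh => w2 v2 wv /(neq_size_split wv) [s [a [w' [b [v' [Ew Ev ab]]]]]].
move: w2 v2; rewrite Ew Ev !all_cat/= => /and3P[s2 a2 w2] /and3P[_ b2 v2].
rewrite !gphiw_cat.
have X : 0 <= phi (a :: w') x <= half by apply: gphiw_bounds; rewrite //= a2.
have Y : 0 <= phi (b :: v') y <= half by apply: gphiw_bounds; rewrite //= b2.
have z0 : 0 <= (0 : R) <= half by apply/andP; split; lra.
have Z : 0 <= phi (a :: w') 0 <= half by apply: gphiw_bounds; rewrite //= a2.
rewrite gphiwB//; [|by case/andP: X|by case/andP: Y].
rewrite gden_cat.
have sep := gphi_separation a2 b2 ab (gphiw_bounds w2 xh) (gphiw_bounds v2 yh).
have s0 := gden_gt0 s2 (lexx 0).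
have /andP[sX1 sX2] := gden_distortion s2 X.
have /andP[sY1 sY2] := gden_distortion s2 Y.
have /andP[sZ1 sZ2] := gden_distortion s2 Z.
have ga : a%:R <= gden (a :: w') 0.
  have /andP[h _] := gden_cons_bounds a w2; apply: le_trans h.
  by rewrite ler_peMr// gden0_ge1.
have aR : 0 < a%:R :> R by rewrite ltr0n ltnW.
have gX : 0 < gden s (phi (a :: w') x) by lra.
have gY : 0 < gden s (phi (b :: v') y) by lra.
have gZ : 0 < gden s (phi (a :: w') 0) by lra.
move: ga; move: (gden (a :: w') 0) => D aD; have D0 : 0 < D by lra.
rewrite ler_pdivlMr ?mulr_gt0//.
apply: le_trans sep.
rewrite mulrC ler_pdivrMr ?mulr_gt0 ?exprn_gt0 ?mulr_gt0//.
rewrite [leRHS]mulrC ler_pdivlMr ?mulr_gt0 ?exprn_gt0//.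
rewrite exprMn.
have h1 : gden s (phi (a :: w') x) * gden s (phi (b :: v') y) <= 4 * gden s 0 ^+ 2.
  have -> : 4 * gden s 0 ^+ 2 = (2 * gden s 0) * (2 * gden s 0) by ring.
  by rewrite ler_pM// ltW.
have h2 : gden s 0 ^+ 2 * a%:R ^+ 2 <= gden s (phi (a :: w') 0) ^+ 2 * D ^+ 2.
  by rewrite ler_pM ?sqr_ge0// lerXn2r ?nnegrE// ltW.
have h3 : gden s (phi (a :: w') x) * gden s (phi (b :: v') y) * a%:R ^+ 2 <= 4 * gden s 0 ^+ 2 * a%:R ^+ 2.
  by rewrite ler_pM2r// exprn_gt0.
lra.
Qed.

End Words.

(** * Conformal measure of cylinders *)

Section Countable.
Local Open Scope ereal_scope.
Context (d : measure_display) (T : measurableType d) (R : realType).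
Variable mu : {measure set T -> \bar R}.

Lemma countable_bigcup_measurable (I : countType) (P : set I) (F : I -> set T) :
  (forall i, P i -> measurable (F i)) -> measurable (\bigcup_(i in P) F i).
Proof.
move=> mF; rewrite bigcup_mkcond; apply: countable_bigcupT_measurable => // i.
by case: ifPn => // /set_mem; exact: mF.
Qed.

Lemma measure_le_sum (A : set T) (F : nat -> set T) (b : nat -> R) (B : R) :
  measurable A -> (forall i, measurable (F i)) -> A `<=` \bigcup_i F i ->
  (forall i, mu (F i) <= (b i)%:E) -> (forall n, \sum_(i < n) b i <= B)%R ->
  mu A <= B%:E.
Proof.
move=> mA mF AF Fb bB; apply: (le_trans (measure_sigma_subadditive mu mF mA AF)).
apply: lime_le; first by apply: is_cvg_nneseries.
apply: nearW => n; rewrite big_mkord; apply: le_trans (_ : (\sum_(i < n) b i)%:E <= _).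
  by rewrite -sumEFin; apply: lee_sum.
by rewrite lee_fin.
Qed.

Lemma measure_bigsetU_le (A : set T) (s : seq nat) (F : nat -> set T) (b : R) :
  measurable A -> (forall i, i \in s -> measurable (F i)) ->
  A `<=` \bigcup_(i in [set` s]) F i ->
  (forall i, i \in s -> mu (F i) <= b%:E) ->
  mu A <= ((size s)%:R * b)%:E.
Proof.
move=> mA mF; elim: s A mA mF => [|i s IH] A mA mF AF Fb.
  have -> : A = set0 by apply/seteqP; split => // x /AF[].
  by rewrite measure0 mul0r.
have mi : measurable (F i) by apply: mF; rewrite mem_head.
have -> : A = (A `&` F i) `|` (A `\` F i) by rewrite setUIDK.
apply: (le_trans (measureU2 mu _ _)); [exact: measurableI|exact: measurableD|].
rewrite /= -natr1 mulrDl mul1r [(_ + b)%R]addrC EFinD; apply: leeD.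
  apply: le_trans (Fb i (mem_head _ _)); apply: le_measure; rewrite ?inE//.
  exact: measurableI.
apply: IH.
- exact: measurableD.
- by move=> j js; apply: mF; rewrite inE js orbT.
- move=> x [/AF[j /= + Fj] nF]; rewrite inE => /predU1P[ji|js]; first by rewrite -ji in nF.
  by exists j.
- by move=> j js; apply: Fb; rewrite inE js orbT.
Qed.

Definition picked (I : countType) (P : set I) (F : I -> set T) (n : nat) : set T :=
  if @pickle_inv I n is Some i then if i \in P then F i else set0 else set0.

Lemma bigcup_picked (I : countType) (P : set I) (F : I -> set T) :
  \bigcup_n picked P F n = \bigcup_(i in P) F i.
Proof.
apply/seteqP; split=> x.
  move=> [n _]; rewrite /picked; case: (pickle_inv n) => [i|//].
  by case: ifPn => // /set_mem Pi Fx; exists i.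
by move=> [i Pi Fx]; exists (pickle i) => //; rewrite /picked pickleK_inv mem_set.
Qed.

Lemma measurable_picked (I : countType) (P : set I) (F : I -> set T) n :
  (forall i, P i -> measurable (F i)) -> measurable (picked P F n).
Proof.
move=> mF; rewrite /picked; case: (pickle_inv n) => [i|//].
by case: ifPn => // /set_mem; exact: mF.
Qed.

Lemma measure_picked (I : countType) (P : set I) (F : I -> set T) :
  (forall i, P i -> measurable (F i)) -> trivIset P F ->
  mu (\bigcup_(i in P) F i) = \sum_(0 <= n <oo) mu (picked P F n).
Proof.
move=> mF tF; rewrite -bigcup_picked; apply: measure_semi_bigcup.
- by move=> n; exact: measurable_picked.
- move=> n m _ _ [x []]; rewrite /picked.
  have := @pickle_invK I n; have := @pickle_invK I m; rewrite /oapp.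
  case: (pickle_inv n) => [i|//]; case: (pickle_inv m) => [j|//] <- <-.
  case: ifPn => // /set_mem Pi Fi; case: ifPn => // /set_mem Pj Fj.
  by congr (pickle _); apply: tF => //; exists x.
- by apply: bigcupT_measurable => n; exact: measurable_picked.
Qed.

Lemma measure_bigcup_countable_le (I : countType) (P : set I) (F : I -> set T) H (k : R) :
  measurable H -> (forall i, P i -> measurable (F i)) -> trivIset P F ->
  (forall i, P i -> mu (H `&` F i) <= k%:E * mu (F i)) ->
  mu (H `&` \bigcup_(i in P) F i) <= k%:E * mu (\bigcup_(i in P) F i).
Proof.
move=> mH mF tF HF; rewrite setI_bigcupr [leLHS]measure_picked; last 2 first.
- by move=> i Pi; apply: measurableI => //; exact: mF.
- by move=> i j Pi Pj [x [[_ Fi] [_ Fj]]]; apply: tF => //; exists x.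
rewrite measure_picked// -nneseriesZl//; apply: lee_nneseries => // n _.
rewrite /picked; case: (pickle_inv n) => [i|]; last by rewrite measure0 mule0.
by case: ifPn => [/set_mem|_]; [exact: HF|rewrite measure0 mule0].
Qed.

Lemma measure_bigcup_countable_ge (I : countType) (P : set I) (F : I -> set T) H (k : R) :
  (0 <= k)%R ->
  measurable H -> (forall i, P i -> measurable (F i)) -> trivIset P F ->
  (forall i, P i -> k%:E * mu (F i) <= mu (H `&` F i)) ->
  k%:E * mu (\bigcup_(i in P) F i) <= mu (H `&` \bigcup_(i in P) F i).
Proof.
move=> k0 mH mF tF HF; rewrite setI_bigcupr [leRHS]measure_picked; last 2 first.
- by move=> i Pi; apply: measurableI => //; exact: mF.
- by move=> i j Pi Pj [x [[_ Fi] [_ Fj]]]; apply: tF => //; exists x.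
rewrite measure_picked// -nneseriesZl//; apply: lee_nneseries => n _.
  by rewrite mule_ge0// lee_fin.
rewrite /picked; case: (pickle_inv n) => [i|]; last by rewrite measure0 mule0.
by case: ifPn => [/set_mem|_]; [exact: HF|rewrite measure0 mule0].
Qed.

End Countable.

(** * Cylinders as sets and the limit set *)

Section Cylinders.
Variable R : realType.
Implicit Types (w v : seq nat) (x y : R).

Definition unit_half : set R := `[0, 2^-1]%classic.

(** The base is [[0, 1/2]] rather than [[0, 1]]: it is mapped into itself by every letter at least
    2, it contains the limit set of the primes, and it makes cylinders of equal level disjoint. *)
Definition cyl w : set R := @gphiw R w @` unit_half.

Lemma unit_halfP x : unit_half x <-> 0 <= x <= 2^-1.
Proof. by rewrite /unit_half /= in_itv/=. Qed.

Lemma unit_half0 : unit_half 0.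
Proof. by apply/unit_halfP/andP; split; lra. Qed.

Lemma words_digits n w : words primes_set n w -> all (leq 2) w.
Proof. by move=> [_ h]; apply/allP => i /h /prime_gt1. Qed.

Lemma cyl_nil : cyl [::] = unit_half.
Proof. by rewrite /cyl image_id. Qed.

Lemma cyl_cat w v : cyl (w ++ v) = @gphiw R w @` cyl v.
Proof.
rewrite /cyl image_comp; congr (_ @` _); apply/funext => x /=; exact: gphiw_cat.
Qed.

Lemma cyl_cons a v : cyl (a :: v) = @gphi R a @` cyl v.
Proof. by rewrite -cat1s cyl_cat. Qed.

Lemma cyl_sub w v : all (leq 2) v -> cyl (w ++ v) `<=` cyl w.
Proof.
move=> v2 _ [x xh <-]; exists (gphiw v x); last by rewrite gphiw_cat.
by apply/unit_halfP/gphiw_bounds => //; exact/unit_halfP.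
Qed.

Lemma cyl_unit_half w : all (leq 2) w -> cyl w `<=` unit_half.
Proof. by move=> w2; rewrite -cyl_nil; exact: (@cyl_sub [::]). Qed.

Lemma gphiw_contract w x y : all (leq 2) w -> 0 <= x -> 0 <= y ->
  `|gphiw w x - gphiw w y| <= `|x - y| / 4 ^+ size w.
Proof.
move=> w2 x0 y0; rewrite gphiwB//; apply: ler_wpM2l => //.
rewrite lef_pV2 ?posrE ?mulr_gt0 ?gden_gt0 ?exprn_gt0//.
have -> : 4 ^+ size w = 2 ^+ size w * 2 ^+ size w :> R by rewrite -exprMn; congr (_ ^+ _); ring.
by rewrite ler_pM ?exprn_ge0// gden_ge.
Qed.

Lemma compact_cyl w : all (leq 2) w -> compact (cyl w).
Proof.
move=> w2; apply: continuous_compact; last exact: segment_compact.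
apply/subspace_continuousP => x /unit_halfP/andP[x0 xh].
apply/cvgrPdist_le => e e0; rewrite near_withinE.
near=> y => /unit_halfP/andP[y0 yh].
apply: le_trans (gphiw_contract w2 x0 y0) _.
apply: (@le_trans _ _ `|x - y|).
  by rewrite ler_pdivrMr ?exprn_gt0// ler_peMr// exprn_ege1// ler1n.
by near: y; exact: (@cvgr_dist_le _ _ _ (nbhs x) _ id x cvg_id e e0).
Unshelve. all: end_near. Qed.

Lemma closed_cyl w : all (leq 2) w -> closed (cyl w).
Proof. by move=> /compact_cyl; apply: compact_closed; exact: Rhausdorff. Qed.

Lemma measurable_cyl w : all (leq 2) w -> measurable (cyl w).
Proof. by move=> w2; apply: closed_measurable; exact: closed_cyl. Qed.

Lemma cyl_inj w v x : all (leq 2) w -> all (leq 2) v -> size w = size v ->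
  cyl w x -> cyl v x -> w = v.
Proof.
move=> w2 v2 wv [y /unit_halfP yh <-] [z /unit_halfP zh E].
by case: (gphiw_inj w2 v2 wv yh zh (esym E)).
Qed.

Lemma trivIset_cyl n (P : set (seq nat)) : P `<=` words primes_set n -> trivIset P cyl.
Proof.
move=> Pn w v /Pn ww /Pn wv [x [xw xv]].
apply: (cyl_inj (words_digits ww) (words_digits wv) _ xw xv).
by rewrite ww.1 wv.1.
Qed.

Lemma words_mkseq (a : nat -> nat) n : (forall i, prime (a i)) ->
  words primes_set n (mkseq a n).
Proof. by move=> pa; split=> [|i /mapP[j _ ->]]; [rewrite size_mkseq|exact: pa]. Qed.

Lemma mkseq_cat (a : nat -> nat) n m :
  mkseq a (n + m) = mkseq a n ++ mkseq (fun i => a (n + i)%N) m.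
Proof.
rewrite /mkseq iotaD map_cat add0n; congr (_ ++ _).
by rewrite -[in LHS](addn0 n) iotaDl -map_comp.
Qed.

Lemma mkseqS_rcons (a : nat -> nat) n : mkseq a n.+1 = rcons (mkseq a n) (a n).
Proof. by rewrite -addn1 mkseq_cat -cats1 /mkseq /= addn0. Qed.

Lemma limset_digits x : limset primes_set x ->
  exists2 a : nat -> nat, (forall i, prime (a i)) & forall n, cyl (mkseq a n) x.
Proof.
move=> [a [pa ax]]; exists a => // n.
have w2 := words_digits (words_mkseq n pa).
apply: (@closed_cvg _ _ _ _ _ (cyl (mkseq a n)) (closed_cyl w2) _ _ ax).
near=> m.
have nm : (n <= m)%N by near: m; exact: nbhs_infty_ge.
rewrite -(subnKC nm) mkseq_cat; apply: (@cyl_sub _ (mkseq (fun i => a (n + i)%N) (m - n))).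
  by apply: words_digits; apply: words_mkseq => i; exact: pa.
by exists 0; first exact: unit_half0.
Unshelve. all: end_near. Qed.

(** This form yields measurability. For the inclusion from right to left, the words found at the
    various levels are prefixes of one another, since cylinders of a level are disjoint, and so they
    define one sequence of letters. *)
Lemma limsetE : @limset R primes_set = \bigcap_n \bigcup_(w in words primes_set n) cyl w.
Proof.
apply/seteqP; split=> x.
  move=> /limset_digits[a pa ax] n _; exists (mkseq a n) => //; exact: words_mkseq.
move=> h; have /choice[w wP] : forall n, exists w, words primes_set n w /\ cyl w x.
  by move=> n; have [w ww xw] := h n I; exists w.
pose a n := nth 2%N (w n.+1) n.
have sw n : size (w n) = n by case: (wP n) => -[].
have tw n m : (n <= m)%N -> take n (w m) = w n.
  move=> nm; apply: (cyl_inj (x := x)).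
  - have /allP h2 := words_digits (wP m).1.
    by apply/allP => i /mem_take; exact: h2.
  - exact: words_digits (wP n).1.
  - by rewrite size_takel ?sw.
  - apply: (@cyl_sub _ (drop n (w m))); last by rewrite cat_take_drop; exact: (wP m).2.
    have /allP h2 := words_digits (wP m).1.
    by apply/allP => i /mem_drop; exact: h2.
  - exact: (wP n).2.
have aw n : mkseq a n = w n.
  apply: (@eq_from_nth _ 2%N); first by rewrite size_mkseq sw.
  move=> i; rewrite size_mkseq => ni; rewrite nth_mkseq// /a -(tw i.+1 n)//.
  by rewrite nth_take.
exists a; split.
  move=> i; apply: (wP i.+1).1.2; rewrite /a mem_nth// sw//.
apply/cvgrPdist_lt => e e0.
near=> n.
rewrite aw; have w2 := words_digits (wP n).1.
have [y /unit_halfP/andP[y0 yh] <-] := (wP n).2.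
apply: le_lt_trans (gphiw_contract w2 y0 (lexx 0)) _.
rewrite sw subr0 ger0_norm// ltr_pdivrMr ?exprn_gt0//.
have n4 : n%:R <= 4 ^+ n :> R by rewrite -natrX ler_nat ltnW// ltn_expl.
have : e^-1 < n%:R by near: n; exact: nbhs_infty_gtr.
rewrite -(ltr_pM2l e0) divff ?gt_eqF// => h1.
have : e * n%:R <= e * 4 ^+ n by rewrite ler_pM2l.
lra.
Unshelve. all: end_near. Qed.

Lemma measurable_bigcup_cyl n (P : set (seq nat)) : P `<=` words primes_set n ->
  measurable (\bigcup_(w in P) cyl w).
Proof.
move=> Pn; apply: countable_bigcup_measurable => w /Pn ww.
apply: measurable_cyl; exact: words_digits ww.
Qed.

Lemma measurable_limset : measurable (@limset R primes_set).
Proof. by rewrite limsetE; apply: bigcap_measurable => [|n _]; [exists 0%N|exact: (@measurable_bigcup_cyl n)]. Qed.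

End Cylinders.

Section ConformalStep.
Variables (R : realType) (d : R) (mu : probability R R).
Hypothesis conf : conformal primes_set d mu.
Local Notation unit_half := (@unit_half R).

Lemma derive1_gphi (a : nat) (x : R) : 0 < a%:R + x ->
  derive1 (gphi a) x = - (a%:R + x) ^- 2.
Proof.
move=> ax0; rewrite derive1E.
have -> : gphi a = (fun y : R => (shift a%:R y)^-1).
  by apply/funext => y; rewrite /gphi /shift/= div1r addrC.
have x0 : shift a%:R x != 0 by rewrite /shift/= addrC gt_eqF.
have H := is_deriveV x0 (is_derive_shift x 1 a%:R).
by rewrite derive_val /GRing.scale/= mulr1 addrC.
Qed.

Lemma conformal_limset0 (A : set R) : measurable A -> A `<=` ~` limset primes_set -> mu A = 0%E.
Proof.
move=> mA AL; apply/eqP; rewrite eq_le measure_ge0 andbT -conf.1.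
apply: le_measure => //; rewrite inE//; apply: measurableC; exact: measurable_limset.
Qed.

Lemma measurable_unit_half : measurable unit_half.
Proof. exact: measurable_itv. Qed.

Lemma limset_unit_half : limset primes_set `<=` unit_half.
Proof.
move=> x; rewrite limsetE => /(_ 0%N I) [w [/size0nil -> _]].
by rewrite cyl_nil.
Qed.

Lemma measure_limsetI (A : set R) : measurable A -> mu A = mu (A `&` limset primes_set).
Proof.
move=> mA; have mL := @measurable_limset R.
rewrite -[in LHS](setUIDK A (limset primes_set)) measureU//; last 3 first.
- exact: measurableI.
- exact: measurableD.
- by rewrite setDE setIACA setICr setI0.
rewrite [X in (_ + X)%E]conformal_limset0 ?adde0//; exact: measurableD.
Qed.

Lemma measure_unit_half : mu unit_half = 1%E.
Proof.
transitivity (mu setT); last exact: probability_setT.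
rewrite (measure_limsetI measurable_unit_half) (measure_limsetI measurableT).
by rewrite setTI setIidr//; exact: limset_unit_half.
Qed.

Lemma measurable_powR_shift (a : nat) (A : set R) :
  measurable_fun A (fun x => ((a%:R + x) `^ (- (2 * d)))%:E).
Proof.
apply: (measurable_funS measurableT) => //; apply/measurable_EFinP.
apply: (measurableT_comp (measurable_powR _)).
by apply: measurable_funD.
Qed.

(** Conformality sums over all letters, but another branch [b] can meet the image of [A] only in
    [phi_b 1 = phi_a 0], when [a = b + 1], and the point 1 has no mass. *)
Lemma measure_gphi_image (a : nat) (A : set R) : prime a -> measurable A -> A `<=` unit_half ->
  measurable (gphi a @` A) ->
  mu (gphi a @` A) = (\int[mu]_(x in A) ((a%:R + x) `^ (- (2 * d)))%:E)%E.
Proof.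
move=> pa mA AJ maA.
have a2 := prime_gt1 pa.
have Ah x : A x -> 0 <= x <= 2^-1 by move=> /AJ/unit_halfP.
have DE b x : prime b -> 0 <= x -> (`|derive1 (gphi b) x|) `^ d = (b%:R + x) `^ (- (2 * d)).
  move=> pb x0; have b0 : 0 < b%:R + x by rewrite ltr_pwDl// ltr0n prime_gt0.
  rewrite derive1_gphi// normrN gtr0_norm ?invr_gt0 ?exprn_gt0//.
  by rewrite -mulNr powRrM powR_invn// ltW.
have sub01 : gphi a @` A `<=` `[0, 1].
  move=> _ [x /Ah/andP[x0 _] <-]; rewrite /= in_itv/=.
  by have /andP[-> /= h] := gphi_bounds a2 x0; lra.
rewrite conf.2// (esumID [set a]); last first.
  by move=> b _; apply: integral_ge0 => x _; rewrite lee_fin powR_ge0.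
have -> : primes_set `&` [set a] = [set a] by apply/setIidPr => _ ->.
rewrite esum_set1; last by apply: integral_ge0 => x _; rewrite lee_fin powR_ge0.
rewrite esum1 ?adde0.
  have -> : `[0%R, 1%R] `&` gphi a @^-1` (gphi a @` A) = A.
    apply/seteqP; split=> x.
      move=> [/= + [y /[dup] Ay /Ah/andP[y0 yh]]]; rewrite in_itv/= => /andP[x0 x1].
      by rewrite /gphi !div1r => /invr_inj/addrI <-.
    move=> Ax; split; last by exists x.
    by have := Ah _ Ax; rewrite /= in_itv/=; lra.
  by apply: eq_integral => x /[!inE] /Ah/andP[x0 _]; rewrite DE.
move=> b [pb /= ba]; have b2 := prime_gt1 pb.
set D := _ `&` _.
have D1 : D `<=` [set 1].
  move=> x [/= + [y /[dup] Ay /Ah/andP[y0 yh]]]; rewrite in_itv/= => /andP[x0 x1].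
  rewrite /gphi !div1r => /invr_inj E.
  have ab : (a < b.+2)%N.
    rewrite -(ltr_nat R) -addn2 natrD; lra.
  have ba' : (b <= a)%N.
    rewrite leqNgt; apply/negP => h; have : a.+1%:R <= b%:R :> R by rewrite ler_nat.
    by rewrite -natr1; move: E; lra.
  have Eab : a = b.+1 by move/eqP: ba; lia.
  by move: E; rewrite Eab -natr1; lra.
have m1 : measurable [set (1 : R)] by exact: measurable_set1.
have mD : measurable D.
  by have [->|->] := subset_set1 D1.
have D0 : mu D = 0%E.
  apply: conformal_limset0 => // x /D1 -> /limset_unit_half/unit_halfP; lra.
rewrite (eq_integral (fun x : R => ((b%:R + x) `^ (- (2 * d)))%:E)); last first.
  by move=> x /[!inE] -[/= + _]; rewrite in_itv/= => /andP[x0 _]; rewrite DE.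
apply: null_set_integral => //; exact: measurable_powR_shift.
Qed.

Lemma measure_gphi_image_le (a : nat) (A : set R) (k : R) : prime a -> measurable A ->
  A `<=` unit_half -> measurable (gphi a @` A) ->
  (forall x, A x -> (a%:R + x) `^ (- (2 * d)) <= k) ->
  (mu (gphi a @` A) <= k%:E * mu A)%E.
Proof.
move=> pa mA AJ maA h; rewrite measure_gphi_image// -(integral_cst mu mA).
apply: ge0_le_integral => //.
- by move=> x _; rewrite lee_fin powR_ge0.
- exact: measurable_powR_shift.
Qed.

Lemma measure_gphi_image_ge (a : nat) (A : set R) (k : R) : prime a -> measurable A ->
  A `<=` unit_half -> measurable (gphi a @` A) -> 0 <= k ->
  (forall x, A x -> k <= (a%:R + x) `^ (- (2 * d))) ->
  (k%:E * mu A <= mu (gphi a @` A))%E.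
Proof.
move=> pa mA AJ maA k0 h; rewrite measure_gphi_image// -(integral_cst mu mA).
apply: ge0_le_integral => //.
exact: measurable_powR_shift.
Qed.

End ConformalStep.

Section Additivity.
Local Open Scope ereal_scope.
Context (d : measure_display) (T : measurableType d) (R : realType).
Variable mu : {measure set T -> \bar R}.

Lemma sum_le_measure (I : eqType) (A : set T) (s : seq I) (F : I -> set T) (b : I -> R) :
  measurable A -> uniq s -> (forall i, i \in s -> measurable (F i)) ->
  (forall i, i \in s -> F i `<=` A) ->
  (forall i j, i \in s -> j \in s -> i != j -> F i `&` F j = set0) ->
  (forall i, i \in s -> (b i)%:E <= mu (F i)) ->
  (\sum_(i <- s) b i)%:E <= mu A.
Proof.
elim: s A => [|i s IH] A mA /=; first by rewrite big_nil.
move=> /andP[nis us] mF FA tF bF.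
have is_ := mem_head i s.
have sub j : j \in s -> j \in i :: s by rewrite inE => ->; rewrite orbT.
rewrite big_cons EFinD -[in leRHS](setUIDK A (F i)) measureU//; last 3 first.
- by apply: measurableI => //; exact: mF.
- by apply: measurableD => //; exact: mF.
- by rewrite setDE setIACA setICr setI0.
rewrite (setIidr (FA _ is_)) leeD ?bF//.
apply: IH => //.
- by apply: measurableD => //; exact: mF.
- by move=> j /sub; exact: mF.
- move=> j js x Fx; split; first exact: (FA _ (sub _ js)).
  move=> Fix.
  have ij : i != j by apply: contraNneq nis => ->.
  by have : (F i `&` F j) x by []; rewrite (tF _ _ is_ (sub _ js) ij).
- by move=> j k /sub js /sub ks; exact: tF.
- by move=> j /sub; exact: bF.
Qed.

End Additivity.

(** * The exponent lies strictly between 1/2 and 1 *)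

Section Gibbs.
Variables (R : realType) (d : R) (mu : probability R R).
Hypothesis conf : conformal primes_set d mu.
Local Notation unit_half := (@unit_half R).
Local Notation cyl := (@cyl R).

Lemma words1 p : prime p -> words primes_set 1 [:: p].
Proof. by move=> pp; split=> // i; rewrite inE => /eqP ->. Qed.

Lemma cyl1 p : cyl [:: p] = gphi p @` unit_half.
Proof. by rewrite cyl_cons cyl_nil. Qed.

Lemma measurable_cyl1 p : prime p -> measurable (cyl [:: p]).
Proof. by move=> /words1 /words_digits; exact: measurable_cyl. Qed.

Lemma sum_prime_inv_sqr n : (3 <= n)%N ->
  \sum_(i < n | prime i) (i%:R : R) ^- 2 <= 3 / 4 - (n.-1)%:R^-1.
Proof.
elim: n => [//|n IH]; rewrite leq_eqVlt => /predU1P[<-|n3].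
  by rewrite big_mkcond !big_ord_recr big_ord0/=; lra.
rewrite big_mkcond big_ord_recr/= -big_mkcond.
have {}IH := IH n3.
have n3R : 3 <= n%:R :> R by rewrite (ler_nat _ 3).
have E : n.-1%:R = n%:R - 1 :> R by rewrite -subn1 natrB//; lia.
rewrite E in IH.
have h : (n%:R : R) ^- 2 <= (n%:R - 1)^-1 - n%:R^-1.
  have -> : (n%:R - 1)^-1 - n%:R^-1 = (n%:R * (n%:R - 1))^-1 :> R by field; lra.
  by rewrite lef_pV2 ?posrE ?exprn_gt0 ?mulr_gt0//; nra.
have n0 : 0 <= (n%:R : R) ^- 2 by rewrite invr_ge0 exprn_ge0.
by case: ifP => _; lra.
Qed.

(** The first-level cylinders carry all the mass, and for [d >= 1] that of [p] has mass at most
    [p^(-2)]; these sum to at most 3/4, short of the total mass 1. *)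
Lemma dim_lt1 : d < 1.
Proof.
rewrite ltNge; apply/negP => d1.
suff : (mu unit_half <= (3 / 4)%:E)%E.
  by rewrite (measure_unit_half conf) lee_fin; lra.
rewrite (measure_limsetI conf (@measurable_unit_half _)).
pose F i := if prime i then cyl [:: i] else set0.
apply: (@measure_le_sum _ _ _ mu _ F (fun i => if prime i then i%:R ^- 2 else 0)).
- by apply: measurableI; [exact: measurable_unit_half|exact: measurable_limset].
- by move=> i; rewrite /F; case: ifPn => // /measurable_cyl1.
- move=> x [_ /limset_digits[a pa ax]]; exists (a 0%N) => //.
  by rewrite /F pa; exact: (ax 1%N).
- move=> p; rewrite /F; case: ifPn => [pp|_]; last by rewrite measure0.
  rewrite cyl1; apply: le_trans (@measure_gphi_image_le _ _ _ conf p unit_half (p%:R ^- 2) _ _ _ _ _) _ => //.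
  + exact: measurable_unit_half.
  + by rewrite -cyl1; exact: measurable_cyl1.
  + move=> x /unit_halfP/andP[x0 xh].
    have p2 : 2 <= p%:R :> R by rewrite (ler_nat _ 2) prime_gt1.
    rewrite -powR_invn; last lra.
    apply: (@le_trans _ _ ((p%:R + x) `^ (- 2%:R))).
      by apply: ler_powR; lra.
    rewrite !powRN lef_pV2 ?posrE ?powR_gt0//; try lra.
    by apply: ge0_ler_powR; rewrite ?nnegrE; lra.
  + by rewrite (measure_unit_half conf) mule1.
move=> n; rewrite -big_mkcond.
apply: (@le_trans _ _ (\sum_(i < n + 3 | prime i) (i%:R : R) ^- 2)).
  rewrite big_mkcond [leRHS]big_mkcond/= big_split_ord/= lerDl sumr_ge0// => i _.
  by case: ifP => // _; rewrite invr_ge0 exprn_ge0.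
apply: le_trans (sum_prime_inv_sqr _) _; first lia.
by rewrite lerBlDr lerDl invr_ge0.
Qed.

Lemma harmonic_unbounded (B : R) : exists n, B < \sum_(1 <= j < n) (j%:R : R)^-1.
Proof.
have h n : (0 < n)%N -> ln (n%:R : R) <= \sum_(1 <= j < n) (j%:R : R)^-1.
  elim: n => [//|[|n] IH _]; first by rewrite ln1 big_geq.
  rewrite big_nat_recr//=; have {}IH := IH isT.
  have n0 : 0 < n.+1%:R :> R by rewrite ltr0n.
  have : ln (1 + (n.+1%:R : R)^-1) <= n.+1%:R^-1.
    by apply: le_ln1Dx; rewrite (lt_trans (ltrN10 _))// invr_gt0.
  have -> : 1 + (n.+1%:R : R)^-1 = n.+2%:R / n.+1%:R by rewrite -[n.+2%:R]natr1; field; rewrite gt_eqF.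
  by rewrite ln_div ?posrE ?ltr0n// lerBlDl => /le_trans; apply; rewrite lerD2r.
exists (Num.truncn (expR B)).+1.
apply: lt_le_trans (h _ _) => //.
rewrite -[ltLHS]expRK ltr_ln ?posrE ?expR_gt0// ?ltr0n//; exact: truncnS_gt.
Qed.

(** For [d <= 1/2] each first-level cylinder has mass at least [1 / (2 p)]. They are disjoint, which
    contradicts the divergence of the sum of the [1 / p], recovered here from dyadic blocks. *)
Lemma dim_gt_half : 2^-1 < d.
Proof.
rewrite ltNge; apply/negP => dh.
have hb n : \sum_(i <- iota 0 n | prime i) (2 * (i%:R : R))^-1 <= 1.
  rewrite -lee_fin -(measure_unit_half conf) -big_filter.
  apply: (@sum_le_measure _ _ _ mu _ _ _ (fun p => cyl [:: p])).
  - exact: measurable_unit_half.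
  - by rewrite filter_uniq// iota_uniq.
  - by move=> p; rewrite mem_filter => /andP[/measurable_cyl1].
  - move=> p; rewrite mem_filter => /andP[/words1/words_digits h _].
    exact: cyl_unit_half.
  - move=> p q; rewrite !mem_filter => /andP[pp _] /andP[pq _] /eqP neq.
    apply/seteqP; split=> // x [px qx]; apply: neq.
    by have [] := cyl_inj (words_digits (words1 pp)) (words_digits (words1 pq)) erefl px qx.
  move=> p; rewrite mem_filter => /andP[pp _].
  have p2 : 2 <= p%:R :> R by rewrite (ler_nat _ 2) prime_gt1.
  have := @measure_gphi_image_ge _ _ _ conf p unit_half (2 * p%:R)^-1 pp (@measurable_unit_half _).
  rewrite -cyl1 (measure_unit_half conf) mule1; apply=> //.
  - exact: measurable_cyl1.
  move=> x /unit_halfP/andP[x0 xh].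
  apply: (@le_trans _ _ ((p%:R + x) `^ (- 1))).
    by rewrite powR_inv1 ?lef_pV2 ?posrE; lra.
  by apply: ler_powR; lra.
have block m : (8 <= m)%N ->
    (32 * m%:R)^-1 <= \sum_(2 ^ m <= p < 2 ^ (m + 4) | prime p) (2 * (p%:R : R))^-1.
  move=> m8; have m0 : 0 < m%:R :> R by rewrite ltr0n; lia.
  apply: (@le_trans _ _ (\sum_(2 ^ m <= p < 2 ^ (m + 4) | prime p) (2 * (2 ^ (m + 4))%:R)^-1)).
    rewrite big_const_seq iter_addr_0 -/(nprimes _ _) -[leRHS]mulr_natr.
    have := nprimes_long_dyadic_ge m8; rewrite -(ler_nat R) natrM.
    set N := (nprimes _ _)%:R; set Q := (2 ^ m)%:R => h.
    have Q0 : 0 < Q :> R by rewrite ltr0n expn_gt0.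
    have -> : (2 ^ (m + 4))%:R = 16 * Q :> R by rewrite expnD natrM mulrC.
    have hN : Q / m%:R <= N by rewrite ler_pdivrMr.
    have -> : (32 * m%:R)^-1 = (2 * (16 * Q))^-1 * (Q / m%:R) by field; rewrite !gt_eqF.
    by rewrite ler_wpM2l// invr_ge0 !mulr_ge0// ltW.
  rewrite big_nat_cond [leRHS]big_nat_cond; apply: ler_sum => p /andP[/andP[mp pm] pp].
  have p0 : 0 < p%:R :> R by rewrite ltr0n prime_gt0.
  rewrite lef_pV2 ?posrE ?mulr_gt0// ?ltr0n ?expn_gt0//.
  by rewrite ler_pM2l// ler_nat ltnW.
(* Blocks at [m = 4 (j + 2)] are disjoint, and each contributes at least
   [1 / (128 (j + 2)) >= 1 / (384 j)]. A harmonic sum above 400 therefore forces more than 1. *)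
have [n hn] := harmonic_unbounded 400.
have tele k : \sum_(1 <= j < k.+1) (128 * ((j + 2)%:R : R))^-1 <=
    \sum_(0 <= p < 2 ^ (4 * (k.+1 + 2)) | prime p) (2 * (p%:R : R))^-1.
  elim: k => [|k IH].
    by rewrite big_geq// sumr_ge0.
  have le24 : (2 ^ (4 * (k.+1 + 2)) <= 2 ^ (4 * (k.+2 + 2)))%N by rewrite leq_exp2l//; lia.
  rewrite big_nat_recr// (big_cat_nat (leq0n _) le24)/=.
  apply: lerD => //.
  have := block (4 * (k.+1 + 2))%N; rewrite (_ : 4 * (k.+1 + 2) + 4 = 4 * (k.+2 + 2))%N; last lia.
  move=> h; apply: le_trans (h _); last lia.
  by rewrite natrM mulrA (_ : 32 * 4%:R = 128)//; ring.
have := le_trans (tele n) (hb _).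
have : 400 / 384 <= \sum_(1 <= j < n.+1) (128 * ((j + 2)%:R : R))^-1.
  apply: (@le_trans _ _ (\sum_(1 <= j < n.+1) 384^-1 * (j%:R : R)^-1)).
    rewrite -mulr_sumr mulrC; apply: ler_wpM2l; first lra.
    apply: ltW; apply: lt_le_trans hn _.
    case: (n) => [|k]; first by rewrite !big_geq.
    by rewrite [leRHS]big_nat_recr//= lerDl.
  rewrite big_nat_cond [leRHS]big_nat_cond; apply: ler_sum => j /andP[/andP[j1 _] _].
  have j0 : 1 <= j%:R :> R by rewrite ler1n.
  have j2 : (j + 2)%:R = j%:R + 2 :> R by rewrite natrD.
  by rewrite j2 -invfM lef_pV2 ?posrE; lra.
lra.
Qed.

End Gibbs.

(** * Gibbs estimates for cylinders *)

Section GibbsBounds.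
Variables (R : realType) (d : R) (mu : probability R R).
Hypotheses (conf : conformal primes_set d mu) (d_gt : 2^-1 < d) (d_lt1 : d < 1).
Local Notation phi := (@gphiw R).
Local Notation cyl := (@cyl R).
Local Notation "'Q' w" := (@gden R w 0) (at level 10).

Lemma words_cons n a v : words primes_set n.+1 (a :: v) -> prime a /\ words primes_set n v.
Proof.
move=> [[sv] h]; split; first by apply: h; rewrite mem_head.
by split=> // i iv; apply: h; rewrite inE iv orbT.
Qed.

Lemma ln_shift_le (a : nat) (x y : R) : (1 < a)%N -> 0 <= x -> 0 <= y ->
  ln (a%:R + x) - ln (a%:R + y) <= `|x - y| / 2.
Proof.
move=> a2 x0 y0; have aR : 2 <= a%:R :> R by rewrite (ler_nat _ 2).
have ax : 0 < a%:R + x by lra.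
have ay : 0 < a%:R + y by lra.
rewrite -ln_div ?posrE//.
have -> : (a%:R + x) / (a%:R + y) = 1 + (x - y) / (a%:R + y) by field; rewrite gt_eqF.
apply: le_trans (le_ln1Dx _) _.
  rewrite ltr_pdivlMr//; lra.
rewrite ler_pdivrMr// mulrAC ler_pdivlMr//.
have h := ler_norm (x - y).
apply: (@le_trans _ _ (`|x - y| * 2)); first by rewrite ler_pM2r.
by rewrite ler_wpM2l//; lra.
Qed.

(** This is the logarithm of the density of the branch [a], compared with its value at [phi v 0].
    Cylinders shrink like [4^(-n)]; the weaker rate [2^(-n)] is already summable. *)
Lemma cyl_oscillation (a : nat) v (x : R) : (1 < a)%N -> all (leq 2) v -> cyl v x ->
  `|- (2 * d) * ln (a%:R + x) - (- (2 * d) * ln (a%:R + phi v 0))| <= (2 ^+ size v)^-1.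
Proof.
move=> a2 v2 [y /unit_halfP/andP[y0 yh] <-].
have px := gphiw_ge0 v2 y0; have p0 : 0 <= phi v 0 by exact: gphiw_ge0.
have d0 : 0 <= 2 * d by have := d_gt; lra.
rewrite -mulrBr normrM normrN (ger0_norm d0).
have c : `|phi v y - phi v 0| <= (2 ^+ size v)^-1.
  apply: le_trans (gphiw_contract v2 y0 (lexx 0)) _.
  rewrite subr0 ger0_norm// ler_pdivrMr ?exprn_gt0//.
  have -> : 4 ^+ size v = 2 ^+ size v * 2 ^+ size v :> R by rewrite -exprMn; congr (_ ^+ _); ring.
  rewrite mulKf ?expf_neq0// (@le_trans _ _ 1)//; first lra.
  by rewrite exprn_ege1// ler1n.
apply: (@le_trans _ _ (2 * (`|phi v y - phi v 0| / 2))).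
  apply: ler_pM; [by have := d_gt; lra|by []|by have := d_lt1; lra|].
  rewrite ler_norml; apply/andP; split; last exact: ln_shift_le.
  by rewrite lerNl opprB distrC; exact: ln_shift_le.
by rewrite mulrC divfK.
Qed.

(** Prepending a letter to a word of length [n] costs a factor [e^(2^(-n))], and these exponents add
    up to [2 (1 - 2^(-n)) < 2]. The induction runs from the front because conformality describes the
    image under one letter. *)
Lemma gibbs_aux n w : words primes_set n w ->
  ((expR (- (2 * (1 - (2 ^+ n)^-1))) * Q w `^ (- (2 * d)))%:E <= mu (cyl w))%E /\
  (mu (cyl w) <= (expR (2 * (1 - (2 ^+ n)^-1)) * Q w `^ (- (2 * d)))%:E)%E.
Proof.
elim: n w => [|n IH] [|a v] ww.
- rewrite cyl_nil (measure_unit_half conf) /= powR1 expr0 invr1 subrr mulr0 oppr0 expR0 mulr1.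
  by split.
- by case: ww.
- by case: ww.
have [pa wv] := words_cons ww; have [IH1 IH2] := IH v wv.
have v2 := words_digits wv; have a2 := prime_gt1 pa.
have sv : size v = n by case: wv.
have osc x (vx : cyl v x) := cyl_oscillation a2 v2 vx.
rewrite sv in osc.
have p0 : 0 <= phi v 0 by exact: gphiw_ge0.
have aR : 2 <= a%:R :> R by rewrite (ler_nat _ 2).
have b0 : 0 < a%:R + phi v 0 by rewrite ltr_pwDl// ltr0n prime_gt0.
set e := (2 ^+ n)^-1 in osc IH1 IH2.
have ex : (2 ^+ n.+1)^-1 = e / 2 :> R by rewrite exprS invfM mulrC.
have Qv : 0 < Q v by exact: gden_gt0.
set c := - (2 * d) * ln (a%:R + phi v 0).
have QE : Q (a :: v) `^ (- (2 * d)) = expR c * Q v `^ (- (2 * d)).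
  by rewrite /= powRM ?(ltW b0) ?(ltW Qv)// [X in X * _]powR_expR.
have powE x : cyl v x -> (a%:R + x) `^ (- (2 * d)) = expR (- (2 * d) * ln (a%:R + x)).
  move=> vx; rewrite powR_expR//.
  have /unit_halfP/andP[x0 _] := cyl_unit_half v2 vx.
  by rewrite ltr_pwDl// ltr0n prime_gt0.
have mA : measurable (gphi a @` cyl v).
  by rewrite -cyl_cons; apply: measurable_cyl; exact: words_digits ww.
have mv := measurable_cyl v2; have vh := cyl_unit_half v2.
have P0 := powR_ge0 (Q v) (- (2 * d)).
rewrite cyl_cons QE ex; split.
  have hge : ((expR (c - e))%:E * mu (cyl v) <= mu (gphi a @` cyl v))%E.
    apply: (measure_gphi_image_ge conf) => // x vx; rewrite powE// ler_expR.
    by have := osc x vx; rewrite ler_norml -/c => /andP[]; lra.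
  apply: le_trans hge.
  apply: (@le_trans _ _ ((expR (c - e))%:E * (expR (- (2 * (1 - e))) * Q v `^ (- (2 * d)))%:E)%E).
    by rewrite -EFinM lee_fin mulrA mulrA -!expRD ler_wpM2r// ler_expR; lra.
  by apply: lee_wpmul2l => //; rewrite lee_fin expR_ge0.
have hle : (mu (gphi a @` cyl v) <= (expR (c + e))%:E * mu (cyl v))%E.
  apply: (measure_gphi_image_le conf) => // x vx; rewrite powE// ler_expR.
  by have := osc x vx; rewrite ler_norml -/c => /andP[]; lra.
apply: (le_trans hle).
apply: (@le_trans _ _ ((expR (c + e))%:E * (expR (2 * (1 - e)) * Q v `^ (- (2 * d)))%:E)%E).
  by apply: lee_wpmul2l => //; rewrite lee_fin expR_ge0.
by rewrite -EFinM lee_fin mulrA mulrA -!expRD ler_wpM2r// ler_expR; lra.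
Qed.

Lemma gibbs_le n w : words primes_set n w ->
  (mu (cyl w) <= (expR 2 * Q w `^ (- (2 * d)))%:E)%E.
Proof.
move=> /gibbs_aux[_ h]; apply: (le_trans h); rewrite lee_fin ler_wpM2r ?powR_ge0// ler_expR.
have : 0 <= (2 ^+ n : R)^-1 by rewrite invr_ge0 exprn_ge0.
lra.
Qed.

Lemma gibbs_ge n w : words primes_set n w ->
  ((expR (- 2) * Q w `^ (- (2 * d)))%:E <= mu (cyl w))%E.
Proof.
move=> /gibbs_aux[h _]; apply: le_trans h; rewrite lee_fin ler_wpM2r ?powR_ge0// ler_expR.
have : 0 <= (2 ^+ n : R)^-1 by rewrite invr_ge0 exprn_ge0.
lra.
Qed.

Lemma words_rcons n w p : words primes_set n w -> prime p -> words primes_set n.+1 (rcons w p).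
Proof.
move=> [sw h] pp; split; first by rewrite size_rcons sw.
by move=> i; rewrite mem_rcons inE => /predU1P[->//|/h].
Qed.

Lemma powR_natN (x : R) : 0 < x -> forall y, y <= x -> 0 < y -> x `^ (- (2 * d)) <= y `^ (- (2 * d)).
Proof.
move=> x0 y yx y0; rewrite !powRN lef_pV2 ?posrE ?powR_gt0//.
by apply: ge0_ler_powR; rewrite ?nnegrE ?(ltW x0) ?(ltW y0)//; have := d_gt; lra.
Qed.

Lemma gibbs_rcons_le n w p : words primes_set n w -> prime p ->
  (mu (cyl (rcons w p)) <= (expR 2 * (Q w `^ (- (2 * d)) * p%:R `^ (- (2 * d))))%:E)%E.
Proof.
move=> ww pp; apply: (le_trans (gibbs_le (words_rcons ww pp))).
have w2 := words_digits ww; have Q0 := gden_gt0 w2 (lexx (0 : R)).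
have p0 : 0 < p%:R :> R by rewrite ltr0n prime_gt0.
rewrite lee_fin ler_wpM2l ?expR_ge0// -powRM ?(ltW Q0)//.
have /andP[h _] := gden_rcons_bounds R w2 (prime_gt1 pp).
apply: powR_natN => //; last exact: mulr_gt0.
by apply: gden_gt0 => //; exact: words_digits (words_rcons ww pp).
Qed.

Lemma gibbs_rcons_ge n w p : words primes_set n w -> prime p ->
  ((expR (- 2) / 4 * (Q w `^ (- (2 * d)) * p%:R `^ (- (2 * d))))%:E <= mu (cyl (rcons w p)))%E.
Proof.
move=> ww pp; apply: le_trans (gibbs_ge (words_rcons ww pp)).
have w2 := words_digits ww; have Q0 := gden_gt0 w2 (lexx (0 : R)).
have p0 : 0 < p%:R :> R by rewrite ltr0n prime_gt0.
rewrite lee_fin -mulrA ler_wpM2l ?expR_ge0//.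
have /andP[_ h] := gden_rcons_bounds R w2 (prime_gt1 pp).
apply: (@le_trans _ _ ((2 * Q w * p%:R) `^ (- (2 * d)))); last first.
  apply: powR_natN => //; first by rewrite !mulr_gt0.
  by apply: gden_gt0 => //; exact: words_digits (words_rcons ww pp).
rewrite !powRM ?mulr_ge0 ?(ltW Q0) ?(ltW p0)// -mulrA ler_wpM2r ?mulr_ge0 ?powR_ge0//.
rewrite (_ : 4^-1 = 2 `^ (- 2%:R)); last by rewrite powR_invn// -natrX.
by apply: ler_powR; have := d_lt1; lra.
Qed.

End GibbsBounds.

Section BlockSums.
Variables (R : realType) (d : R) (mu : probability R R).
Hypotheses (conf : conformal primes_set d mu) (d_gt : 2^-1 < d) (d_lt1 : d < 1).
Local Notation cyl := (@cyl R).
Local Notation "'Qd' w" := (@gden R w 0 `^ (- (2 * d))) (at level 10).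

Lemma dyadic_block p : (0 < p)%N -> (2 ^ trunc_log 2 p <= p < 2 ^ (trunc_log 2 p).+1)%N.
Proof. by move=> p0; rewrite trunc_logP//= trunc_log_ltn. Qed.

Lemma geometric_sum_le (C t : R) m n : 0 <= C -> 0 < t < 1 ->
  \sum_(i < n) C * t ^+ (m + i) <= C * t ^+ m / (1 - t).
Proof.
move=> C0 /andP[t0 t1].
suff -> : \sum_(i < n) C * t ^+ (m + i) = C * t ^+ m * (1 - t ^+ n) / (1 - t).
  rewrite ler_wpM2r ?invr_ge0 ?subr_ge0 ?(ltW t1)// ler_piMr ?mulr_ge0 ?exprn_ge0 ?(ltW t0)//.
  by rewrite gerBl exprn_ge0 ?(ltW t0).
elim: n => [|n IH]; first by rewrite big_ord0 expr0 subrr mulr0 mul0r.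
rewrite big_ord_recr/= IH exprD [t ^+ n.+1]exprS; field.
by rewrite subr_eq0 gt_eqF.
Qed.

Lemma measure_dyadic_blocks (A : set R) (F : nat -> set R) (b : nat -> R) (C t : R) m :
  measurable A -> (forall p, prime p -> measurable (F p)) ->
  A `<=` \bigcup_(p in [set p | prime p /\ (2 ^ m <= p)%N]) F p ->
  (forall j p, (m <= j)%N -> prime p -> (2 ^ j <= p < 2 ^ j.+1)%N -> (mu (F p) <= (b j)%:E)%E) ->
  0 <= C -> 0 < t < 1 ->
  (forall j, (m <= j)%N -> (nprimes (2 ^ j) (2 ^ j.+1))%:R * b j <= C * t ^+ j) ->
  (mu A <= (C * t ^+ m / (1 - t))%:E)%E.
Proof.
move=> mA mF AF Fb C0 t01 Nb.
pose s i := [seq p <- index_iota (2 ^ (m + i)) (2 ^ (m + i).+1) | prime p].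
pose G i := A `&` \bigcup_(p in [set` s i]) F p.
have sP i p : p \in s i -> prime p /\ (2 ^ (m + i) <= p < 2 ^ (m + i).+1)%N.
  by rewrite mem_filter mem_index_iota => /andP[].
have mU i : measurable (\bigcup_(p in [set` s i]) F p).
  by apply: countable_bigcup_measurable => p /sP[/mF].
apply: (@measure_le_sum _ _ _ mu _ G (fun i => C * t ^+ (m + i))) => //.
- by move=> i; exact: measurableI.
- move=> x Ax; have [p [pp mp] Fx] := AF x Ax.
  have /andP[l1 l2] := dyadic_block (prime_gt0 pp).
  have mt : (m <= trunc_log 2 p)%N by apply: trunc_log_max.
  exists (trunc_log 2 p - m)%N => //; split=> //; exists p => //=.
  by rewrite mem_filter pp mem_index_iota subnKC// l1.
- move=> i; have mi : (m <= m + i)%N by exact: leq_addr.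
  apply: le_trans (_ : ((size (s i))%:R * b (m + i)%N)%:E <= _)%E.
    apply: (@measure_bigsetU_le _ _ _ mu _ _ F) => //.
    + by apply: measurableI.
    + by move=> p /sP[/mF].
    + by move=> x [].
    + by move=> p /sP[pp pi]; exact: Fb.
  rewrite lee_fin; apply: le_trans (Nb _ mi).
  by rewrite /s size_filter -/(nprimes _ _).
- by move=> n; exact: geometric_sum_le.
Qed.

(** Ratio [2^(1 - 2 d)] of consecutive blocks: about twice as many primes, each lighter by
    [2^(-2 d)]. It is below 1 because [d > 1/2]. *)
Let theta : R := expR (- ((2 * d - 1) * ln 2)).

Let theta01 : 0 < theta < 1.
Proof.
by rewrite expR_gt0/= /theta -[X in _ < X]expR0 ltr_expR oppr_lt0 mulr_gt0//; have := d_gt; lra.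
Qed.

Lemma pow2_powR j (x : R) : (2 ^ j)%:R `^ x = expR (j%:R * (x * ln 2)).
Proof. by rewrite powR_expR ?ltr0n ?expn_gt0// natrX lnXn// -mulr_natl; congr expR; ring. Qed.

Lemma tail_measure_le : exists2 C, 0 < C & forall n w m (A : set R),
  words primes_set n w -> (0 < m)%N -> measurable A ->
  A `<=` \bigcup_(p in [set p | prime p /\ (2 ^ m <= p)%N]) cyl (rcons w p) ->
  (mu A <= (C * (Qd w * tailw d m))%:E)%E.
Proof.
have /andP[t0 t1] := theta01.
exists (2 * expR 2 / (1 - theta)); first by rewrite divr_gt0 ?mulr_gt0 ?expR_gt0// subr_gt0.
move=> n w m A ww m0 mA AF.
have mR : 0 < m%:R :> R by rewrite ltr0n.
have P0 := powR_ge0 (gden w 0) (- (2 * d)).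
pose b j := expR 2 * (Qd w * (2 ^ j)%:R `^ (- (2 * d))).
pose C := 2 * expR 2 / m%:R * Qd w.
have C0 : 0 <= C by rewrite /C mulr_ge0 ?divr_ge0 ?mulr_ge0 ?expR_ge0.
apply: le_trans (@measure_dyadic_blocks A (fun p => cyl (rcons w p)) b C theta m mA _ AF _ C0 theta01 _) _.
- move=> p pp; apply: measurable_cyl; exact: words_digits (words_rcons ww pp).
- move=> j p mj pp /andP[jp _].
  apply: (le_trans (gibbs_rcons_le conf d_gt d_lt1 ww pp)).
  rewrite lee_fin ler_wpM2l ?expR_ge0// ler_wpM2l//.
  apply: powR_natN => //; rewrite ?ltr0n ?prime_gt0 ?ler_nat ?expn_gt0//.
- move=> j mj; have j0 : 0 < j%:R :> R by rewrite ltr0n (leq_trans m0).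
  have := nprimes_dyadic_le j; rewrite -(ler_nat R) natrM.
  set N := (nprimes _ _)%:R => hN.
  have {}hN : N <= 2 * (2 ^ j)%:R / m%:R.
    rewrite ler_pdivlMr//; apply: le_trans (_ : N * j%:R <= _); first by rewrite ler_wpM2l// ler_nat.
    by apply: le_trans hN _; rewrite expnS natrM.
  apply: (@le_trans _ _ (2 * (2 ^ j)%:R / m%:R * b j)).
    by rewrite ler_wpM2r// !mulr_ge0// ?expR_ge0// powR_ge0.
  rewrite /b /C pow2_powR /theta -expRM_natl.
  have -> : (2 ^ j)%:R = expR (j%:R * ln 2) :> R by rewrite natrX expRM_natl lnK ?posrE.
  rewrite le_eqVlt; apply/orP; left; apply/eqP.
  have -> : expR (j%:R * - ((2 * d - 1) * ln 2)) = expR (j%:R * ln 2) * expR (j%:R * (- (2 * d) * ln 2)) :> R.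
    by rewrite -expRD; congr expR; ring.
  ring.
rewrite lee_fin le_eqVlt; apply/orP; left; apply/eqP.
rewrite /C /tailw /theta -expRM_natl mulrN; ring.
Qed.

End BlockSums.

Lemma nat_window a p h : (p < a + h.+1)%N -> (a < p + h.+1)%N -> (a - h <= p <= a + h)%N.
Proof. by move=> h1 h2; lia. Qed.

(** For [L = a - h], [n = a + h] and [k = 2 h + 1], these are the conditions under which every prime
    of the window divides ['C(n, k)]; this choice of [k] makes [n - k = L - 1]. *)
Lemma nat_window_bounds a h : (16 < a)%N -> (16 * h <= a)%N ->
  [/\ (1 < a - h)%N, (0 < 2 * h + 1 <= a + h)%N, (2 * h + 1 < a - h)%N,
      (a + h - (2 * h + 1) < a - h)%N & (a <= (a - h) * 2)%N /\ (a + h <= 2 * a)%N].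
Proof. by move=> h1 h2; repeat split; lia. Qed.

(** * Measure of balls *)

Section BallEstimate.
Variables (R : realType) (d : R) (mu : probability R R).
Hypotheses (conf : conformal primes_set d mu) (d_gt : 2^-1 < d) (d_lt1 : d < 1).
Local Notation cyl := (@cyl R).
Local Notation "'Qd' w" := (@gden R w 0 `^ (- (2 * d))) (at level 10).

Definition near_digits (a : nat) (t rho : R) : set nat :=
  [set p | prime p /\ exists2 s, 0 <= s <= 2^-1 & `|gphi p s - gphi a t| <= rho].

(** The letters [p >= 2^m] fill the part of the limit set in [[0, 2^(-m)]], so the right side is the
    ball estimate at radius [2^(-m)]: this is the extremal configuration. *)
Lemma tailw_gauge m : tailw d m = expR (- (m%:R * (d * ln 2))) * gauge d m.
Proof. by rewrite /tailw /gauge [RHS]mulrA -expRD; congr (expR _ / _); ring. Qed.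

(** Case [rho >= 1 / (512 a)]: the ball stays below [513 rho], so only letters of order at least
    [1 / rho] are near. *)
Lemma far_digits_ge (a p : nat) (s t rho : R) : prime a -> prime p ->
  0 <= s <= 2^-1 -> 0 <= t -> 0 < rho -> 1 <= 512 * rho * a%:R ->
  `|gphi p s - gphi a t| <= rho -> (700 * rho)^-1 <= p%:R.
Proof.
move=> pa pp /andP[s0 sh] t0 r0 ra.
have aR : 2 <= a%:R :> R by rewrite (ler_nat _ 2) prime_gt1.
have pR : 2 <= p%:R :> R by rewrite (ler_nat _ 2) prime_gt1.
rewrite /gphi !div1r ler_norml => /andP[_ h].
have p0 : 0 < p%:R + s by lra.
have h1 : (a%:R + t)^-1 <= 512 * rho.
  apply: (@le_trans _ _ (a%:R^-1)); first by rewrite lef_pV2 ?posrE; lra.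
  by rewrite -[leLHS]mul1r ler_pdivrMr; lra.
have h2 : (p%:R + s)^-1 <= 513 * rho by lra.
have h3 : 1 <= 513 * rho * (p%:R + s) by rewrite -ler_pdivrMr// div1r.
rewrite -[leLHS]mul1r ler_pdivrMr; last lra.
nra.
Qed.

(** Since [1 / (700 rho) <= a], the dyadic exponent [j] can be kept between 1 and [log2 a]; then the
    tail bound applies at [j], and quasi-monotonicity replaces [gauge j] by the gauge at
    [log2 a]. *)
Lemma dyadic_scale (a : nat) (rho : R) : prime a -> 0 < rho -> 1 <= 512 * rho * a%:R ->
  exists2 j, (0 < j <= trunc_log 2 a)%N & (2 ^+ j)^-1 <= 1400 * rho /\
    forall p, prime p -> (700 * rho)^-1 <= p%:R -> (2 ^ j <= p)%N.
Proof.
move=> pa r0 ra; have a2 := prime_gt1 pa.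
set z := (700 * rho)^-1.
have q0 : 0 < 700 * rho by lra.
have z0 : 0 < z by rewrite invr_gt0 q0.
have zr : z * (700 * rho) = 1 by exact: mulVf (lt0r_neq0 q0).
have [z2|z2] := ltP z 2.
  exists 1%N; first by rewrite /= trunc_log_gt0.
  split; last by move=> p /prime_gt1.
  by rewrite expr1; nra.
set Z := Num.truncn z.
have /andP[Zz zZ] := truncn_itv (ltW z0).
have Z2 : (2 <= Z)%N by rewrite /Z truncn_ge_nat ?(ltW z0).
have Z0 : (0 < Z)%N by exact: ltnW Z2.
have /andP[l1 l2] := dyadic_block Z0.
exists (trunc_log 2 Z).
  apply/andP; split; first by rewrite trunc_log_gt0.
  apply: trunc_log_max => //; apply: (leq_trans l1); rewrite -(ler_nat R).
  apply: (le_trans Zz); rewrite -[leLHS]mul1r; nra.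
split.
  have : z <= 2 ^+ (trunc_log 2 Z).+1.
    by rewrite -natrX (le_trans (ltW zZ))// ler_nat.
  rewrite exprS; set y := 2 ^+ _; have y0 : 0 < y :> R by rewrite exprn_gt0.
  move=> h; rewrite -[leLHS]mul1r ler_pdivrMr//; nra.
move=> p pp h; apply: (leq_trans l1); rewrite -(ler_nat R); exact: le_trans h.
Qed.

Lemma near_measure_far : exists2 C, 0 < C & forall n w a (t rho : R) (A : set R),
  words primes_set n w -> prime a -> 0 <= t <= 2^-1 -> 0 < rho -> 1 <= 512 * rho * a%:R ->
  measurable A -> A `<=` \bigcup_(p in near_digits a t rho) cyl (rcons w p) ->
  (mu A <= (C * (Qd w * (rho `^ d * gauge d (trunc_log 2 a))))%:E)%E.
Proof.
have [C1 C10 tail] := tail_measure_le conf d_gt d_lt1.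
have [C2 C20 qm] := gauge_quasi_mono d_lt1.
have K0 : 0 < 1400 :> R by rewrite ltr0n.
exists (C1 * 1400 * C2); first exact: mulr_gt0 (mulr_gt0 C10 K0) C20.
move=> n w a t rho A ww pa /andP[t0 th] r0 ra mA AF.
have [j /andP[j0 jm] [jr jp]] := dyadic_scale pa r0 ra.
apply: le_trans (tail n w j A ww j0 mA _) _.
  move=> x /AF [p [pp [s sh ps]] px]; exists p => //; split=> //.
  apply: jp => //; exact: (far_digits_ge pa pp sh t0 r0 ra).
have K1 : 1 <= 1400 :> R by rewrite ler1n.
move: K0 K1 jr; move: 1400 => K K0 K1 jr.
have -> : C1 * K * C2 * (Qd w * (rho `^ d * gauge d (trunc_log 2 a))) =
  C1 * (Qd w * (K * rho `^ d * (C2 * gauge d (trunc_log 2 a)))) by ring.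
rewrite lee_fin ler_pM2l//.
rewrite ler_wpM2l ?powR_ge0// tailw_gauge ler_pM ?expR_ge0//.
- by apply: ltW; apply: gauge_gt0.
- have -> : expR (- (j%:R * (d * ln 2))) = ((2 ^+ j)^-1) `^ d :> R.
    by rewrite powR_expR ?invr_gt0 ?exprn_gt0// lnV ?posrE ?exprn_gt0// lnXn// -mulr_natl; congr expR; ring.
  apply: (@le_trans _ _ ((K * rho) `^ d)).
    apply: ge0_ler_powR; rewrite ?nnegrE ?invr_ge0 ?exprn_ge0//; last first.
      by rewrite mulr_ge0 ?ltW.
    by have := d_gt; lra.
  rewrite powRM ?(ltW K0) ?(ltW r0)//.
  by rewrite ler_wpM2r ?powR_ge0//; apply: ler1_powR; [|exact: ltW].
- by apply: qm; rewrite j0.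
Qed.

(** Case [rho < 1 / (512 a)]: the branches have slope about [a^(-2)] there, so the ball becomes a
    window of letters of half-width [2 rho a^2], plus 1/2 for the tails [s] and [t]. *)
Lemma close_digits (a p : nat) (s t rho : R) : prime a -> prime p ->
  0 <= s <= 2^-1 -> 0 <= t <= 2^-1 -> 0 < rho -> 512 * rho * a%:R < 1 -> 16 <= a%:R :> R ->
  `|gphi p s - gphi a t| <= rho ->
  `|p%:R - a%:R| <= 2 * rho * a%:R ^+ 2 + 2^-1.
Proof.
move=> pa pp /andP[s0 sh] /andP[t0 th] r0 ra a16.
have pR : 2 <= p%:R :> R by rewrite (ler_nat _ 2) prime_gt1.
have p0 : 0 < p%:R + s by lra.
have a0 : 0 < a%:R + t by lra.
have -> : gphi p s - gphi a t = (a%:R + t - (p%:R + s)) / ((p%:R + s) * (a%:R + t)).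
  by rewrite /gphi; field; rewrite !gt_eqF.
rewrite normrM normfV (gtr0_norm (mulr_gt0 p0 a0)) ler_pdivrMr ?mulr_gt0//.
set P := p%:R + s in p0 *; set A := a%:R + t in a0 *.
have rA : rho * A <= 256^-1 by rewrite /A; nra.
have rA0 : 0 < rho * A by rewrite mulr_gt0.
have AA : A ^+ 2 <= (33 / 32 * a%:R) ^+ 2.
  by rewrite lerXn2r ?nnegrE /A; lra.
rewrite ler_norml => /andP[h1 h2].
have PA : P <= 256 / 255 * A.
  have : rho * (P * A) <= 256^-1 * P by rewrite mulrCA mulrC ler_wpM2r// ltW.
  lra.
have PA2 : rho * (P * A) <= rho * (256 / 255 * A ^+ 2).
  by rewrite ler_pM2l// expr2 mulrA ler_pM2r.
have PA3 : rho * (256 / 255 * A ^+ 2) <= 2 * rho * a%:R ^+ 2.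
  rewrite [leRHS](_ : _ = rho * (2 * a%:R ^+ 2)); last by ring.
  rewrite ler_pM2l//; move: AA; rewrite exprMn; have : 0 <= a%:R ^+ 2 :> R by rewrite sqr_ge0.
  lra.
have {}h1 : - (2 * rho * a%:R ^+ 2) <= A - P.
  by apply: le_trans h1; rewrite lerN2; exact: le_trans PA3.
have {}h2 : A - P <= 2 * rho * a%:R ^+ 2.
  by apply: le_trans h2 _; exact: le_trans PA3.
move: h1 h2; rewrite /P /A; move: (2 * rho * a%:R ^+ 2) => Y h1 h2.
by rewrite ler_norml; apply/andP; split; lra.
Qed.

(** The window holds at most of the order of [rho^d a^(2 d) gauge (log2 a)] primes, each of relative
    mass about [a^(-2 d)], and the powers of [a] cancel. *)
Lemma near_measure_close : exists2 C, 0 < C & forall n w a (t rho : R) (A : set R),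
  words primes_set n w -> prime a -> 0 <= t <= 2^-1 -> 0 < rho -> 512 * rho * a%:R < 1 ->
  1 <= 32 * rho * a%:R ^+ 2 ->
  measurable A -> A `<=` \bigcup_(p in near_digits a t rho) cyl (rcons w p) ->
  (mu A <= (C * (Qd w * (rho `^ d * gauge d (trunc_log 2 a))))%:E)%E.
Proof.
have [C2 C20 bin] : exists2 C2, 0 < C2 & forall n k : nat, (0 < k <= n)%N ->
    ln ('C(n, k)%:R : R) <= C2 * (k%:R `^ d * n%:R `^ (1 - d)).
  exists (1 + (1 - d)^-1); last by move=> n k; exact: ln_bin_le_powR.
  by rewrite addr_gt0// invr_gt0 subr_gt0.
have d0 : 0 < d by have := d_gt; lra.
have d10 : 0 < 1 - d by rewrite subr_gt0.
have c2 : 0 < 4 :> R by rewrite ltr0n.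
have K2 : 0 < C2 * 136 * (4 / ln 2).
  have c1 : 0 < 136 :> R by rewrite ltr0n.
  exact: mulr_gt0 (mulr_gt0 C20 c1) (divr_gt0 c2 (ln2_gt0 R)).
exists (expR 2 * 4 * (C2 * 136) * (4 / ln 2)).
  by rewrite -mulrA; exact: mulr_gt0 (mulr_gt0 (expR_gt0 _) c2) K2.
move=> n w a t rho A ww pa th r0 ra ra2 mA AF.
(* The two bounds on [rho] give [1 <= 32 rho a^2 < a / 16]. *)
have a16 : 16 < a%:R :> R.
  have a2 : 0 < a%:R :> R by rewrite ltr0n prime_gt0.
  rewrite -(ltr_pM2l (mulr_gt0 (_ : 0 < 32) (mulr_gt0 r0 a2)))//.
  by move: ra2; rewrite expr2; lra.
have a00 : 0 < a%:R :> R by rewrite ltr0n prime_gt0.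
have a16n : (16 < a)%N by rewrite -(ltr_nat R).
set y := 2 * rho * a%:R ^+ 2 + 2^-1.
have y0 : 0 <= y by rewrite addr_ge0 ?mulr_ge0// ltW.
set h := Num.truncn y.
have /andP[hy yh] := truncn_itv y0.
have ya : y <= a%:R / 256 + 2^-1.
  rewrite lerD2r expr2 mulrA ler_pdivlMr ?ltr0n// [leLHS](_ : _ = 512 * rho * a%:R * a%:R); last by ring.
  by rewrite ler_piMl ?ltW.
have ha : (16 * h <= a)%N.
  by rewrite -(ler_nat R) natrM; lra.
set k := (2 * h + 1)%N; set L := (a - h)%N; set n0 := (a + h)%N.
have near p : near_digits a t rho p -> (L <= p <= n0)%N.
  move=> [pp [s sh ps]].
  have /ler_normlP[l1 l2] := close_digits pa pp sh th r0 ra (ltW a16) ps.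
  have l3 : (p < a + h.+1)%N by rewrite -(ltr_nat R) natrD; move: yh l2; rewrite -/h -/y; lra.
  have l4 : (a < p + h.+1)%N by rewrite -(ltr_nat R) natrD; move: yh l1; rewrite -/h -/y; lra.
  exact: nat_window.
have [L0 kn kL nkL [aL n0a]] : [/\ (1 < L)%N, (0 < k <= n0)%N, (k < L)%N,
    (n0 - k < L)%N & (a <= L * 2)%N /\ (n0 <= 2 * a)%N] by exact: nat_window_bounds.
have LR : 1 < L%:R :> R by rewrite (ltr_nat _ 1).
have aR : 0 < a%:R :> R by lra.
set N := nprimes L n0.+1.
have P0 := powR_ge0 (gden w 0) (- (2 * d)).
have La : a%:R / 2 <= L%:R :> R.
  by rewrite ler_pdivrMr// -natrM ler_nat.
(* Logarithm of [L^N <= 'C(n0, k)]. Division by [ln L], of order [log2 a], produces the denominator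
   of the gauge. *)
have N1 : N%:R * ln L%:R <= C2 * (k%:R `^ d * n0%:R `^ (1 - d)).
  apply: le_trans (bin _ _ kn).
  rewrite mulr_natl -lnXn; last lra.
  have /andP[_ kn0] := kn.
  rewrite -natrX ler_ln ?posrE ?ltr0n ?expn_gt0 ?bin_gt0 ?(ltnW L0)//.
  by rewrite ler_nat; exact: expn_nprimes_leq_bin.
have kR : k%:R <= 68 * rho * a%:R ^+ 2 :> R.
  by rewrite /k natrD natrM; move: hy; rewrite -/h /y; lra.
have n0R : n0%:R <= 2 * a%:R :> R by rewrite -natrM ler_nat.
have kp : k%:R `^ d <= 68 * (rho `^ d * a%:R `^ (2 * d)).
  apply: (@le_trans _ _ ((68 * rho * a%:R ^+ 2) `^ d)).
    apply: (ge0_ler_powR (ltW d0)); rewrite ?nnegrE//; exact: le_trans kR.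
  rewrite -!mulrA -[a%:R ^+ 2]powR_mulrn ?(ltW aR)//.
  rewrite powRM ?mulr_ge0 ?powR_ge0 ?(ltW r0)// [X in _ * X <= _]powRM ?powR_ge0 ?(ltW r0)// -powRrM.
  rewrite ler_wpM2r ?mulr_ge0 ?powR_ge0//; apply: ler1_powR; [lra|exact: ltW].
have np : n0%:R `^ (1 - d) <= 2 * a%:R `^ (1 - d).
  apply: (@le_trans _ _ ((2 * a%:R) `^ (1 - d))).
    apply: (ge0_ler_powR (ltW d10)); rewrite ?nnegrE//; exact: le_trans n0R.
  rewrite powRM ?(ltW aR)// ler_wpM2r ?powR_ge0//; apply: ler1_powR; [lra|by have := d_gt; lra].
set m := trunc_log 2 a.
have /andP[m1 m2] := dyadic_block (prime_gt0 pa).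
have m4 : (4 <= m)%N by apply: trunc_log_max => //; exact: ltnW a16n.
have mR : 4 <= m%:R :> R by rewrite (ler_nat _ 4).
have lnL : m%:R * (ln 2 / 2) <= ln (L%:R : R).
  apply: (@le_trans _ _ (ln ((2 : R) ^+ m.-1))).
    have E : m.-1%:R = m%:R - 1 :> R by rewrite -[m.-1]subn1 natrB// (leq_trans _ m4).
    by rewrite lnXn// -[leRHS]mulr_natl E; have := ln2_gt0 R; nra.
  rewrite ler_ln ?posrE ?exprn_gt0//; last lra.
  rewrite -natrX; apply: le_trans La; rewrite ler_pdivlMr// -natrM ler_nat.
  by rewrite mulnC -expnS prednK// (leq_trans _ m4).
have lnL0 : 0 < ln L%:R :> R by rewrite ln_gt0.
have am : a%:R `^ (1 - d) <= 2 * (m%:R * gauge d m).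
  apply: (@le_trans _ _ ((2 * (2 ^ m)%:R) `^ (1 - d))).
    apply: ge0_ler_powR; rewrite ?nnegrE ?(ltW d10) ?(ltW aR) -?natrM//.
    by rewrite -expnS ler_nat ltnW.
  have m0 : m%:R != 0 :> R by rewrite pnatr_eq0 -lt0n (leq_trans _ m4).
  rewrite powRM// pow2_powR [m%:R * gauge d m]mulrC /gauge (divfK m0).
  rewrite ler_wpM2r ?expR_ge0//; apply: ler1_powR; [lra|by have := d_gt; lra].
have g0 : 0 < gauge d m by apply: gauge_gt0; exact: leq_trans m4.
have N2 : N%:R <= C2 * 136 * (4 / ln 2) * (rho `^ d * a%:R `^ (2 * d) * gauge d m).
  rewrite -(ler_pM2r lnL0); apply: (le_trans N1).
  apply: (@le_trans _ _ (C2 * ((68 * (rho `^ d * a%:R `^ (2 * d))) * (2 * (2 * (m%:R * gauge d m)))))).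
    rewrite ler_pM2l// ler_pM ?powR_ge0//; apply: (le_trans np).
    by rewrite ler_pM2l.
  set X := rho `^ d * a%:R `^ (2 * d).
  have X0 : 0 <= X by rewrite mulr_ge0 ?powR_ge0.
  apply: (@le_trans _ _ (C2 * 136 * (4 / ln 2) * (X * gauge d m) * (m%:R * (ln 2 / 2)))).
    rewrite le_eqVlt; apply/orP; left; apply/eqP; field; exact: lt0r_neq0.
  exact: ler_wpM2l (mulr_ge0 (ltW K2) (mulr_ge0 X0 (ltW g0))) _ _ lnL.
have Lp : L%:R `^ (- (2 * d)) <= 4 * a%:R `^ (- (2 * d)).
  apply: (@le_trans _ _ ((a%:R / 2) `^ (- (2 * d)))).
    by apply: powR_natN => //; lra.
  rewrite powRM ?invr_ge0 ?(ltW aR)// mulrC ler_wpM2r ?powR_ge0//.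
  rewrite (_ : 2^-1 = 2 `^ (-1)); last by rewrite powR_inv1.
  rewrite -powRrM mulN1r opprK (_ : 4 = 2 `^ 2%:R); last by rewrite powR_mulrn// -natrX.
  by apply: ler_powR; have := d_lt1; lra.
pose s := [seq p <- index_iota L n0.+1 | prime p].
have sP p : p \in s -> prime p /\ (L <= p <= n0)%N by rewrite mem_filter mem_index_iota => /andP[].
apply: (@le_trans _ _ ((size s)%:R * (expR 2 * (Qd w * L%:R `^ (- (2 * d)))))%:E).
  apply: (@measure_bigsetU_le _ _ _ mu A s (fun p => cyl (rcons w p))) => //.
  - by move=> p /sP[pp _]; apply: measurable_cyl; exact: words_digits (words_rcons ww pp).
  - move=> x /AF[p np' px]; exists p => //=; rewrite mem_filter np'.1 mem_index_iota.
    exact: near.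
  - move=> p /sP[pp /andP[Lpp _]]; apply: (le_trans (gibbs_rcons_le conf d_gt d_lt1 ww pp)).
    rewrite lee_fin ler_wpM2l ?expR_ge0// ler_wpM2l//.
    apply: powR_natN; rewrite ?ltr0n ?ler_nat//; [exact: prime_gt0|exact: ltnW].
rewrite lee_fin /s size_filter -/(nprimes _ _) -/N.
apply: (@le_trans _ _ (C2 * 136 * (4 / ln 2) * (rho `^ d * a%:R `^ (2 * d) * gauge d m) *
   (expR 2 * (Qd w * (4 * a%:R `^ (- (2 * d))))))).
  apply: ler_pM => //; first by rewrite !mulr_ge0 ?expR_ge0 ?powR_ge0.
  by rewrite ler_wpM2l ?expR_ge0// ler_wpM2l.
rewrite [a%:R `^ (- _)]powRN le_eqVlt; apply/orP; left; apply/eqP.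
have := powR_gt0 (2 * d) aR; move: (a%:R `^ (2 * d)) (gauge d m) (expR 2) (Qd w) (ln 2) (ln2_gt0 R) => X g e q l l0 X0.
by field; rewrite !gt_eqF.
Qed.

Lemma near_measure : exists2 C, 0 < C & forall n w a (t rho : R) (A : set R),
  words primes_set n w -> prime a -> 0 <= t <= 2^-1 -> 0 < rho ->
  1 <= 32 * rho * a%:R ^+ 2 ->
  measurable A -> A `<=` \bigcup_(p in near_digits a t rho) cyl (rcons w p) ->
  (mu A <= (C * (Qd w * (rho `^ d * gauge d (trunc_log 2 a))))%:E)%E.
Proof.
have [C1 C10 h1] := near_measure_far.
have [C2 C20 h2] := near_measure_close.
exists (C1 + C2); first by rewrite addr_gt0.
move=> n w a t rho A ww pa th r0 ra2 mA AF.
have g0 : 0 <= gauge d (trunc_log 2 a).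
  by apply/ltW/gauge_gt0; rewrite trunc_log_gt0/= prime_gt1.
have X0 : 0 <= Qd w * (rho `^ d * gauge d (trunc_log 2 a)).
  by rewrite !mulr_ge0 ?powR_ge0.
have [ra|ra] := leP 1 (512 * rho * a%:R).
  apply: le_trans (h1 _ _ _ _ _ _ ww pa th r0 ra mA AF) _.
  by rewrite lee_fin ler_wpM2r// lerDl ltW.
apply: le_trans (h2 _ _ _ _ _ _ ww pa th r0 ra ra2 mA AF) _.
by rewrite lee_fin ler_wpM2r// lerDr ltW.
Qed.

End BallEstimate.

Section BallMeasure.
Variables (R : realType) (d : R) (mu : probability R R).
Hypotheses (conf : conformal primes_set d mu) (d_gt : 2^-1 < d) (d_lt1 : d < 1).
Local Notation cyl := (@cyl R).
Local Notation phi := (@gphiw R).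
Local Notation "'Q' w" := (@gden R w 0) (at level 10).

Lemma cyl_rcons_inv w p x : cyl (rcons w p) x ->
  exists2 t : R, 0 <= t <= 2^-1 & x = phi w (gphi p t).
Proof.
by rewrite -cats1 cyl_cat => -[_ [t /unit_halfP ht <-] <-]; exists t.
Qed.

(** The radius lies between the separation scales of levels [n] and [n + 1]: the ball meets a single
    cylinder of level [n], yet is wide enough for [near_measure]. The denominator disappears because
    [Q^(-2 d) rho^d = (4 r)^d]. *)
Lemma ball_measure : exists2 C, 0 < C & forall (u : nat -> nat) (x r : R) n,
  (forall i, prime (u i)) -> (forall k, cyl (mkseq u k) x) -> 0 < r ->
  r < (32 * Q (mkseq u n) ^+ 2)^-1 -> (32 * Q (mkseq u n.+1) ^+ 2)^-1 <= r ->
  (mu `[(x - r)%R, (x + r)%R]%classic <= (C * (r `^ d * gauge d (trunc_log 2 (u n))))%:E)%E.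
Proof.
have [C C0 near] := near_measure conf d_gt d_lt1.
exists (C * 4); first by rewrite mulr_gt0.
move=> u x r n pu ux r0 rn rn1.
set w := mkseq u n in rn *.
have ww : words primes_set n w := words_mkseq n pu.
have w2 := words_digits ww.
have Q0 : 0 < Q w by exact: gden_gt0.
have pa := pu n; have a2 := prime_gt1 pa.
have aR : 0 < (u n)%:R :> R by rewrite ltr0n prime_gt0.
have [t th xt] : exists2 t : R, 0 <= t <= 2^-1 & x = phi w (gphi (u n) t).
  by apply: cyl_rcons_inv; rewrite -mkseqS_rcons.
have half_gphi (p : nat) (s : R) : prime p -> 0 <= s <= 2^-1 -> 0 <= gphi p s <= 2^-1.
  by move=> pp /andP[s0 _]; apply: gphi_bounds => //; exact: prime_gt1.
(* Along the cylinder [gden w] is at most [2 Q w], so pulling back by [phi w] enlarges distances at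
   most by the square of this. *)
pose rho := 4 * Q w ^+ 2 * r.
have rho0 : 0 < rho by rewrite !mulr_gt0 ?exprn_gt0.
have mB : measurable (`[(x - r)%R, (x + r)%R]%classic : set R) by exact: measurable_itv.
rewrite (measure_limsetI conf mB).
have sub : `[(x - r)%R, (x + r)%R]%classic `&` limset primes_set `<=`
    \bigcup_(p in near_digits (u n) t rho) cyl (rcons w p).
  move=> z [/= + /limset_digits[v pv vz]]; rewrite in_itv/= => /andP[z1 z2].
  have zr : `|x - z| <= r by rewrite ler_norml; apply/andP; split; lra.
  have [wv|wv] := eqVneq w (mkseq v n); last first.
    have [y /unit_halfP yh zy] := vz n.
    have v2 : all (leq 2) (mkseq v n) := words_digits (words_mkseq n pv).
    have := gphiw_separation w2 v2 (etrans ww.1 (esym (size_mkseq v n))) wv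
      (half_gphi _ _ pa th) yh.
    by rewrite zy -xt => h; have := lt_le_trans rn (le_trans h zr); rewrite ltxx.
  have vzn := vz n.+1; rewrite mkseqS_rcons -wv in vzn.
  have [s sh zs] := cyl_rcons_inv vzn.
  exists (v n) => //; split; first exact: pv.
  exists s => //.
  have /andP[s0 s1] := half_gphi _ _ (pv n) sh.
  have /andP[t0 t1] := half_gphi _ _ pa th.
  have /andP[gs1 gs2] : Q w <= gden w (gphi (v n) s) <= 2 * Q w by apply: gden_distortion => //; apply/andP.
  have /andP[gt1 gt2] : Q w <= gden w (gphi (u n) t) <= 2 * Q w by apply: gden_distortion => //; apply/andP.
  move: zr; rewrite xt zs gphiwB// ler_pdivrMr; last by rewrite mulr_gt0//; lra.
  rewrite distrC => /le_trans; apply; rewrite /rho mulrC ler_pM2r//.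
  rewrite (_ : 4 * Q w ^+ 2 = (2 * Q w) * (2 * Q w)); last by ring.
  by rewrite ler_pM//; lra.
have ra : 1 <= 32 * rho * (u n)%:R ^+ 2.
  have /andP[_ h] := gden_rcons_bounds R w2 a2.
  rewrite mkseqS_rcons -/w in rn1.
  have q0 : 0 < Q (rcons w (u n)).
    by apply: gden_gt0 => //; exact: words_digits (words_rcons ww pa).
  have h2 : 32 * Q (rcons w (u n)) ^+ 2 <= 32 * (2 * Q w * (u n)%:R) ^+ 2.
    by rewrite ler_pM2l// lerXn2r// ?nnegrE ?mulr_ge0// ltW.
  have q20 : 0 < 32 * Q (rcons w (u n)) ^+ 2 by rewrite mulr_gt0// exprn_gt0.
  have : 1 <= r * (32 * Q (rcons w (u n)) ^+ 2) by rewrite -ler_pdivrMr// div1r.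
  move=> /le_trans; apply; apply: (le_trans (ler_wpM2l (ltW r0) h2)).
  rewrite /rho le_eqVlt; apply/orP; left; apply/eqP; ring.
have mBL : measurable (`[(x - r)%R, (x + r)%R]%classic `&` limset primes_set : set R).
  by apply: measurableI => //; exact: measurable_limset.
apply: le_trans (near _ _ _ _ _ _ ww pa th rho0 ra mBL sub) _.
rewrite lee_fin -[leRHS]mulrA ler_pM2l// [leLHS]mulrA [leRHS]mulrA.
have g0 : 0 <= gauge d (trunc_log 2 (u n)).
  by apply/ltW/gauge_gt0; rewrite trunc_log_gt0.
rewrite ler_wpM2r//.
have -> : Q w `^ (- (2 * d)) * rho `^ d = (4 * r) `^ d.
  have rhoE : rho = (4 * r) * Q w `^ 2%:R by rewrite powR_mulrn ?(ltW Q0)// /rho; ring.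
  rewrite rhoE [X in _ * X]powRM ?powR_ge0 ?mulr_ge0 ?(ltW r0)// -powRrM.
  rewrite mulrCA -powRD; last by apply/implyP => _; rewrite gt_eqF.
  by rewrite addNr powRr0 mulr1.
rewrite powRM ?(ltW r0)// ler_wpM2r ?powR_ge0//.
by apply: ler1_powR; [lra|exact: ltW].
Qed.

Definition tailset n m : set R := \bigcup_(w in words primes_set n)
  \bigcup_(p in [set p | prime p /\ (2 ^ m <= p)%N]) cyl (rcons w p).

Lemma measurable_tail_at n w m : words primes_set n w ->
  measurable (\bigcup_(p in [set p | prime p /\ (2 ^ m <= p)%N]) cyl (rcons w p)).
Proof.
move=> ww; apply: countable_bigcup_measurable => p [pp _].
by apply: measurable_cyl; exact: words_digits (words_rcons ww pp).
Qed.

Lemma measurable_tailset n m : measurable (tailset n m).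
Proof. by apply: countable_bigcup_measurable => w; exact: measurable_tail_at. Qed.

Lemma cyl_rcons_sub n w p : words primes_set n w -> prime p -> cyl (rcons w p) `<=` cyl w.
Proof. by move=> ww pp; rewrite -cats1; apply: cyl_sub; rewrite /= prime_gt1. Qed.

Lemma tailset_cyl n m w : words primes_set n w ->
  tailset n m `&` cyl w = \bigcup_(p in [set p | prime p /\ (2 ^ m <= p)%N]) cyl (rcons w p).
Proof.
move=> ww; apply/seteqP; split=> x.
  move=> [[v wv [p [pp mp] vx]] wx].
  have vw : v = w.
    apply: (cyl_inj (words_digits wv) (words_digits ww) _ (cyl_rcons_sub wv pp vx) wx).
    by rewrite wv.1 ww.1.
  by exists p => //; rewrite -vw.
move=> [p [pp mp] px]; split; last exact: (cyl_rcons_sub ww pp).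
by exists w => //; exists p.
Qed.

(** The lower Gibbs bound trades [Q^(-2 d)] for the mass of the cylinder of each word, and these
    masses add up to at most 1. *)
Lemma tailset_measure_le : exists2 C, 0 < C & forall n m, (0 < m)%N ->
  (mu (tailset n m) <= (C * tailw d m)%:E)%E.
Proof.
have [C C0 tail] := tail_measure_le conf d_gt d_lt1.
exists (C * expR 2); first by rewrite mulr_gt0 ?expR_gt0.
move=> n m m0.
set k := C * expR 2 * tailw d m.
have t0 := tailw_gt0 d m0.
have k0 : 0 <= k by exact: ltW (mulr_gt0 (mulr_gt0 C0 (expR_gt0 _)) t0).
have -> : tailset n m = tailset n m `&` \bigcup_(w in words primes_set n) cyl w.
  apply/esym/setIidPl => x [w ww [p [pp mp] px]]; exists w => //; exact: (cyl_rcons_sub ww pp).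
have mU := @measurable_bigcup_cyl R n _ (@subset_refl _ (words primes_set n)).
apply: (@le_trans _ _ (k%:E * mu (\bigcup_(w in words primes_set n) cyl w))%E).
  apply: measure_bigcup_countable_le.
  - exact: measurable_tailset.
  - by move=> w ww; apply: measurable_cyl; exact: words_digits ww.
  - exact: (@trivIset_cyl R n).
  move=> w ww; rewrite tailset_cyl//.
  have h := tail n w m _ ww m0 (measurable_tail_at m ww) (fun x px => px).
  apply: (le_trans h).
  apply: (@le_trans _ _ (k%:E * (expR (- 2) * Q w `^ (- (2 * d)))%:E)%E).
    rewrite -EFinM lee_fin le_eqVlt; apply/orP; left; apply/eqP.
    rewrite /k expRN; have := expR_gt0 (2 : R); move: (expR 2) => e e0.
    by field; rewrite gt_eqF.
  by apply: lee_wpmul2l; [rewrite lee_fin|exact: gibbs_ge ww].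
rewrite -[leRHS]mule1; apply: lee_wpmul2l; first by rewrite lee_fin.
exact: probability_le1.
Qed.

End BallMeasure.

(** * Convergence *)

Section MassDistribution.
Variable R : realType.

Lemma summable_tail (u : nat -> R) K : (forall k, (K <= k)%N -> 0 <= u k) ->
  (\sum_(K <= k <oo) (u k)%:E < +oo)%E ->
  forall e, 0 < e -> exists2 k0, (K <= k0)%N & forall n, \sum_(i < n) u (k0 + i)%N <= e.
Proof.
move=> u0 fin e e0.
pose S n := \sum_(i < n) u (K + i)%N.
have SB n : ((S n)%:E <= \sum_(K <= k <oo) (u k)%:E)%E.
  have := @nneseries_lim_ge R (fun k => (u k)%:E) xpredT K (K + n)%N.
  move=> h; apply: le_trans (h _); last by move=> k Kk _; rewrite lee_fin u0.
  by rewrite sumEFin lee_fin -{1}[K]add0n big_addn addKn big_mkord; under eq_bigr do rewrite addnC.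
set T := (\sum_(K <= k <oo) (u k)%:E)%E in fin SB *.
have T0 : (0 <= T)%E by apply: le_trans (SB 0%N); rewrite /S big_ord0.
have Tfin : T \is a fin_num by rewrite ge0_fin_numE.
have SB' n : S n <= fine T by rewrite -lee_fin fineK.
have supS : has_sup (range S).
  by split; [exists (S 0%N); exists 0%N|exists (fine T) => _ [n _ <-]].
have [_ [n1 _ <-] hn1] := sup_adherent e0 supS.
exists (K + n1)%N; first exact: leq_addr.
move=> n; have : S (n1 + n)%N <= sup (range S).
  by apply: ub_le_sup; [exact: supS.2|exists (n1 + n)%N].
rewrite /S big_split_ord/= -/(S n1).
under [X in _ + X]eq_bigr do rewrite addnA.
lra.
Qed.

Lemma diam_ge (U : set R) (e x y : R) : (forall x y, U x -> U y -> `|x - y| <= e) ->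
  U x -> U y -> `|x - y| <= diam U.
Proof.
move=> Ue Ux Uy; rewrite /diam; apply: ub_le_sup; last by exists x => //; exists y.
by exists e => _ [a Ua [b Ub <-]]; exact: Ue.
Qed.

Lemma diam_le (U : set R) (e x : R) : (forall x y, U x -> U y -> `|x - y| <= e) ->
  U x -> diam U <= e.
Proof.
move=> Ue Ux; apply: ge_sup; first by exists `|x - x|; exists x => //; exists x.
by move=> _ [a Ua [b Ub <-]]; exact: Ue.
Qed.

(** A covering set that meets [G] is enclosed in a ball centred in [G] with its diameter as radius.
    Sets of diameter 0 cost nothing, since [psi0] vanishes at 0, so points of [G] have to be null;
    the small values of [psi] ensure this. *)
Lemma mass_distribution (mu : probability R R) (psi : R -> R) (A G : set R) (e c M : R) :
  0 < M -> measurable G -> G `<=` A -> (c%:E <= mu G)%E ->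
  (forall r : R, 0 < r -> 0 < psi r) ->
  (forall e' : R, 0 < e' -> exists2 r : R, 0 < r <= e & psi r < e') ->
  (forall x r : R, G x -> 0 < r <= e -> (mu `[(x - r)%R, (x + r)%R]%classic <= (psi r / M)%:E)%E) ->
  ((M * c)%:E <= hausdorff_eps psi e A)%E.
Proof.
move=> M0 mG GA cG psi_pos psie Gb.
apply: le_ereal_inf_tmp => _ [U [AU Ue] <-].
pose r i := diam (U i).
have point0 x : G x -> mu [set x] = 0%E.
  move=> Gx; apply/eqP; rewrite eq_le measure_ge0 andbT; apply/lee_addgt0Pr => e' e'0.
  rewrite add0e.
  have [s /andP[s0 se] ps] := psie (M * e') (mulr_gt0 M0 e'0).
  have sse : 0 < s <= e by rewrite s0.
  apply: (@le_trans _ _ (mu `[(x - s)%R, (x + s)%R]%classic)).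
    apply: le_measure; rewrite ?inE; [exact: measurable_set1|exact: measurable_itv|].
    by move=> _ ->; rewrite /= in_itv/=; apply/andP; split; lra.
  apply: (le_trans (Gb x s Gx sse)); rewrite lee_fin ler_pdivrMr// mulrC; exact: ltW.
have : forall i, exists V : set R, [/\ measurable V, U i `&` G `<=` V &
    (mu V <= (M^-1 * psi0 psi (r i))%:E)%E].
  move=> i; have [[x [Ux Gx]]|n] := pselect (U i `&` G !=set0); last first.
    exists set0; split => //; first by move=> x UGx; apply: n; exists x.
    rewrite measure0 lee_fin mulr_ge0 ?invr_ge0 ?(ltW M0)// /psi0.
    by case: ifP => // h; exact/ltW/psi_pos.
  have Ui := @diam_ge (U i) e _ _ (Ue i).
  have [r0|r0] := ltP 0 (r i).
    exists `[(x - r i)%R, (x + r i)%R]%classic; split; first exact: measurable_itv.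
      move=> y [Uy _]; have := Ui y x Uy Ux.
      by rewrite ler_norml /= in_itv/= -/(r i) => /andP[h1 h2]; apply/andP; split; lra.
    apply: le_trans (Gb x _ Gx _) _; first by rewrite r0; exact: diam_le (Ue i) Ux.
    by rewrite /psi0 r0 mulrC.
  exists [set x]; split; first exact: measurable_set1.
    move=> y [Uy _]; apply/eqP; rewrite /= -subr_eq0 -normr_le0.
    exact: le_trans (Ui y x Uy Ux) r0.
  by rewrite point0// /psi0 ltNge r0/= mulr0.
move=> /choice[V hV].
have mV i : measurable (V i) by case: (hV i).
have GV : G `<=` \bigcup_i V i.
  move=> x Gx; have [i _ Ux] := AU _ (GA _ Gx).
  by exists i => //; have [_ h _] := hV i; apply: h.
have p0 i : 0 <= psi0 psi (r i) by rewrite /psi0; case: ifP => // h; exact/ltW/psi_pos.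
have : (mu G <= (M^-1)%:E * \sum_(0 <= i <oo) (psi0 psi (r i))%:E)%E.
  apply: (le_trans (measure_sigma_subadditive mu mV mG GV)).
  rewrite -nneseriesZl; last by move=> i _; rewrite lee_fin.
  by apply: lee_nneseries => [i _ _|i _]; [exact: measure_ge0|rewrite -EFinM; case: (hV i)].
move=> /(le_trans cG) h.
rewrite EFinM -[leRHS]mul1e -(divff (lt0r_neq0 M0)) EFinM -muleA.
by apply: lee_wpmul2l => //; rewrite lee_fin ltW.
Qed.

End MassDistribution.

(** * Sets of full measure have infinite Hausdorff measure *)

Section InfiniteMeasure.
Variables (R : realType) (d : R) (mu : probability R R).
Hypotheses (conf : conformal primes_set d mu) (d_gt : 2^-1 < d) (d_lt1 : d < 1).
Local Notation cyl := (@cyl R).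
Local Notation "'Q' w" := (@gden R w 0) (at level 10).

Lemma least_gauge m0 (z : R) : (0 < m0)%N -> exists m, [/\ (m0 <= m)%N, z < gauge d m &
  forall j, (m0 <= j < m)%N -> gauge d j <= z].
Proof.
move=> m00; have [C C0 qm] := gauge_quasi_mono d_lt1.
have g0 := gauge_gt0 d m00.
have [m1 m10 hm1] := gauge_unbounded d_lt1 (`|z| + C * gauge d m0).
have ex : exists m, (m0 <= m)%N && (z < gauge d m).
  exists m1; apply/andP; split; last first.
    apply: le_lt_trans (ler_norm z) (le_lt_trans _ hm1).
    by rewrite lerDl mulr_ge0// ltW.
  rewrite leqNgt; apply/negP => m1m0.
  have : gauge d m1 <= C * gauge d m0 by apply: qm; rewrite m10 ltnW.
  by have := normr_ge0 z; lra.
exists (ex_minn ex); case: ex_minnP => m /andP[m0m zm] min; split=> // j /andP[m0j jm].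
rewrite leNgt; apply/negP => zj.
by have := min j; rewrite m0j zj => /(_ isT); rewrite leqNgt jm.
Qed.

(** These cylinders have separation scale at least [1 / j], which provides a radius, uniform over
    the set, below which balls are resolved at level [n] or deeper. *)
Definition wide n (j : nat) : set R :=
  \bigcup_(w in [set w | words primes_set n w /\ 32 * Q w ^+ 2 <= j%:R]) cyl w.

Lemma measurable_wide n j : measurable (wide n j).
Proof. by apply: (@measurable_bigcup_cyl R n) => w []. Qed.

Lemma exists_wide n (e : R) : 0 < e -> exists2 j, (0 < j)%N & (mu (~` wide n j) <= e%:E)%E.
Proof.
move=> e0; have mW := measurable_wide n.
have cv : mu (wide n j) @[j --> \oo] --> mu (\bigcup_j wide n j).
  apply: nondecreasing_cvg_mu => //; first exact: bigcupT_measurable.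
  move=> i j ij; apply/subsetPset => x [w [ww wi] wx]; exists w => //; split=> //.
  by apply: (le_trans wi); rewrite ler_nat.
have U1 : mu (\bigcup_j wide n j) = 1%E.
  apply/eqP; rewrite eq_le probability_le1//=; last exact: bigcupT_measurable.
  have <- : mu (limset primes_set) = 1%E.
    rewrite -(probability_setT mu) [RHS](measure_limsetI conf measurableT).
    by rewrite setTI.
  apply: le_measure; rewrite ?inE; [exact: measurable_limset|exact: bigcupT_measurable|].
  move=> x /limset_digits[u pu ux]; have ww := words_mkseq n pu.
  exists (Num.truncn (32 * Q (mkseq u n) ^+ 2)).+1 => //.
  by exists (mkseq u n) => //; split=> //; apply: ltW; exact: truncnS_gt.
rewrite U1 in cv; have cv' := fine_cvg cv.
have near1 : \forall j \near \oo, 1 - e < fine (mu (wide n j)).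
  by apply: (cvgr_gt 1 (cv' _)); lra.
near \oo => j; exists j; first by near: j; exact: nbhs_infty_gt.
have h : 1 - e < fine (mu (wide n j)) by near: j; exact: near1.
rewrite probability_setC// -(@fineK _ (mu (wide n j))) ?fin_num_measure//.
by rewrite -EFinB lee_fin; lra.
Unshelve. all: end_near. Qed.

Lemma pow4_ge (lam : R) : 1 < lam -> exists2 L, (0 < L)%N & lam <= 4 ^+ L.
Proof.
move=> l1; exists (Num.truncn lam).+1 => //.
apply: (@le_trans _ _ (Num.truncn lam).+1%:R); first by apply: ltW; exact: truncnS_gt.
by rewrite -natrX ler_nat ltnW// ltn_expl.
Qed.

(** Radii resolved at level [n] are at most [4^(-n)], hence at most [lam^(-k)] with [k = n %/ L];
    this is how [y k] governs level [n]. *)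
Lemma pow_ratio_le (lam : R) L n : 1 < lam -> lam <= 4 ^+ L -> (0 < L)%N ->
  (4 ^+ n)^-1 <= lam ^- (n %/ L).
Proof.
move=> l1 lL L0; have l0 : 0 < lam by lra.
rewrite lef_pV2 ?posrE ?exprn_gt0//.
apply: (@le_trans _ _ ((4 ^+ L) ^+ (n %/ L))); first by apply: lerXn2r => //; rewrite nnegrE ?exprn_ge0 ?(ltW l0).
by rewrite -exprM ler_weXn2l ?ler1n// mulnC leq_trunc_div.
Qed.

Lemma exists_scale (u : nat -> nat) n0 (r : R) : (forall i, prime (u i)) -> 0 < r ->
  r < (32 * Q (mkseq u n0) ^+ 2)^-1 ->
  exists2 n, (n0 <= n)%N &
   r < (32 * Q (mkseq u n) ^+ 2)^-1 /\ (32 * Q (mkseq u n.+1) ^+ 2)^-1 <= r.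
Proof.
move=> pu r0 rn0.
have w2 n := words_digits (words_mkseq n pu).
have ex : exists n, (n0 <= n)%N && ((32 * Q (mkseq u n.+1) ^+ 2)^-1 <= r).
  set z := Num.truncn r^-1.
  exists (n0 + z)%N; rewrite leq_addr andTb.
  have Qz : r^-1 <= Q (mkseq u (n0 + z).+1).
    apply: (@le_trans _ _ z.+1%:R); first by apply: ltW; exact: truncnS_gt.
    apply: le_trans (gden_ge (w2 (n0 + z).+1) (lexx 0)).
    rewrite size_mkseq -natrX ler_nat.
    apply: leq_trans (_ : 2 ^ z.+1 <= _)%N; first by rewrite ltnW// ltn_expl.
    by rewrite leq_exp2l// ltnS leq_addl.
  have Q1 := gden0_ge1 R (w2 (n0 + z).+1).
  move: Qz Q1; move: (Q _) => q Qz q1.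
  have q20 : 0 < 32 * q ^+ 2 by nra.
  rewrite -[leRHS]invrK lef_pV2 ?posrE ?invr_gt0//.
  by apply: (le_trans Qz); nra.
exists (ex_minn ex); case: ex_minnP => n /andP[n0n hn] min => //.
split=> //; have [<-//|nn] := eqVneq n0 n.
have nn0 : (n0 < n)%N by rewrite ltn_neqAle nn.
rewrite ltNge; apply/negP => h.
have := min n.-1; rewrite prednK ?(leq_trans _ nn0)// h andbT.
rewrite -ltnS prednK ?(leq_trans _ nn0)// => /(_ isT).
by rewrite leqNgt ltn_predL (leq_trans _ nn0).
Qed.

Lemma le_Q_pow4 w : all (leq 2) w -> (32 * Q w ^+ 2)^-1 <= (4 ^+ size w)^-1.
Proof.
move=> w2; have Q0 : 0 < Q w by exact: gden_gt0.
rewrite lef_pV2 ?posrE ?mulr_gt0 ?exprn_gt0//.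
have h : 4 ^+ size w <= Q w ^+ 2.
  have -> : 4 ^+ size w = (2 ^+ size w) ^+ 2 :> R by rewrite expr2 -exprMn; congr (_ ^+ _); ring.
  by rewrite lerXn2r ?nnegrE ?exprn_ge0 ?(ltW Q0)//; exact: gden_ge.
by apply: (le_trans h); rewrite ler_peMl ?sqr_ge0// ler1n.
Qed.

Lemma hausdorff_infinite (psi : R -> R) (y : nat -> R) (lam : R) K (A : set R) :
  1 < lam -> (forall k, (K <= k)%N -> 1 < y k) ->
  (\sum_(K <= k <oo) (series_term d (y k))%:E < +oo)%E ->
  (forall r : R, 0 < r -> 0 < psi r) ->
  (forall e e' : R, 0 < e -> 0 < e' -> exists2 r : R, 0 < r <= e & psi r < e') ->
  (forall k (r : R), 0 < r -> r <= lam ^- k -> r `^ d * y k <= psi r) ->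
  measurable A -> mu (~` A) = 0%E ->
  hausdorff psi A = +oo%E.
Proof.
move=> l1 y1 fin psi_pos psi0 psiy mA A0.
have [C C0 ball] := ball_measure conf d_gt d_lt1.
have [C1 C10 tails] := tailset_measure_le conf d_gt d_lt1.
have [L L0 lL] := pow4_ge l1.
suff H M : 0 < M -> ((M / 2)%:E <= hausdorff psi A)%E.
  apply/eqyP => M M0; have := H (2 * M) (mulr_gt0 (ltr0n _ 2) M0).
  by rewrite mulrAC divff// mul1r.
move=> M0.
have CM0 : 0 < C * M by rewrite mulr_gt0.
have [C2 C20 tw] := tailw_le_term d_gt d_lt1 CM0.
(* The critical exponents. Exceeding [y k / (C M)] makes the tail at [mm k] at most a multiple of
   the term of the series; minimality keeps the gauges before [mm k] below [y k / (C M)]. *)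
have /choice[mm hmm] : forall k, exists m, [/\ (0 < m)%N, y k < C * M * gauge d m &
    forall j, (0 < j < m)%N -> C * M * gauge d j <= y k].
  move=> k; have [m [m0 ym min]] := least_gauge (y k / (C * M)) (ltn0Sn 0).
  exists m; split=> //; first by move: ym; rewrite ltr_pdivrMr// mulrC.
  by move=> j /min; rewrite ler_pdivlMr// mulrC.
pose Bad n : set R := tailset n (mm (n %/ L)%N).
have mBad n : measurable (Bad n) by exact: measurable_tailset.
have badb n : (K <= n %/ L)%N -> (mu (Bad n) <= (C1 * (C2 * series_term d (y (n %/ L)%N)))%:E)%E.
  move=> kn; have [m0 ym _] := hmm (n %/ L)%N.
  apply: (le_trans (tails _ _ m0)); rewrite lee_fin ler_pM2l//.
  by apply: tw => //; [exact: y1|exact: ltW].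
(* With this bound on the tail of the series the bad sets have total mass at most 1/4; the factor
   [L] counts the levels that share one [k]. *)
have c0 : 0 < (4 * (L%:R * (C1 * C2)))^-1 by rewrite invr_gt0 !mulr_gt0 ?ltr0n.
have [k0 Kk0 small] := summable_tail (fun k h => ltW (series_term_gt0 d (y1 k h))) fin c0.
pose n0 := (L * k0)%N.
pose BU := \bigcup_i Bad (n0 + i)%N.
have mBU : measurable BU by apply: bigcupT_measurable => i; exact: mBad.
have BUq : (mu BU <= (4^-1)%:E)%E.
  pose F i := \bigcup_(j in [set` iota 0 L]) Bad (L * (k0 + i) + j)%N.
  have mF i : measurable (F i) by apply: countable_bigcup_measurable => j _; exact: mBad.
  apply: (@measure_le_sum _ _ _ mu _ F (fun i => L%:R * (C1 * (C2 * series_term d (y (k0 + i)%N))))) => //.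
  - move=> x [i _ Bx]; exists (i %/ L)%N => //; exists (i %% L)%N; first by rewrite /= mem_iota ltn_mod.
    by rewrite mulnDr -addnA (mulnC L (i %/ L)%N) -divn_eq.
  - move=> i; rewrite -[X in (X%:R * _)%:E](size_iota 0 L).
    apply: (@measure_bigsetU_le _ _ _ mu _ _ (fun j => Bad (L * (k0 + i) + j)%N)) => //.
    move=> j; rewrite mem_iota add0n => /andP[_ jL].
    have E : ((L * (k0 + i) + j) %/ L = k0 + i)%N by rewrite mulnC divnMDl// divn_small// addn0.
    by have := badb (L * (k0 + i) + j)%N; rewrite E => /(_ (leq_trans Kk0 (leq_addr _ _))).
  - move=> n; rewrite -mulr_sumr -mulr_sumr -mulr_sumr.
    have := small n; set S := \sum_(_ < _) _ => hS.
    have K0 : 0 < L%:R * (C1 * C2) by rewrite !mulr_gt0 ?ltr0n.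
    have -> : L%:R * (C1 * (C2 * S)) = L%:R * (C1 * C2) * S by ring.
    rewrite mulrC -ler_pdivlMr//; apply: (le_trans hS); by rewrite invfM.
have [j j0 hj] := @exists_wide n0 4^-1 ltac:(lra).
(* Mass at least 1/2 remains: 1/4 may go to bad letters and 1/4 to cylinders of level [n0] that are
   too narrow. *)
pose G := A `&` limset primes_set `&` wide n0 j `\` BU.
have mW := measurable_wide n0 j.
have mL := @measurable_limset R.
have mG : measurable G by apply: measurableD => //; apply: measurableI => //; exact: measurableI.
have GA : G `<=` A by move=> x [[[]]].
have halfG : ((2^-1)%:E <= mu G)%E.
  have CG : (mu (~` G) <= (2^-1)%:E)%E.
    have -> : ~` G = (~` A `|` ~` limset primes_set) `|` (~` wide n0 j `|` BU).
      by rewrite /G setDE !setCI setCK setUA.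
    apply: (le_trans (measureU2 mu _ _)).
    + by apply: measurableU; exact: measurableC.
    + by apply: measurableU => //; exact: measurableC.
    have -> : 2^-1 = 0 + (4^-1 + 4^-1) :> R by lra.
    rewrite EFinD; apply: leeD.
      apply: (le_trans (measureU2 mu _ _)); [exact: measurableC|exact: measurableC|].
      by rewrite /= A0 conf.1 add0e.
    apply: (le_trans (measureU2 mu _ _)); [exact: measurableC|by []|].
    by rewrite EFinD; apply: leeD.
  move: CG; rewrite probability_setC// -(@fineK _ (mu G)) ?fin_num_measure//.
  by rewrite -EFinB !lee_fin; lra.
have jR : 0 < (2 * j%:R)^-1 :> R by rewrite invr_gt0 mulr_gt0// ltr0n.
apply: (@le_trans _ _ (hausdorff_eps psi (2 * j%:R)^-1 A)); last first.
  by apply: ereal_sup_ubound; exists (2 * j%:R)^-1 => //; rewrite /= in_itv/= jR.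
apply: (mass_distribution M0 mG GA halfG psi_pos) => [e' e'0|x r]; first exact: psi0.
move=> [[[_ /limset_digits[u pu ux]] [w [ww wj] wx]] nB] /andP[r0 rj].
have w2 n := words_digits (words_mkseq n pu).
have wu : w = mkseq u n0.
  by apply: (cyl_inj (words_digits ww) (w2 n0) _ wx (ux n0)); rewrite ww.1 size_mkseq.
have rn0 : r < (32 * Q (mkseq u n0) ^+ 2)^-1.
  apply: (le_lt_trans rj); rewrite ltf_pV2 ?posrE ?mulr_gt0 ?ltr0n ?exprn_gt0 ?gden_gt0//.
  rewrite -wu; apply: (le_lt_trans wj); have : 0 < j%:R :> R by rewrite ltr0n.
  lra.
have [n nn0 [rn rn1]] := exists_scale pu r0 rn0.
apply: (le_trans (ball u x r n pu ux r0 rn rn1)); rewrite lee_fin ler_pdivlMr//.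
have kn : (k0 <= n %/ L)%N by rewrite leq_divRL// mulnC.
set k := (n %/ L)%N in kn.
have [m0 _ min] := hmm k.
(* A point of [G] is in no bad set, so its next letter stays below [2^(mm k)], and minimality of
   [mm k] bounds the gauge of that letter. *)
have um : (u n < 2 ^ mm k)%N.
  rewrite ltnNge; apply/negP => h; apply: nB; exists (n - n0)%N => //.
  rewrite subnKC//; exists (mkseq u n); first exact: words_mkseq.
  by exists (u n); [split|rewrite -mkseqS_rcons].
have /andP[l1' l2'] := dyadic_block (prime_gt0 (pu n)).
have tm : (0 < trunc_log 2 (u n) < mm k)%N.
  rewrite trunc_log_gt0/= prime_gt1//=.
  by rewrite -(ltn_exp2l _ _ (ltnSn 1)); exact: leq_ltn_trans um.
have rk : r <= lam ^- k.
  apply: (le_trans (ltW rn)); apply: le_trans (pow_ratio_le n l1 lL L0).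
  by have := le_Q_pow4 (w2 n); rewrite size_mkseq.
apply: le_trans (psiy k r r0 rk).
rewrite [leLHS](_ : _ = r `^ d * (C * M * gauge d (trunc_log 2 (u n)))); last by ring.
by rewrite ler_wpM2l ?powR_ge0// min.
Qed.

End InfiniteMeasure.

(** * Divergence *)

Section Growth.
Variables (R : realType) (d : R) (mu : probability R R).
Hypotheses (conf : conformal primes_set d mu) (d_gt : 2^-1 < d) (d_lt1 : d < 1).
Local Notation cyl := (@cyl R).
Local Notation "'Q' w" := (@gden R w 0) (at level 10).

Definition large_den n (L : R) : set R :=
  \bigcup_(w in [set w | words primes_set n w /\ L <= Q w]) cyl w.

Lemma measurable_large_den n L : measurable (large_den n L).
Proof. by apply: (@measurable_bigcup_cyl R n) => w []. Qed.

(** Moment exponent: the block of letters near [2^j] weighs at most about [2^(j (1 - 2 d + e))],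
    which is [2^(-j e)] for this [e]. Then [t] is the ratio of consecutive blocks and [Z] the factor
    paid per letter. *)
Let e := (2 * d - 1) / 2.
Let t := expR (- (e * ln 2)).
Let Z := 2 `^ e / (1 - t).

Let e0 : 0 < e.
Proof. by rewrite /e; have := d_gt; lra. Qed.

Let t01 : 0 < t < 1.
Proof. by rewrite expR_gt0/= /t -[X in _ < X]expR0 ltr_expR oppr_lt0 mulr_gt0. Qed.

Let Z0 : 0 < Z.
Proof. by rewrite divr_gt0 ?powR_gt0// subr_gt0; case/andP: t01. Qed.

(* Chernoff bound: the factor [2 p] by which a letter [p] can enlarge the denominator has a finite
   moment of order [e]. *)
Lemma large_den_le n (L : R) : 0 < L -> (mu (large_den n L) <= (Z ^+ n * L `^ (- e))%:E)%E.
Proof.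
elim: n L => [|n IH] L L0.
  have [L1|L1] := leP L 1.
    apply: (@le_trans _ _ 1%E); first by apply: probability_le1; exact: measurable_large_den.
    rewrite expr0 mul1r lee_fin powRN -[leLHS]invr1 lef_pV2 ?posrE ?powR_gt0//.
    rewrite [leRHS](_ : 1 = 1 `^ e); last by rewrite powR1.
    apply: ge0_ler_powR; rewrite ?nnegrE//; exact: ltW.
  have -> : large_den 0 L = set0.
    apply/seteqP; split=> // x [w [[/size0nil -> _]]] /=; lra.
  by rewrite measure0 expr0 mul1r lee_fin powR_ge0.
(* Since [Q (p :: w) <= 2 p Q w], a large denominator after prepending [p] forces [Q w] to be at
   least [L / (2 p)]. *)
pose F p := @gphi R p @` large_den n (L / (2 * p%:R)).
have FE p : F p = \bigcup_(w in [set w | words primes_set n w /\ L / (2 * p%:R) <= Q w]) cyl (p :: w).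
  by rewrite /F image_bigcup; apply: eq_bigcupr => w _; rewrite cyl_cons.
have mF p : prime p -> measurable (F p).
  move=> pp; rewrite FE; apply: countable_bigcup_measurable => w [ww _].
  by apply: measurable_cyl; rewrite /= prime_gt1//=; exact: words_digits ww.
pose X := Z ^+ n * L `^ (- e) * 2 `^ e.
have X0 : 0 <= X by rewrite !mulr_ge0 ?powR_ge0 ?exprn_ge0// ltW.
pose b j := X * expR (- (j%:R * ((2 * d - e) * ln 2))).
apply: le_trans (@measure_dyadic_blocks R mu (large_den n.+1 L) F b X t 0 _ mF _ _ X0 t01 _) _.
- exact: measurable_large_den.
- move=> x [[|p w] [ww Lw] wx]; first by case: ww.
  have [pp wv] := words_cons ww.
  exists p; first by split=> //; exact: prime_gt0.
  rewrite FE; exists w => //; split=> //.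
  have p0 : 1 <= p%:R :> R by rewrite ler1n prime_gt0.
  have w2 := words_digits wv.
  have /andP[_ h] := gden_cons_bounds R p w2.
  rewrite ler_pdivrMr; last by lra.
  apply: (le_trans Lw); apply: (le_trans h); rewrite mulrC ler_pM2l ?gden_gt0//; lra.
- move=> j p _ pp /andP[jp _].
  have p0 : 0 < p%:R :> R by rewrite ltr0n prime_gt0.
  have lF : (mu (F p) <= (p%:R `^ (- (2 * d)))%:E * mu (large_den n (L / (2 * p%:R))))%E.
    apply: (measure_gphi_image_le conf) => //.
    + exact: measurable_large_den.
    + by move=> x [w [ww _] wx]; exact: (cyl_unit_half (words_digits ww)).
    + exact: mF.
    move=> x [w [ww _] wx].
    have /unit_halfP/andP[x0 _] := cyl_unit_half (words_digits ww) wx.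
    by apply: powR_natN => //; rewrite ?lerDl// ltr_wpDr.
  apply: (le_trans lF).
  apply: (@le_trans _ _ ((p%:R `^ (- (2 * d)))%:E * (Z ^+ n * (L / (2 * p%:R)) `^ (- e))%:E)%E).
    apply: lee_wpmul2l; first by rewrite lee_fin powR_ge0.
    by apply: IH; rewrite divr_gt0// mulr_gt0.
  rewrite -EFinM lee_fin.
  have -> : (L / (2 * p%:R)) `^ (- e) = L `^ (- e) * (2 `^ e * p%:R `^ e).
    rewrite powRM ?invr_ge0 ?mulr_ge0 ?(ltW L0) ?(ltW p0)//; congr (_ * _).
    have pp0 : 0 <= 2 * p%:R :> R by rewrite mulr_ge0.
    by rewrite -powRM ?(ltW p0)// -(powR_inv1 pp0) -powRrM mulN1r opprK.
  have -> : p%:R `^ (- (2 * d)) * (Z ^+ n * (L `^ (- e) * (2 `^ e * p%:R `^ e))) =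
      X * (p%:R `^ (- (2 * d)) * p%:R `^ e) by rewrite /X; ring.
  rewrite /b ler_wpM2l// -powRD; last by apply/implyP => _; rewrite gt_eqF.
  have -> : - (2 * d) + e = - (2 * d - e) by ring.
  apply: (@le_trans _ _ ((2 ^ j)%:R `^ (- (2 * d - e)))).
    rewrite !powRN lef_pV2 ?posrE ?powR_gt0// ?ltr0n ?expn_gt0//.
    apply: ge0_ler_powR; rewrite ?nnegrE ?ler_nat//.
    by rewrite /e; have := d_gt; lra.
  by rewrite pow2_powR mulNr mulrN.
- move=> j _; rewrite /b mulrCA ler_wpM2l// /t -expRM_natl.
  apply: (@le_trans _ _ ((2 ^ j)%:R * expR (- (j%:R * ((2 * d - e) * ln 2))))).
    rewrite ler_wpM2r ?expR_ge0// ler_nat /nprimes (leq_trans (count_size _ _))//.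
    by rewrite size_iota expnS; lia.
  rewrite natrX -[X in X ^+ _]lnK ?posrE// -expRM_natl -expRD ler_expR le_eqVlt; apply/orP; left; apply/eqP.
  by rewrite /e; field.
rewrite lee_fin expr0 mulr1 /X exprS le_eqVlt; apply/orP; left; apply/eqP.
by rewrite /Z; ring.
Qed.

(** With [lam^(c e) >= 2 Z], the Chernoff bound at [L = lam^(c n)] leaves [2^(-n)], which is
    summable for Borel-Cantelli. *)
Lemma gden_growth (lam : R) : 1 < lam -> exists2 c, (0 < c)%N &
  forall n, (mu (large_den n (lam ^+ (c * n))) <= ((2 ^+ n)^-1)%:E)%E.
Proof.
move=> l1; have l0 : 0 < lam by lra.
have ll0 : 0 < ln lam by rewrite ln_gt0.
have Z20 : 0 < 2 * Z by rewrite mulr_gt0.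
set q := `|ln (2 * Z)| / (ln lam * e).
have le0 : 0 < ln lam * e by rewrite mulr_gt0.
set c := (Num.truncn q).+1.
have qc : q < c%:R by exact: truncnS_gt.
exists c => // n.
apply: (le_trans (large_den_le n (exprn_gt0 _ l0))).
have h : `|ln (2 * Z)| <= c%:R * (ln lam * e) by rewrite -ler_pdivrMr// ltW.
have h2 : ln 2 + ln Z <= c%:R * (ln lam * e).
  by rewrite -lnM ?posrE//; exact: le_trans (ler_norm _) h.
rewrite lee_fin powR_expR ?exprn_gt0// lnXn// -[ln lam *+ _]mulr_natl natrM.
have -> : Z ^+ n = expR (n%:R * ln Z) by rewrite expRM_natl lnK ?posrE.
have -> : (2 ^+ n)^-1 = expR (- (n%:R * ln 2)) :> R by rewrite expRN expRM_natl lnK ?posrE.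
rewrite -expRD ler_expR.
have := ler_wpM2l (ler0n R n) h2; rewrite mulrDr.
rewrite (_ : - e * (c%:R * n%:R * ln lam) = - (n%:R * (c%:R * (ln lam * e)))); last by ring.
by move: (n%:R * (_ * _)) (n%:R * ln 2) (n%:R * ln Z) => a b0 b1; lra.
Qed.

End Growth.

(** * Large letters occur infinitely often *)

Section Hits.
Variables (R : realType) (d : R) (mu : probability R R).
Hypotheses (conf : conformal primes_set d mu) (d_gt : 2^-1 < d) (d_lt1 : d < 1).
Local Notation cyl := (@cyl R).
Local Notation "'Q' w" := (@gden R w 0) (at level 10).
Local Notation "'Qd' w" := (@gden R w 0 `^ (- (2 * d))) (at level 10).

Definition tail_at (w : seq nat) (m : nat) : set R :=
  \bigcup_(p in [set p | prime p /\ (2 ^ m <= p)%N]) cyl (rcons w p).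

Lemma tail_at_ge : exists2 c, 0 < c & forall n w m, words primes_set n w -> (8 <= m)%N ->
  ((c * (Qd w * tailw d m))%:E <= mu (tail_at w m))%E.
Proof.
exists (expR (- 2) / 4 * expR (4%:R * (- (2 * d) * ln 2))).
  by rewrite !mulr_gt0 ?expR_gt0.
move=> n w m ww m8; have mR : 0 < m%:R :> R by rewrite ltr0n (leq_trans _ m8).
pose b := expR (- 2) / 4 * (Qd w * (2 ^ (m + 4))%:R `^ (- (2 * d))).
pose s := [seq p <- index_iota (2 ^ m) (2 ^ (m + 4)) | prime p].
have sP p : p \in s -> prime p /\ (2 ^ m <= p < 2 ^ (m + 4))%N.
  by rewrite mem_filter mem_index_iota => /andP[].
have wr p : p \in s -> words primes_set n.+1 (rcons w p).
  by move=> /sP[pp _]; exact: words_rcons.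
have b0 : 0 <= b by rewrite mulr_ge0 ?divr_ge0 ?expR_ge0// mulr_ge0 ?powR_ge0.
apply: (@le_trans _ _ (\sum_(p <- s) b)%:E).
  rewrite big_const_seq count_predT iter_addr_0 lee_fin /s size_filter -/(nprimes _ _) -[leRHS]mulr_natl.
  have := nprimes_long_dyadic_ge m8; rewrite -(ler_nat R) natrM.
  set N := (nprimes _ _)%:R => hN.
  have {}hN : (2 ^ m)%:R / m%:R <= N by rewrite ler_pdivrMr.
  apply: le_trans (ler_wpM2r b0 hN).
  have E4 : (2 ^ (m + 4))%:R `^ (- (2 * d)) =
      expR (m%:R * (- (2 * d) * ln 2)) * expR (4%:R * (- (2 * d) * ln 2)).
    by rewrite pow2_powR natrD mulrDl expRD.
  rewrite /b E4 /tailw.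
  have -> : (2 ^ m)%:R = expR (m%:R * ln 2) :> R by rewrite natrX expRM_natl lnK ?posrE.
  have -> : expR (- (m%:R * ((2 * d - 1) * ln 2))) = expR (m%:R * ln 2) * expR (m%:R * (- (2 * d) * ln 2)) :> R.
    by rewrite -expRD; congr expR; ring.
  rewrite le_eqVlt; apply/orP; left; apply/eqP; ring.
apply: (@sum_le_measure _ _ _ mu _ _ _ (fun p => cyl (rcons w p))).
- exact: measurable_tail_at ww.
- by rewrite filter_uniq// iota_uniq.
- by move=> p /wr /words_digits; exact: measurable_cyl.
- by move=> p /sP[pp /andP[mp _]] x px; exists p.
- move=> p q ps qs /eqP pq; apply/seteqP; split=> // x [px qx]; apply: pq.
  have := cyl_inj (words_digits (wr _ ps)) (words_digits (wr _ qs)) _ px qx.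
  by rewrite !size_rcons => /(_ erefl) /rcons_inj[].
move=> p ps; have [pp /andP[_ mp]] := sP p ps.
apply: le_trans (gibbs_rcons_ge conf d_gt d_lt1 ww pp).
have Q0 : 0 < Q w by apply: gden_gt0 => //; exact: words_digits ww.
rewrite lee_fin /b ler_wpM2l ?divr_ge0 ?expR_ge0// ler_wpM2l ?powR_ge0//.
apply: powR_natN => //; rewrite ?ltr0n ?expn_gt0 ?prime_gt0// ler_nat; exact: ltnW.
Qed.

Lemma tail_at_ge_cyl : exists2 c, 0 < c & forall n w m, words primes_set n w -> (8 <= m)%N ->
  ((c * tailw d m)%:E * mu (cyl w) <= mu (tail_at w m))%E.
Proof.
have [c c0 tail] := tail_at_ge.
exists (c * expR (- 2)); first by rewrite mulr_gt0 ?expR_gt0.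
move=> n w m ww m8; apply: le_trans (tail n w m ww m8).
have t0 : 0 <= tailw d m by apply/ltW/tailw_gt0; exact: leq_trans m8.
have k0 : 0 <= c * expR (- 2) * tailw d m by rewrite !mulr_ge0 ?expR_ge0// ltW.
apply: (@le_trans _ _ ((c * expR (- 2) * tailw d m)%:E * (expR 2 * Qd w)%:E)%E).
  by apply: lee_wpmul2l; [rewrite lee_fin|exact: gibbs_le ww].
rewrite -EFinM lee_fin le_eqVlt; apply/orP; left; apply/eqP.
by rewrite expRN; have := expR_gt0 (2 : R); move: (expR 2) => x x0; field; rewrite gt_eqF.
Qed.

Variables (m : nat -> nat) (good : pred nat).
Hypothesis m8 : forall n, (8 <= m n)%N.

Definition nohit N k : set (seq nat) := [set w | words primes_set (N + k) w /\
  forall i, (i < k)%N -> good (N + i)%N -> (nth 0 w (N + i) < 2 ^ m (N + i))%N].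

Definition nohit_set N k : set R := \bigcup_(w in nohit N k) cyl w.

Lemma measurable_nohit N k : measurable (nohit_set N k).
Proof. by apply: (@measurable_bigcup_cyl R (N + k)) => w []. Qed.

Lemma words_belast n w : words primes_set n.+1 w ->
  exists v p, [/\ w = rcons v p, words primes_set n v & prime p].
Proof.
case/lastP: w => [[]//|v p] [sw h]; exists v, p; split=> //.
  split; first by move: sw; rewrite size_rcons => -[].
  by move=> i iv; apply: h; rewrite mem_rcons inE iv orbT.
by apply: h; rewrite mem_rcons mem_head.
Qed.

Lemma nohitS N k w : nohit N k.+1 w -> exists v p,
  [/\ w = rcons v p, nohit N k v, prime p & good (N + k)%N -> (p < 2 ^ m (N + k))%N].
Proof.
rewrite /nohit addnS => -[ww h]; have [v [p [Ew wv pp]]] := words_belast ww.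
have sv : size v = (N + k)%N by case: wv.
exists v, p; split=> //.
  split=> // i ik gi; have := h i (ltnW ik) gi.
  by rewrite Ew nth_rcons sv ltn_add2l ik.
by move=> gk; have := h k (ltnSn k) gk; rewrite Ew nth_rcons sv ltnn eqxx.
Qed.

Lemma nohit_sub N k : nohit_set N k.+1 `<=` nohit_set N k.
Proof.
move=> x [w /nohitS[v [p [-> vN pp _]]] wx]; exists v => //.
exact: cyl_rcons_sub vN.1 pp _ wx.
Qed.

(** Inside each cylinder of the past, a large letter has conditional mass at least [c * tailw],
    whatever that past is; this uniformity stands in for independence. *)
Lemma nohit_step : exists2 c, 0 < c & forall N k, good (N + k)%N ->
  (mu (nohit_set N k.+1) <= (1 - c * tailw d (m (N + k)%N))%:E * mu (nohit_set N k))%E.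
Proof.
have [c c0 tail] := tail_at_ge_cyl.
exists c => // N k gk; set n := (N + k)%N; set W := nohit_set N k.
have mW : measurable W := @measurable_nohit N k.
have mT := @measurable_tailset R n (m n).
have t0 : 0 <= tailw d (m n) by apply/ltW/tailw_gt0; exact: leq_trans (m8 n).
have ct0 : 0 <= c * tailw d (m n) by rewrite mulr_ge0// ltW.
have hit : ((c * tailw d (m n))%:E * mu W <= mu (tailset n (m n) `&` W))%E.
  apply: measure_bigcup_countable_ge => //.
  - by move=> w [ww _]; apply: measurable_cyl; exact: words_digits ww.
  - by apply: (@trivIset_cyl R n) => w [].
  by move=> w [ww _]; rewrite tailset_cyl//; exact: tail ww (m8 n).
have sub : nohit_set N k.+1 `<=` W `\` tailset n (m n).
  move=> x wx; split; first exact: nohit_sub wx.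
  case: wx => w /nohitS[v [p [-> vN pp /(_ gk) pm]]] wx [v' wv' [q [qq mq] qx]].
  have := cyl_inj (words_digits (words_rcons vN.1 pp)) (words_digits (words_rcons wv' qq)) _ wx qx.
  rewrite !size_rcons vN.1.1 wv'.1 => /(_ erefl) /rcons_inj[_ pq].
  by move: pm; rewrite pq ltnNge mq.
have mD : measurable (W `\` tailset n (m n)) by exact: measurableD.
apply: (@le_trans _ _ (mu (W `\` tailset n (m n)))).
  by apply: le_measure; rewrite ?inE//; exact: measurable_nohit.
have E : mu W = (mu (tailset n (m n) `&` W) + mu (W `\` tailset n (m n)))%E.
  rewrite setIC -measureU//; [by rewrite setUIDK|exact: measurableI|].
  by rewrite setDE setIACA setICr setI0.
have mTW : measurable (tailset n (m n) `&` W) by exact: measurableI.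
move: hit E; rewrite -(@fineK _ (mu W)) ?fin_num_measure//.
rewrite -(@fineK _ (mu (tailset n (m n) `&` W))) ?fin_num_measure//.
rewrite -(@fineK _ (mu (W `\` _))) ?fin_num_measure//.
move: (fine (mu W)) (fine (mu (_ `&` _))) (fine _) => x y z.
rewrite -EFinD -!EFinM !lee_fin => h [E].
by rewrite mulrBl mul1r; lra.
Qed.

Lemma nohit_le : exists2 c, 0 < c & forall N k,
  (mu (nohit_set N k) <= (expR (- (c * \sum_(i < k | good (N + i)%N) tailw d (m (N + i)%N))))%:E)%E.
Proof.
have [c c0 step] := nohit_step.
exists c => // N; elim=> [|k IH].
  rewrite big_ord0 mulr0 oppr0 expR0; apply: probability_le1; exact: measurable_nohit.
rewrite big_mkcond big_ord_recr/= -big_mkcond/=; case: ifPn => gk; last first.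
  rewrite addr0; apply: le_trans IH.
  by apply: le_measure; rewrite ?inE; [exact: measurable_nohit..|exact: nohit_sub].
apply: (le_trans (step N k gk)).
apply: (@le_trans _ _ ((expR (- (c * tailw d (m (N + k)%N))))%:E * mu (nohit_set N k))%E).
  rewrite lee_wpmul2r// lee_fin.
  by apply: le_trans (expR_ge1Dx _).
rewrite mulrDr opprD expRD [in leRHS]mulrC EFinM.
by apply: lee_wpmul2l => //; rewrite lee_fin expR_ge0.
Qed.

Lemma nohit_null N :
  (forall B, exists k, B <= \sum_(i < k | good (N + i)%N) tailw d (m (N + i)%N)) ->
  mu (\bigcap_k nohit_set N k) = 0%E.
Proof.
move=> unb; have [c c0 le] := nohit_le.
apply/eqP; rewrite eq_le measure_ge0 andbT; apply/lee_addgt0Pr => e e0; rewrite add0e.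
have [k hk] := unb (- ln e / c).
apply: (@le_trans _ _ (mu (nohit_set N k))).
  apply: le_measure; rewrite ?inE; [|exact: measurable_nohit|exact: bigcap_inf].
  by apply: bigcap_measurable => [|i _]; [exists 0%N|exact: measurable_nohit].
apply: (le_trans (le N k)); rewrite lee_fin -[leRHS]lnK ?posrE// ler_expR lerNl.
by move: hk; rewrite ler_pdivrMr// mulrC.
Qed.

End Hits.

Section VanishingMeasure.
Variables (R : realType) (d : R) (mu : probability R R).
Hypotheses (conf : conformal primes_set d mu) (d_gt : 2^-1 < d) (d_lt1 : d < 1).
Local Notation tail_at := (@tail_at R).
Local Notation "'Q' w" := (@gden R w 0) (at level 10).

Lemma sum_subsample_le (u : nat -> R) L n : (forall k l, (k <= l)%N -> u l <= u k) ->
  \sum_(k < L * n) u k <= L%:R * \sum_(i < n) u (L * i)%N.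
Proof.
move=> u_dec; elim: n => [|n IH]; first by rewrite muln0 !big_ord0 mulr0.
rewrite big_ord_recr/= mulrDr mulnS addnC big_split_ord/= lerD//.
rewrite mulr_natl -[X in _ *+ X]card_ord -sumr_const; apply: ler_sum => i _.
by apply: u_dec; exact: leq_addr.
Qed.

(** The scale met at level [n] is only known to exceed [lam^(-L n)], so the series is sampled at
    multiples of [L]; for nonincreasing terms this costs at most the factor [L]. *)
Lemma unbounded_subsample (u : nat -> R) L : (0 < L)%N ->
  (forall k l, (k <= l)%N -> u l <= u k) -> (forall k, 0 <= u k) ->
  (forall B, exists n, B <= \sum_(k < n) u k) ->
  forall B, exists n, B <= \sum_(i < n) u (L * i)%N.
Proof.
move=> L0 u_dec u0 unb B; have LR : 0 < L%:R :> R by rewrite ltr0n.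
have [n hn] := unb (L%:R * B); exists n.
rewrite -(ler_pM2l LR); apply: (le_trans hn); apply: le_trans (sum_subsample_le L n u_dec).
rewrite -(subnKC (leq_pmull n L0)) big_split_ord/= lerDl.
by apply: sumr_ge0.
Qed.

(** On the discarded levels the tail weight is exponentially small, so the rest still diverges. The
    discarded levels will be those where [2^(mm n)] exceeds [lam^n]. *)
Lemma unbounded_good (u tau : nat -> R) (good : pred nat) (C rho : R) N :
  0 < C -> 0 < rho < 1 -> (forall n, 0 <= tau n) -> (forall n, 0 <= u n) ->
  (forall n, u n <= C * tau n) ->
  (forall n, ~~ good n -> tau n <= rho ^+ n) ->
  (forall B, exists n, B <= \sum_(k < n) u k) ->
  forall B, exists k, B <= \sum_(i < k | good (N + i)%N) tau (N + i)%N.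
Proof.
move=> C0 rho01 tau0 u0 utau bad unb B.
set S := \sum_(i < N) tau i; set T := rho ^+ N / (1 - rho).
have [k hk] := unb (C * (S + (T + B))); exists k.
have h1 : \sum_(i < k) u i <= C * (S + \sum_(i < k) tau (N + i)%N).
  apply: (@le_trans _ _ (\sum_(i < N + k) u i)).
    by rewrite addnC big_split_ord/= lerDl sumr_ge0.
  apply: (@le_trans _ _ (\sum_(i < N + k) C * tau i)); first exact: ler_sum.
  by rewrite -mulr_sumr big_split_ord.
have h2 : \sum_(i < k) tau (N + i)%N <= \sum_(i < k | good (N + i)%N) tau (N + i)%N + T.
  rewrite (bigID (fun i : 'I_k => good (N + i)%N))/= lerD2l.
  apply: (@le_trans _ _ (\sum_(i < k) 1 * rho ^+ (N + i))).
    rewrite big_mkcond/=; apply: ler_sum => i _; rewrite mul1r; case: ifPn => [/bad//|_].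
    by rewrite exprn_ge0// ltW//; case/andP: rho01.
  by apply: (le_trans (@geometric_sum_le R 1 rho N k _ rho01)) => //; rewrite mul1r.
have := le_trans hk h1; rewrite ler_pM2l// lerD2l; lra.
Qed.

Lemma gauge_succ j : (0 < j)%N -> gauge d j.+1 <= 2 * gauge d j.
Proof.
move=> j0; have jR : 0 < j%:R :> R by rewrite ltr0n.
rewrite /gauge [leRHS]mulrA; apply: ler_pM; rewrite ?expR_ge0 ?invr_ge0//.
  have E2 : expR (ln 2) = 2 :> R by rewrite lnK ?posrE.
  rewrite -[X in _ <= X * _]E2 -expRD ler_expR -natr1 mulrDl mul1r addrC lerD2r.
  by rewrite ler_piMl ?(ltW (ln2_gt0 R))//; have := d_gt; lra.
by rewrite lef_pV2 ?posrE ?ltr0n// ler_nat.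
Qed.

(** All these subcylinders lie in the image under [phi w] of [[0, 2^(-m)]]: one short set covers
    infinitely many of them, which is what makes the cover cheap. *)
Lemma tail_at_dist n w m x y : words primes_set n w -> tail_at w m x -> tail_at w m y ->
  `|x - y| <= (Q w ^+ 2 * 2 ^+ m)^-1.
Proof.
move=> ww [p [pp mp] px] [q [pq mq] qy].
have w2 := words_digits ww.
have [s /andP[s0 _] ->] := cyl_rcons_inv px; have [t /andP[t0 _] ->] := cyl_rcons_inv qy.
have bnd (r : nat) (z : R) : prime r -> (2 ^ m <= r)%N -> 0 <= z -> 0 <= gphi r z <= (2 ^+ m)^-1.
  move=> pr mr z0; have r0 : 0 < r%:R :> R by rewrite ltr0n prime_gt0.
  rewrite /gphi div1r invr_ge0 addr_ge0//= lef_pV2 ?posrE ?exprn_gt0 ?ltr_wpDr//.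
  by rewrite -natrX (le_trans (_ : _ <= r%:R)) ?ler_nat// lerDl.
have /andP[a0 a1] := bnd p s pp mp s0; have /andP[b0 b1] := bnd q t pq mq t0.
have Q0 : 0 < Q w by exact: gden_gt0.
have ge u : 0 <= u <= 2^-1 -> Q w <= gden w u by move=> hu; case/andP: (gden_distortion w2 hu).
have half (r : nat) (z : R) : prime r -> 0 <= z -> 0 <= gphi r z <= 2^-1.
  by move=> pr z0; apply: gphi_bounds => //; exact: prime_gt1.
have ga := ge _ (half p s pp s0); have gb := ge _ (half q t pq t0).
have ga0 := lt_le_trans Q0 ga; have gb0 := lt_le_trans Q0 gb.
rewrite gphiwB// [leRHS]invfM [leRHS]mulrC; apply: ler_pM => //.
- by rewrite invr_ge0 ltW// mulr_gt0.
- by rewrite ler_norml; apply/andP; split; lra.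
- rewrite lef_pV2 ?posrE ?mulr_gt0 ?exprn_gt0//.
  by rewrite expr2 ler_pM// ltW.
Qed.

Lemma diam_set0 : diam (set0 : set R) = 0.
Proof.
rewrite /diam (_ : [set `|x - y| | x in set0 & y in set0] = set0) ?sup0//.
by apply/seteqP; split=> // z [x []].
Qed.

Lemma psi0_diam_le (psi : R -> R) (U : set R) (r : R) :
  (forall x y : R, 0 < x -> x <= y -> psi x <= psi y) -> 0 <= psi r ->
  (forall x y, U x -> U y -> `|x - y| <= r) -> psi0 psi (diam U) <= psi r.
Proof.
move=> mono p0 Ur; rewrite /psi0; case: ifPn => // d0; apply: mono => //.
have [[x Ux]|/set0P/negP/negPn/eqP U0] := pselect (U !=set0); first exact: diam_le Ux.
by rewrite U0 diam_set0 ltxx in d0.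
Qed.

End VanishingMeasure.

(** * Covers by first hits *)

Section Cover.
Variables (R : realType) (d : R) (mu : probability R R).
Hypotheses (conf : conformal primes_set d mu) (d_gt : 2^-1 < d) (d_lt1 : d < 1).
Local Notation cyl := (@cyl R).
Local Notation tail_at := (@tail_at R).
Local Notation "'Q' w" := (@gden R w 0) (at level 10).
Variables (mm : nat -> nat) (good : pred nat) (thr : nat -> R).

Definition hit n w := [/\ words primes_set n w, good n & Q w < thr n].

Definition hit_set n : set R := \bigcup_(w in hit n) tail_at w (mm n).

Lemma measurable_tail_hit n w : words primes_set n w -> measurable (tail_at w (mm n)).
Proof. exact: measurable_tail_at. Qed.

Lemma measurable_hit_set n : measurable (hit_set n).
Proof. by apply: countable_bigcup_measurable => w [ww _ _]; exact: measurable_tail_hit. Qed.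

Definition limsup_hit : set R := lim_sup_set hit_set.

Lemma measurable_limsup_hit : measurable limsup_hit.
Proof.
apply: bigcap_measurable => [|N _]; first by exists 0%N.
by apply: bigcup_measurable => n _; exact: measurable_hit_set.
Qed.

(** Stopping words: the first hit from level [N] on. Stopping makes the covering sets disjoint, so
    that their masses, and with them the cost of the cover, have a bounded sum. *)
Definition first_hit N : set (seq nat) := [set w |
  [/\ (N <= size w)%N, hit (size w) w &
    forall i, (N <= i < size w)%N -> hit i (take i w) -> (nth 0 w i < 2 ^ mm i)%N]].

Lemma take_words n i w : words primes_set n w -> (i <= n)%N -> words primes_set i (take i w).
Proof.
move=> [sw h] ni; split; first by rewrite size_takel ?sw.
by move=> j /mem_take; exact: h.
Qed.

Lemma cyl_take n i w : words primes_set n w -> cyl w `<=` cyl (take i w).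
Proof.
move=> [sw h]; rewrite -{1}(cat_take_drop i w); apply: cyl_sub.
by apply/allP => j /mem_drop /h /prime_gt1.
Qed.

Lemma tail_at_cyl n w m : words primes_set n w -> tail_at w m `<=` cyl w.
Proof. by move=> ww x [p [pp _] px]; exact: cyl_rcons_sub ww pp _ px. Qed.

(** If two of the sets met, the shorter word would be a prefix of the longer one, which would then
    have been stopped earlier. *)
Lemma trivIset_first_hit N : trivIset (first_hit N) (fun w => tail_at w (mm (size w))).
Proof.
suff H w w' x : first_hit N w -> first_hit N w' -> (size w <= size w')%N ->
    tail_at w (mm (size w)) x -> tail_at w' (mm (size w')) x -> w = w'.
  move=> w w' Sw Sw' [x [wx w'x]].
  have [le|/ltnW le] := leqP (size w) (size w'); first exact: H Sw Sw' le wx w'x.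
  by apply/esym; exact: H Sw' Sw le w'x wx.
move=> [Nw hw _] [_ hw' nh] le wx w'x.
have ww := let: And3 h _ _ := hw in h.
have ww' := let: And3 h _ _ := hw' in h.
have cw := tail_at_cyl ww wx; have cw' := tail_at_cyl ww' w'x.
have wt := take_words ww' le.
have Et : w = take (size w) w'.
  by apply: (cyl_inj (words_digits ww) (words_digits wt) _ cw (cyl_take _ ww' cw')); rewrite wt.1.
have [E|lt] := eqVneq (size w) (size w'); first by rewrite Et E take_size.
have {}lt : (size w < size w')%N by rewrite ltn_neqAle lt.
have := nh (size w); rewrite Nw lt -Et => /(_ isT hw) small.
have [p [pp mp] px] := wx.
have wt1 := take_words ww' lt.
have := cyl_inj (words_digits (words_rcons ww pp)) (words_digits wt1) _ px (cyl_take _ ww' cw').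
rewrite size_rcons wt1.1 (take_nth 0%N lt) -Et => /(_ erefl) /rcons_inj[Ep].
by move: small; rewrite -Ep ltnNge mp.
Qed.

Lemma limsup_hit_cover N : limsup_hit `<=` \bigcup_(w in first_hit N) tail_at w (mm (size w)).
Proof.
move=> x Ax; have [n0 Nn0 Hn0] := Ax N I.
have ex : exists n, `[< (N <= n)%N /\ hit_set n x >] by exists n0; apply/asboolP.
case: (ex_minnP ex) => n /asboolP[Nn [w hw wx]] min.
have ww := let: And3 h _ _ := hw in h.
have sw := ww.1.
exists w; last by rewrite sw.
split; rewrite ?sw// => i /andP[Ni ni] hi; rewrite ltnNge; apply/negP => mi.
have := min i; rewrite (leqNgt n i) ni => H; suff : false by []; apply: H.
apply/asboolP; split=> //; exists (take i w) => //.
exists (nth 0%N w i); first by split=> //; apply: ww.2; rewrite mem_nth// sw.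
by rewrite -take_nth ?sw//; exact: (cyl_take i.+1 ww (tail_at_cyl ww wx)).
Qed.

(** Each covering set costs at most [K] times its mass, and the sets are disjoint. The starting
    level [N] exceeds [1 / e] and denominators are at least [2^N], so the diameters are at most
    [e]. *)
Lemma hausdorff_limsup_hit_le (psi : R -> R) (K : R) : 0 <= K ->
  (forall r : R, 0 < r -> 0 < psi r) ->
  (forall x y : R, 0 < x -> x <= y -> psi x <= psi y) ->
  (forall n w, hit n w -> ((psi (Q w ^+ 2 * 2 ^+ mm n)^-1)%:E <= K%:E * mu (tail_at w (mm n)))%E) ->
  (hausdorff psi limsup_hit <= K%:E)%E.
Proof.
move=> K0 psi_pos mono bnd; apply: ge_ereal_sup => _ [e + <-]; rewrite /= in_itv/= andbT => e0.
pose N := (Num.truncn e^-1).+1.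
pose J w := tail_at w (mm (size w)).
pose U := picked (first_hit N) J.
have hS w : first_hit N w -> words primes_set (size w) w by case=> _ [].
have mJ w : first_hit N w -> measurable (J w) by move=> /hS; exact: measurable_tail_hit.
have rpos w : first_hit N w -> 0 < (Q w ^+ 2 * 2 ^+ mm (size w))^-1.
  move=> /hS ww; rewrite invr_gt0 mulr_gt0 ?exprn_gt0//.
  by apply: gden_gt0 => //; exact: words_digits ww.
apply: ge_ereal_inf; exists (\sum_(0 <= i <oo) (psi0 psi (diam (U i)))%:E)%E.
  exists U => //; split; first by rewrite bigcup_picked; exact: limsup_hit_cover.
  move=> i x y; rewrite /U /picked; case: (pickle_inv i) => [w|//].
  case: ifPn => [/set_mem Sw|_ []] wx wy; have ww := hS w Sw.
  apply: (le_trans (tail_at_dist ww wx wy)).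
  have w2 := words_digits ww.
  have Q0 : 0 < Q w by exact: gden_gt0.
  have NQ : e^-1 <= Q w.
    apply: (@le_trans _ _ N%:R); first by apply: ltW; exact: truncnS_gt.
    apply: le_trans (gden_ge w2 (lexx (0 : R))); rewrite -natrX ler_nat.
    apply: leq_trans (_ : 2 ^ N <= _)%N; first by rewrite ltnW// ltn_expl.
    by rewrite leq_exp2l//; case: Sw.
  have Q1 := gden0_ge1 R w2.
  rewrite -[leRHS]invrK lef_pV2 ?posrE ?invr_gt0 ?mulr_gt0 ?exprn_gt0//.
  apply: (le_trans NQ); move: Q1 Q0; move: (Q w) => q q1 q0.
  have h : 1 <= 2 ^+ mm (size w) :> R by rewrite exprn_ege1// ler1n.
  by move: h; move: (2 ^+ _) => z z1; rewrite expr2; nra.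
have psiJ i : ((psi0 psi (diam (U i)))%:E <= K%:E * mu (U i))%E.
  rewrite /U /picked; case: (pickle_inv i) => [w|].
    case: ifPn => [/set_mem Sw|_].
      have ww := hS w Sw; have [_ hw _] := Sw.
      apply: le_trans (bnd _ _ hw); rewrite lee_fin; apply: psi0_diam_le => //.
        exact/ltW/psi_pos/rpos.
      by move=> x y Jx Jy; exact: (tail_at_dist ww Jx Jy).
    by rewrite diam_set0 /psi0 ltxx measure0 mule0.
  by rewrite diam_set0 /psi0 ltxx measure0 mule0.
have p0 i : 0 <= psi0 psi (diam (U i)) by rewrite /psi0; case: ifP => // h; exact/ltW/psi_pos.
apply: (@le_trans _ _ (\sum_(0 <= i <oo) K%:E * mu (U i))%E).
  by apply: lee_nneseries => [i _ _|i _]; [rewrite lee_fin|].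
rewrite nneseriesZl// -measure_picked//; last exact: trivIset_first_hit.
rewrite -[leRHS]mule1; apply: lee_wpmul2l; first by rewrite lee_fin.
apply: probability_le1; apply: countable_bigcup_measurable => w; exact: mJ.
Qed.

(** By Borel-Cantelli almost every point has denominators below [thr n] at all large levels. If such
    a point has only finitely many hits, then for some [N] it lies in every [nohit_set N k], a null
    event. *)
Lemma limsup_hit_full : (forall n, (8 <= mm n)%N) ->
  (forall n, (mu (large_den n (thr n)) <= ((2 ^+ n)^-1)%:E)%E) ->
  (forall N (B : R), exists k, B <= \sum_(i < k | good (N + i)%N) tailw d (mm (N + i)%N)) ->
  mu (~` limsup_hit) = 0%E.
Proof.
move=> m8 growth unb.
pose LS := lim_sup_set (fun n => large_den n (thr n)).
have mD n : measurable (large_den n (thr n)) by exact: measurable_large_den.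
have mLS : measurable LS.
  apply: bigcap_measurable => [|N _]; first by exists 0%N.
  by apply: bigcup_measurable => n _; exact: mD.
have LS0 : mu LS = 0%E.
  apply: lim_sup_set_cvg0 => //; apply: (@le_lt_trans _ _ 2%:E); last exact: ltry.
  apply: lime_le; first by apply: is_cvg_nneseries.
  apply: nearW => n; rewrite big_mkord; apply: (@le_trans _ _ (\sum_(i < n) 1 * (2^-1) ^+ (0 + i) : R)%:E).
    by rewrite -sumEFin; apply: lee_sum => i _; rewrite mul1r add0n exprVn; exact: growth.
  have t01 : 0 < (2^-1 : R) < 1 by apply/andP; split; lra.
  rewrite lee_fin; apply: (le_trans (@geometric_sum_le R 1 2^-1 0 n ler01 t01)).
  by rewrite expr0 mulr1 ler_pdivrMr; lra.
pose NH := \bigcup_N \bigcap_k @nohit_set R mm good N k.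
have mNHN N : measurable (\bigcap_k @nohit_set R mm good N k).
  by apply: bigcap_measurable => [|k _]; [exists 0%N|exact: measurable_nohit].
have mNH : measurable NH by apply: bigcupT_measurable.
have NH0 : mu NH = 0%E.
  apply/eqP; rewrite eq_le measure_ge0 andbT.
  apply: (@measure_le_sum _ _ _ mu _ (fun N => \bigcap_k @nohit_set R mm good N k) (fun=> 0)) => //.
    by move=> N; rewrite le_eqVlt; apply/orP; left; apply/eqP; exact: nohit_null (unb N).
  by move=> n; rewrite big1.
have mA := measurable_limsup_hit.
have mL := @measurable_limset R.
have sub : ~` limsup_hit `<=` ~` limset primes_set `|` (LS `|` NH).
  move=> x nA; have [xL|] := pselect (limset primes_set x); last by left.
  right; have [|nLS] := pselect (LS x); [by left|right].
  have [u pu ux] := limset_digits xL.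
  have [N1 hN1] : exists N, forall n, (N <= n)%N -> ~ hit_set n x.
    apply: contrapT => h; apply: nA => N _; apply: contrapT => h2; apply: h.
    by exists N => n Nn Hn; apply: h2; exists n.
  have [N2 hN2] : exists N, forall n, (N <= n)%N -> ~ large_den n (thr n) x.
    apply: contrapT => h; apply: nLS => N _; apply: contrapT => h2; apply: h.
    by exists N => n Nn Hn; apply: h2; exists n.
  exists (maxn N1 N2) => // k _; set N := maxn N1 N2.
  exists (mkseq u (N + k)) => //; split; first exact: words_mkseq.
  move=> i ik gi; rewrite nth_mkseq ?ltn_add2l//.
  rewrite ltnNge; apply/negP => mi.
  have n1 : (N1 <= N + i)%N by rewrite (leq_trans (leq_maxl N1 N2)) ?leq_addr.
  have n2 : (N2 <= N + i)%N by rewrite (leq_trans (leq_maxr N1 N2)) ?leq_addr.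
  apply: (hN1 _ n1); exists (mkseq u (N + i)).
    split=> //; first exact: words_mkseq.
    rewrite ltNge; apply/negP => h; apply: (hN2 _ n2).
    by exists (mkseq u (N + i)) => //; split=> //; exact: words_mkseq.
  by exists (u (N + i)%N); [split|rewrite -mkseqS_rcons].
apply/eqP; rewrite eq_le measure_ge0 andbT.
apply: (@le_trans _ _ (mu (~` limset primes_set `|` (LS `|` NH)))).
  apply: le_measure => //; rewrite inE; first exact: measurableC.
  by apply: measurableU; [exact: measurableC|exact: measurableU].
apply: (le_trans (measureU2 mu _ _)); [exact: measurableC|exact: measurableU|].
rewrite [X in (X + _)%E]conf.1 add0e.
by apply: (le_trans (measureU2 mu mLS mNH)); rewrite [X in (X + _)%E]LS0 add0e [leLHS]NH0.
Qed.

End Cover.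

Section ZeroMeasure.
Variables (R : realType) (d : R) (mu : probability R R).
Hypotheses (conf : conformal primes_set d mu) (d_gt : 2^-1 < d) (d_lt1 : d < 1).
Local Notation "'Q' w" := (@gden R w 0) (at level 10).
Local Notation "'Qd' w" := (@gden R w 0 `^ (- (2 * d))) (at level 10).

Lemma hausdorff_ge0 (psi : R -> R) (A : set R) :
  (forall r : R, 0 < r -> 0 < psi r) -> (0 <= hausdorff psi A)%E.
Proof.
move=> psi_pos; apply: (@le_trans _ _ (hausdorff_eps psi 1 A)); last first.
  by apply: ereal_sup_ubound; exists 1 => //; rewrite /= in_itv/= ltr01.
apply: le_ereal_inf_tmp => _ [U _ <-]; apply: nneseries_ge0 => i _ _.
by rewrite lee_fin /psi0; case: ifP => // h; exact/ltW/psi_pos.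
Qed.

Lemma unbounded_const (c : R) : 0 < c -> forall B, exists n, B <= \sum_(k < n) c.
Proof.
move=> c0 B; exists (Num.truncn (`|B| / c)).+1.
rewrite sumr_const card_ord -mulr_natl; apply: (le_trans (ler_norm B)).
by rewrite -ler_pdivrMr//; apply: ltW; exact: truncnS_gt.
Qed.

(** By minimality the preceding gauge is at most [M * y], and one step at most doubles it. At the
    floor [m = 8] there is no predecessor to invoke and [2 <= y] gives the bound; hence the minimum
    of two constants. *)
Lemma least_gauge_bound (M : R) : 0 < M -> exists2 B, 0 < B & forall y m, 2 <= y -> (8 <= m)%N ->
  (forall j, (8 <= j < m)%N -> gauge d j <= M * y) -> B * gauge d m <= y.
Proof.
move=> M0; have g8 : 0 < gauge d 8 by exact: gauge_gt0.
have M20 : 0 < (2 * M)^-1 by rewrite invr_gt0 mulr_gt0.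
have g80 : 0 < 2 / gauge d 8 by rewrite divr_gt0.
exists (Num.min (2 * M)^-1 (2 / gauge d 8)); first by rewrite lt_min M20.
move=> y m y2 m8 min; have g0 : 0 < gauge d m by apply: gauge_gt0; exact: leq_trans m8.
move: m8; rewrite leq_eqVlt => /predU1P[E|m8].
  rewrite -E in g0 *; apply: le_trans y2.
  by rewrite -ler_pdivlMr// ge_min lexx orbT.
apply: (@le_trans _ _ ((2 * M)^-1 * gauge d m)).
  by rewrite ler_pM2r// ge_min lexx.
rewrite ler_pdivrMl ?mulr_gt0//.
case: m m8 min g0 => // j j8 min g0.
apply: le_trans (gauge_succ d_gt (leq_trans (isT : 0 < 8)%N j8)) _.
by rewrite -mulrA ler_pM2l// min// ltnSn andbT.
Qed.

Lemma tailw_le_ratio m n (lam : R) : (0 < m)%N -> 1 < lam -> lam ^+ n <= 2 ^+ m ->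
  tailw d m <= expR (- ((2 * d - 1) * ln lam)) ^+ n.
Proof.
move=> m0 l1 h; have l0 : 0 < lam by lra.
have mR : 1 <= m%:R :> R by rewrite ler1n.
have h2 : n%:R * ln lam <= m%:R * ln 2.
  by rewrite !mulr_natl -!lnXn// ler_ln ?posrE ?exprn_gt0.
rewrite /tailw -expRM_natl.
apply: (@le_trans _ _ (expR (- (m%:R * ((2 * d - 1) * ln 2))))).
  by rewrite ler_pdivrMr ?ler_peMr ?expR_ge0//; lra.
have d0 : 0 <= 2 * d - 1 by have := d_gt; lra.
have := ler_wpM2l d0 h2.
by rewrite ler_expR mulrN lerN2 !mulrA [n%:R * _]mulrC [m%:R * _]mulrC.
Qed.

Lemma hausdorff_measure_zero (psi : R -> R) (y : nat -> R) (lam : R) :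
  1 < lam -> (forall k, 2 <= y k) -> (forall k l, (k <= l)%N -> y k <= y l) ->
  (forall B, exists n, B <= \sum_(k < n) series_term d (y k)) ->
  (forall r : R, 0 < r -> 0 < psi r) ->
  (forall x y : R, 0 < x -> x <= y -> psi x <= psi y) ->
  (forall k (r : R), 0 < r -> lam ^- k <= r -> r <= 1 -> psi r <= r `^ d * y k) ->
  hausdorff_measure_of psi mu = 0%E.
Proof.
move=> l1 y2 ymono unb psi_pos mono psiy; have l0 : 0 < lam by lra.
apply/eqP; rewrite eq_le; apply/andP; split; last first.
  by apply: le_ereal_inf_tmp => _ [A _ <-]; exact: hausdorff_ge0.
apply/lee_addgt0Pr => e e0; rewrite add0e.
have [c c0 tailge] := tail_at_ge conf d_gt d_lt1.
have [g g0 growth] := gden_growth conf d_gt d_lt1 l1.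
(* The constant [c] comes from the lower bound of the tails and [e] is the target: this [M] makes
   each covering set cost at most [e] times its mass. The covered set of full measure depends on
   [e], which the infimum over such sets permits. *)
pose M := (c * e)^-1; have M0 : 0 < M by rewrite invr_gt0 mulr_gt0.
(* From [Q w < lam^(g n)] and [2^(mm n) <= lam^n], the inverse scale [Q^2 2^(mm n)] is at most
   [lam^((2 g + 1) n)]. *)
pose L := (2 * g).+1.
have /choice[mm hmm] : forall n, exists m, [/\ (8 <= m)%N, M * y (L * n)%N < gauge d m &
    forall j, (8 <= j < m)%N -> gauge d j <= M * y (L * n)%N].
  by move=> n; exact: least_gauge.
have m8 n : (8 <= mm n)%N by case: (hmm n).
have m0 n : (0 < mm n)%N by exact: leq_trans (m8 n).
pose good n := (2 : R) ^+ mm n <= lam ^+ n.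
pose thr n := lam ^+ (g * n).
have [B B0 hB] := least_gauge_bound M0.
have [C C0 hC] := term_le_tailw d_gt d_lt1 B0.
have rho01 : 0 < expR (- ((2 * d - 1) * ln lam)) < 1.
  rewrite expR_gt0/= -[X in _ < X]expR0 ltr_expR oppr_lt0 mulr_gt0 ?ln_gt0//.
  by have := d_gt; lra.
have st0 k : 0 <= series_term d (y k).
  by apply/ltW/series_term_gt0; have := y2 k; lra.
have unbL := @unbounded_subsample R (fun k => series_term d (y k)) L (ltn0Sn _)
  (fun k l kl => series_term_le d_gt d_lt1 (lt_le_trans (ltr1n R 2 : 1 < 2) (y2 k)) (ymono k l kl)) st0 unb.
have unbg N := @unbounded_good R _ (fun n => tailw d (mm n)) good C _ N C0 rho01
  (fun n => ltW (tailw_gt0 d (m0 n))) (fun n => st0 (L * n)%N) _ _ unbL.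
have full : mu (~` limsup_hit mm good thr) = 0%E.
  apply: (limsup_hit_full conf d_gt d_lt1 m8 growth) => N; apply: unbg.
    by move=> n; apply: hC => //; apply: hB => //; case: (hmm n).
  by move=> n; rewrite /good -ltNge => /ltW; exact: tailw_le_ratio.
apply: (@le_trans _ _ (hausdorff psi (limsup_hit mm good thr))).
  apply: ereal_inf_lbound; exists (limsup_hit mm good thr) => //.
  by split=> //; exact: measurable_limsup_hit.
apply: (@hausdorff_limsup_hit_le _ mu) => //; first exact: ltW.
move=> n w [ww gn Qn]; have w2 := words_digits ww.
have Q1 : 1 <= Q w by exact: gden0_ge1.
have Q0 : 0 < Q w by exact: lt_le_trans Q1.
apply: (@le_trans _ _ (e%:E * (c * (Qd w * tailw d (mm n)))%:E)%E); last first.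
  by apply: lee_wpmul2l; [rewrite lee_fin ltW|exact: tailge ww (m8 n)].
rewrite -EFinM lee_fin.
set D := Q w ^+ 2 * 2 ^+ mm n.
have D0 : 0 < D by rewrite mulr_gt0 ?exprn_gt0.
have D1 : 1 <= D by rewrite -[leLHS]mul1r ler_pM// exprn_ege1// ler1n.
have DL : D <= lam ^+ (L * n).
  have -> : lam ^+ (L * n) = thr n ^+ 2 * lam ^+ n.
    by rewrite /thr -exprM -exprD; congr (_ ^+ _); rewrite /L; ring.
  by rewrite ler_pM ?exprn_ge0 ?(ltW Q0)// lerXn2r ?nnegrE ?exprn_ge0 ?(ltW Q0) ?(ltW l0)// ltW.
have [_ My _] := hmm n.
have y0 : 0 <= y (L * n)%N by have := y2 (L * n)%N; lra.
apply: le_trans (psiy (L * n)%N _ _ _ _) _.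
- by rewrite invr_gt0.
- by rewrite lef_pV2 ?posrE ?exprn_gt0.
- by rewrite invf_le1.
(* After this factorization, [y <= c e gauge] turns [2^(-m d)] into [c e] times the tail weight, the
   lower bound for the mass of the covering set. *)
have -> : D^-1 `^ d = Qd w * expR (- ((mm n)%:R * (d * ln 2))).
  rewrite !powR_expR ?invr_gt0// lnV ?posrE// lnM ?posrE ?exprn_gt0// !lnXn// -expRD; congr expR.
  by rewrite -[ln (Q w) *+ 2]mulr_natl -[ln 2 *+ _]mulr_natl; ring.
have {}My : y (L * n)%N <= c * e * gauge d (mm n).
  by move: My; rewrite /M mulrC ltr_pdivrMr ?mulr_gt0// mulrC => /ltW.
apply: le_trans (ler_wpM2l _ My) _; first by rewrite mulr_ge0 ?powR_ge0 ?expR_ge0.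
by rewrite tailw_gauge le_eqVlt; apply/orP; left; apply/eqP; ring.
Qed.

End ZeroMeasure.

Lemma series_converges_bounded (R : realType) (d : R) (y : nat -> R) (K : nat) (B : R) :
  (forall k, (K <= k)%N -> 1 < y k) ->
  (forall n, \sum_(K <= k < n) series_term d (y k) <= B) -> series_converges d y.
Proof.
move=> y1 hB; exists K; split=> //; apply: (@le_lt_trans _ _ B%:E); last exact: ltry.
apply: lime_le.
  by apply: is_cvg_nneseries => n Kn _; rewrite lee_fin; apply/ltW/series_term_gt0; exact: y1.
by apply: nearW => n; rewrite sumEFin lee_fin.
Qed.

(** Truncation keeps the terms meaningful where [y k <= 1]. Either [y] never exceeds 2 and the
    truncated terms are a positive constant, or it exceeds 2 from some index on and the truncation
    changes only finitely many terms. *)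
Lemma diverges_max2_unbounded (R : realType) (d : R) (y : nat -> R) :
  (forall k l, (k <= l)%N -> y k <= y l) -> ~ series_converges d y ->
  forall B, exists n, B <= \sum_(k < n) series_term d (Num.max 2 (y k)).
Proof.
move=> ymono div B; apply: contrapT => /forallNP small.
have {}small n : \sum_(k < n) series_term d (Num.max 2 (y k)) < B.
  by have /negP := small n; rewrite -ltNge.
have max1 k : 1 < Num.max 2 (y k) by rewrite lt_max ltr1n.
have [[K yK]|/forallNP y2] := pselect (exists K, 2 < y K); last first.
  have t2 : 0 < series_term d (2 : R) by apply: series_term_gt0; rewrite ltr1n.
  have [n Bn] := unbounded_const t2 B.
  move: (small n); rewrite ltNge => /negP; apply.
  rewrite (eq_bigr (fun=> series_term d 2)) // => k _; congr (series_term d _).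
  by apply: max_l; have /negP := y2 k; rewrite -leNgt.
have yKk k : (K <= k)%N -> 2 < y k by move=> Kk; apply: lt_le_trans yK (ymono _ _ Kk).
apply: div; apply: (@series_converges_bounded _ _ _ K B) => [k Kk|n].
  by apply: lt_trans (yKk k Kk); rewrite ltr1n.
apply: le_trans (ltW (small n)).
rewrite -(big_mkord xpredT (fun k => series_term d (Num.max 2 (y k)))).
have t0 k : 0 <= series_term d (Num.max 2 (y k)) by exact/ltW/series_term_gt0.
rewrite (@eq_big_nat _ _ _ K n _ (fun k => series_term d (Num.max 2 (y k)))); last first.
  by move=> k /andP[Kk _]; rewrite max_r// ltW// yKk.
have [Kn|/ltnW nK] := leqP K n; last by rewrite big_geq// sumr_ge0.
by rewrite [leRHS](@big_cat_nat _ _ _ K)//= lerDr sumr_ge0.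
Qed.

(** Where they are defined, the terms do not decrease, hence they do not tend to 0. *)
Lemma nonincreasing_diverges (R : realType) (d : R) (y : nat -> R) :
  2^-1 < d -> d < 1 -> (forall k l, (k <= l)%N -> y l <= y k) -> ~ series_converges d y.
Proof.
move=> d_gt d_lt1 ymono [K [y1 fin]].
have t0 k : (K <= k)%N -> 0 < series_term d (y k) by move=> /y1; exact: series_term_gt0.
have tK : 0 < series_term d (y K) / 2 by rewrite divr_gt0 ?t0.
have [k0 Kk0 /(_ 1%N)] := summable_tail (fun k Kk => ltW (t0 k Kk)) fin tK.
rewrite big_ord1 addn0 => small.
have := le_trans (series_term_le d_gt d_lt1 (y1 _ Kk0) (ymono _ _ Kk0)) small.
by have := t0 K (leqnn K); lra.
Qed.

Theorem theorem1 (R : realType) (delta : R) (mu : probability R R)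
  (psi : R -> R) (lambda : R) :
  pressure_is primes_set delta 0 ->
  conformal primes_set delta mu ->
  dimension_function psi ->
  doubling psi ->
  let Psi := fun r : R => psi r / r `^ delta in
  ((forall x y : R, 0 < x -> x <= y -> Psi x <= Psi y) \/
   (forall x y : R, 0 < x -> x <= y -> Psi y <= Psi x)) ->
  1 < lambda ->
  let y := fun k : nat => Psi (lambda ^- k) in
  (~ series_converges delta y -> hausdorff_measure_of psi mu = 0%E) /\
  (series_converges delta y -> hausdorff_measure_of psi mu = +oo%E).
Proof.
move=> _ conf [_ [psi_mono [psi_pos psi_cvg]]] _ Psi PsiM l1 y.
have d_lt1 := dim_lt1 conf; have d_gt := dim_gt_half conf.
have l0 : 0 < lambda by lra.
have lV k : 0 < lambda ^- k by rewrite invr_gt0 exprn_gt0.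
have lVle k l : (k <= l)%N -> lambda ^- l <= lambda ^- k.
  by move=> kl; rewrite lef_pV2 ?posrE ?exprn_gt0// ler_weXn2l// ltW.
have psiE r : 0 < r -> psi r = r `^ delta * Psi r.
  by move=> r0; rewrite /Psi mulrC divfK// gt_eqF// powR_gt0.
(* Increasing [Psi]: [y] is nonincreasing, so the series cannot converge. Radii up to 1 have
   [Psi r <= Psi 1], so a constant sequence can replace [y], and its series diverges trivially. *)
case: PsiM => PsiM.
  have dv : ~ series_converges delta y.
    by apply: nonincreasing_diverges => // k l kl; apply: PsiM (lVle _ _ kl).
  split=> // _; set c := Num.max 2 (Psi 1).
  have c2 : 2 <= c by rewrite le_max lexx.
  apply: (@hausdorff_measure_zero R delta mu conf d_gt d_lt1 psi (fun=> c) lambda) => //.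
    by apply: unbounded_const; apply: series_term_gt0; lra.
  move=> k r r0 _ r1; rewrite psiE// ler_wpM2l ?powR_ge0//.
  by rewrite le_max PsiM ?orbT.
(* Decreasing [Psi]: [y] is nondecreasing, and [Psi r] is at most [y k] for [r >= lambda^(-k)] and
   at least [y k] for [r <= lambda^(-k)], which are the bounds on [psi] that the two halves use. *)
have ymono k l : (k <= l)%N -> y k <= y l by move=> kl; apply: PsiM (lVle _ _ kl).
split=> [dv|[K [y1 fin]]].
  apply: (@hausdorff_measure_zero R delta mu conf d_gt d_lt1 psi
    (fun k => Num.max 2 (y k)) lambda) => //.
  - by move=> k; rewrite le_max lexx.
  - by move=> k l kl; rewrite le_max2// ymono.
  - exact: diverges_max2_unbounded.
  move=> k r r0 kr _; rewrite psiE// ler_wpM2l ?powR_ge0//.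
  by rewrite le_max PsiM ?orbT.
apply/eqP; rewrite -leye_eq; apply: le_ereal_inf_tmp => _ [A [mA fullA] <-].
rewrite leye_eq; apply/eqP.
apply: (hausdorff_infinite conf d_gt d_lt1 l1 y1 fin) => //; last first.
  by move=> k r r0 rk; rewrite psiE// ler_wpM2l ?powR_ge0// PsiM.
move=> e e' e0 e'0; have /cvgrPdist_lt/(_ e' e'0) := psi_cvg.
rewrite near_withinE => small.
have [eta /= eta0 hb] : exists2 eta : R, 0 < eta & ball (0 : R) eta `<=` [set r | 0 < r -> `|0 - psi r| < e'].
  by move/nbhs_ballP: small => [eta eta0 h]; exists eta.
pose r := Num.min e (eta / 2).
have r0 : 0 < r by rewrite lt_min e0 divr_gt0.
exists r; first by rewrite r0 ge_min lexx.
have : ball (0 : R) eta r.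
  rewrite /ball/= sub0r normrN gtr0_norm// gt_min; apply/orP; right.
  by rewrite ltr_pdivrMr// mulr_natr mulr2n ltrDl.
by move=> /hb /(_ r0); rewrite sub0r normrN gtr0_norm// psi_pos.
Qed.
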